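(* Let $\mathcal{P}=(P,d\mu,d\sigma)$ be an $n$-dimensional system with $n\ge2$. For every $T\in\mathbb{R}$ there exists $u\in\mathcal{M}^{\frac{n}{n-1}}(P)$ which minimizes $F_{\mathcal{P}}(T,\cdot)$ on $\mathcal{M}^{1}(P)$, i.e. $F_{\mathcal{P}}(T,u)\le F_{\mathcal{P}}(T,v)$ for all $v\in\mathcal{M}^1(P)$.
   Context: An $n$-dimensional system is a triple $\mathcal{P}=(P,d\mu,d\sigma)$ where $P$ is a simple polytope in an $n$-dimensional real affine space $V$ (a compact subset with non-empty interior that is a finite intersection of closed half spaces, such that every vertex is the intersection of exactly $n$ facets), $d\mu$ is the restriction to $P$ of a translation-invariant measure on $V$ that is positive and finite on bounded non-empty open sets (i.e. a positive multiple of Lebesgue measure), and $d\sigma$ is a measure on the boundary $\partial P$ whose restriction to each facet is a positive multiple of the Lebesgue measure of the affine hyperplane spanned by that facet. For $p\ge1$, $\mathcal{M}^p(P)$ is the set of lower semicontinuous functions $u:P\to(0,\infty]$ that are log-convex ($u((1-t)x+ty)\le u(x)^{1-t}u(y)^t$ for $x,y\in P$, $t\in[0,1]$) and satisfy $\int_P u\,d\mu=\int_P d\mu$ and $\int_P u^p\,d\mu<\infty$. For $u\in\mathcal{M}^1(P)$: entropy $S_{\mathcal{P}}(u):=-\frac{1}{\int_Pd\mu}\int_P u\log u\,d\mu\in[-\infty,0]$; internal $\mu$-energy $U_{\mathcal{P}}(u):=\frac{1}{\int_Pd\mu}\int_{\partial P}u\,d\sigma\in(0,\infty]$; and for $T\in\mathbb{R}$,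 free $\mu$-energy $F_{\mathcal{P}}(T,u):=U_{\mathcal{P}}(u)-TS_{\mathcal{P}}(u)$ if $S_{\mathcal{P}}(u)>-\infty$, and $F_{\mathcal{P}}(T,u):=+\infty$ if $S_{\mathcal{P}}(u)=-\infty$. *)

(* Defs.v *)
From HB Require Import structures.
From mathcomp Require Import all_boot all_order all_algebra.
From mathcomp Require Import all_classical all_reals all_analysis.
Set Implicit Arguments. Unset Strict Implicit. Unset Printing Implicit Defensive.
Import Order.TTheory GRing.Theory Num.Theory.
Import numFieldNormedType.Exports.
Local Open Scope classical_set_scope.
Local Open Scope ring_scope.

(* The n-dimensional real affine space V is modelled by row vectors    *)
(* 'rV[R]_n (with their normed topology).  We equip it with the Borel  *)
(* sigma-algebra, i.e. the sigma-algebra generated by the coordinate   *)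
(* projections (= product of Borel sigma-algebras = Borel of R^n).     *)
Section rV_measurable.
Context {R : realType} (n : nat).
Let coor : 'I_n -> 'rV[R]_n -> R := fun i x => x ord0 i.

Let rV_set0 : g_sigma_preimage coor set0.
Proof. exact: sigma_algebra0. Qed.
Let rV_setC A : g_sigma_preimage coor A -> g_sigma_preimage coor (~` A).
Proof. exact: sigma_algebraC. Qed.
Let rV_bigcup (F : (set 'rV[R]_n)^nat) : (forall i, g_sigma_preimage coor (F i)) ->
  g_sigma_preimage coor (\bigcup_i (F i)).
Proof. exact: sigma_algebra_bigcup. Qed.

HB.instance Definition _ := @isMeasurable.Build (measure_tuple_display default_measure_display)
  'rV[R]_n (g_sigma_preimage coor) rV_set0 rV_setC rV_bigcup.
End rV_measurable.

Section system.
Context {R : realType} {n : nat}.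
Local Notation V := 'rV[R]_n.

Definition dotv (x y : V) : R := \sum_(i < n) x ord0 i * y ord0 i.

Definition is_polytope (P : set V) : Prop :=
  compact P /\ (P° !=set0) /\
  exists (m : nat) (a : 'I_m -> V) (b : 'I_m -> R),
    (forall j, a j != 0) /\ P = [set x | forall j, dotv (a j) x <= b j].

Definition supporting (P : set V) (a : V) (b : R) : Prop :=
  a != 0 /\ forall x, P x -> dotv a x <= b.

Definition hyperplane (a : V) (b : R) : set V := [set x | dotv a x = b].

(* facets: faces P /\ H of P (H a supporting hyperplane) whose affine  *)
(* hull has dimension n-1, i.e. containing a point x0 and points       *)
(* x0 + M_i for n-1 linearly independent vectors M_i.                  *)
Definition facet_hyp (P : set V) (F : set V) (a : V) (b : R) : Prop :=
  supporting P a b /\ F = P `&` hyperplane a b /\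
  exists (x0 : V) (M : 'M[R]_(n.-1, n)),
    row_free M /\ F x0 /\ forall i, F (x0 + row i M).

Definition facet (P : set V) (F : set V) : Prop :=
  exists a b, facet_hyp P F a b.

Definition vertex (P : set V) (v : V) : Prop :=
  exists a b, supporting P a b /\ P `&` hyperplane a b = [set v].

Definition simple_polytope (P : set V) : Prop :=
  is_polytope P /\
  forall v, vertex P v ->
    exists F : 'I_n -> set V,
      injective F /\ (forall i, facet P (F i)) /\
      (forall G, facet P G -> G v -> exists i, G = F i) /\
      \bigcap_(i in [set: 'I_n]) F i = [set v].
End system.

(* A translation-invariant measure which is positive and finite on      *)
(* bounded non-empty open sets (i.e. a positive multiple of Lebesgue).  *)
Definition lebesgue_like {R : realType} {k : nat}
    (mu : {measure set 'rV[R]_k -> \bar R}) : Prop :=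
  (forall (A : set 'rV[R]_k) (t : 'rV[R]_k), measurable A ->
      mu [set x + t | x in A] = mu A) /\
  (forall O : set 'rV[R]_k, open O -> bounded_set O -> O !=set0 ->
      (0 < mu O)%E /\ (mu O < +oo)%E).

(* An n-dimensional system (P, dmu, dsigma).  dmu is a lebesgue_like     *)
(* measure (its restriction to P is used); dsigma is a measure on V      *)
(* concentrated on the boundary of P whose restriction to each facet F   *)
(* (spanned by the hyperplane {a.x = b}) is the image of a lebesgue_like *)
(* measure on R^(n-1) under an affine bijection R^(n-1) -> {a.x = b},    *)
(* i.e. a positive multiple of the Lebesgue measure of that hyperplane.  *)
Definition is_system {R : realType} {n : nat} (P : set 'rV[R]_n)
    (mu sigma : {measure set 'rV[R]_n -> \bar R}) : Prop :=
  simple_polytope P /\ lebesgue_like mu /\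
  sigma (~` (P `\` P°)) = 0%E /\
  forall F a b, facet_hyp P F a b ->
    exists (nu : {measure set 'rV[R]_(n.-1) -> \bar R})
           (x0 : 'rV[R]_n) (M : 'M[R]_(n.-1, n)),
      lebesgue_like nu /\ row_free M /\
      (forall y, hyperplane a b (x0 + y *m M)) /\
      (forall x, hyperplane a b x -> exists y, x = x0 + y *m M) /\
      forall A, measurable A ->
        sigma (A `&` F) = nu [set y | (A `&` F) (x0 + y *m M)].

Section functionals.
Context {R : realType} {n : nat}.
Local Notation V := 'rV[R]_n.
Local Open Scope ereal_scope.

Definition lsc_on (P : set V) (u : V -> \bar R) : Prop :=
  forall x, P x -> forall a : R, a%:E < u x ->
    exists2 e : R, (0 < e)%R & forall y, P y -> (`|y - x| < e)%R -> a%:E < u y.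

Definition log_convex_on (P : set V) (u : V -> \bar R) : Prop :=
  forall x y, P x -> P y -> forall t : R, (0 <= t <= 1)%R ->
    u ((1 - t) *: x + t *: y)%R <= poweR (u x) (1 - t) * poweR (u y) t.

Definition Mp (P : set V) (mu : {measure set V -> \bar R}) (p : R)
    (u : V -> \bar R) : Prop :=
  lsc_on P u /\ (forall x, P x -> 0 < u x) /\ log_convex_on P u /\
  \int[mu]_(x in P) u x = mu P /\
  \int[mu]_(x in P) poweR (u x) p < +oo.

Definition xlogx (s : \bar R) : \bar R :=
  match s with
  | r%:E => (r * ln r)%:E
  | +oo => +oo
  | -oo => 0
  end.

Definition entropy (P : set V) (mu : {measure set V -> \bar R})
    (u : V -> \bar R) : \bar R :=
  - ((fine (mu P))^-1)%:E * \int[mu]_(x in P) xlogx (u x).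

Definition internal_energy (P : set V) (mu sigma : {measure set V -> \bar R})
    (u : V -> \bar R) : \bar R :=
  ((fine (mu P))^-1)%:E * \int[sigma]_(x in P `\` P°) u x.

Definition free_energy (P : set V) (mu sigma : {measure set V -> \bar R})
    (T : R) (u : V -> \bar R) : \bar R :=
  if entropy P mu u == -oo then +oo
  else internal_energy P mu sigma u - T%:E * entropy P mu u.
End functionals.

(* Main.v *)
Require Import Defs.
From HB Require Import structures.
From mathcomp Require Import all_boot all_order all_algebra.
From mathcomp Require Import all_classical all_reals all_analysis.
From mathcomp Require Import measurable_realfun ring lra.
Set Implicit Arguments. Unset Strict Implicit. Unset Printing Implicit Defensive.
Import Order.TTheory GRing.Theory Num.Theory.
Import numFieldNormedType.Exports.
Local Open Scope classical_set_scope.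
Local Open Scope ring_scope.

(** Write p = n/(n-1).  A superlevel set A = {u > t} of a log-convex u on P has a convex
    complement, so along every line through a point of A one of the two exit points
    from P lies in A.  Comparing A with prisms over the traces of A on the faces gives
    an isoperimetric inequality mu(A) <= C r sigma(A /\ dP) as soon as
    sigma(A /\ dP) <= r^(n-1), and integration over dyadic levels yields
    int_P u^p <= C max(1, int_dP u)^p.  As s log s = o(s^p), the entropy is o(int_dP u), hence
    the free energy is bounded below and controls int_dP u.  Along a minimizing sequence
    the functions are therefore locally bounded and equi-Lipschitz in the interior; a
    subsequence converges there, the L^p bound makes the mass and the entropy converge,
    and the lower limit at the boundary of the limit function has no larger boundary
    integral by Fatou's lemma. *)

(** * Borel sets and invariant measures on R^n *)

(** Two obstacles shape the proof. A competitor may be infinite on the boundary, and [sigma] charges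
    exactly the set that [mu] does not see; so compactness is available only inside, and boundary
    values must be rebuilt from interior ones. Fatou then needs the rebuilt value to lie below the
    liminf of the sequence at every boundary point, where nothing converges a priori; log-convexity
    on segments to one interior point supplies this. Secondly, [T] has either sign, so
    semicontinuity of the entropy would not do: it has to converge, which requires uniform
    integrability of u log u and hence a bound with exponent p > 1.

    The exponent comes from taking r^(n-1) equal to the boundary measure in the isoperimetric
    inequality, which then reads mu(A) <= C s^(n/(n-1)) with s = sigma(A /\ dP). The form C r s is
    kept for the dyadic sum: r is estimated by Markov's inequality, but the factor s is left alone,
    since the sum of 2^k s_k is controlled by the boundary integral. Applying Markov to both factors
    would leave terms that do not decay in k. *)

Section sigma_finite_copy.
Context d (T : measurableType d) (R : realType) (mu : {measure set T -> \bar R})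
  (h : sigma_finite setT mu).
(** A name for [mu] that remembers a proof of sigma-finiteness, so that the corresponding structure
    can be attached to it; Tonelli's theorem is stated for that structure. *)
Definition sigma_finite_copy of sigma_finite setT mu : set T -> \bar R := mu.
Local Notation mu' := (sigma_finite_copy h).
HB.instance Definition _ := Measure.copy mu' mu.
HB.instance Definition _ := Measure_isSigmaFinite.Build d T R mu' h.
End sigma_finite_copy.

Section measurable_rV.
Context {R : realType} {n : nat}.
Local Notation V := 'rV[R]_n.

Lemma measurable_coord (i : 'I_n) : measurable_fun setT (fun x : V => x ord0 i).
Proof.
move=> _ Y mY; rewrite setTI; apply: sub_sigma_algebra => /=.
rewrite -bigcup_seq/=; exists i => /=; first by rewrite mem_index_enum.
by exists Y => //; rewrite setTI.
Qed.

Lemma measurable_rV d (T : measurableType d) (f : T -> V) :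
  (forall i, measurable_fun setT (fun t => f t ord0 i)) -> measurable_fun setT f.
Proof.
move=> mf _ A mA; rewrite setTI.
suff H : @measurable _ V `<=` [set B | measurable (f @^-1` B)] by exact: (H _ mA).
apply: smallest_sub.
  split => /=.
  - by rewrite preimage_set0.
  - by move=> B mB; rewrite setTD preimage_setC; exact: measurableC.
  - by move=> F mF; rewrite preimage_bigcup; exact: bigcupT_measurable.
rewrite -bigcup_seq/=; apply: bigcup_sub => i _ B [C mC <-] /=.
by have := mf i measurableT _ mC; rewrite !setTI.
Qed.

Lemma rV_ballE (x y : V) (e : R) : 0 < e ->
  ball x e y <-> forall i, `|x ord0 i - y ord0 i| < e.
Proof.
move=> e0; split => [[_ H] i|H]; first exact: (H ord0 i).
by split => // i j; rewrite (ord1 i); exact: H.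
Qed.

Lemma measurable_rV_ball (x : V) (e : R) : measurable (ball x e).
Proof.
have [e0|e0] := ltP 0 e; last first.
  by rewrite (_ : ball x e = set0)//; apply/seteqP; split => y // -[]; rewrite ltNge e0.
have -> : ball x e = \bigcap_(i in [set: 'I_n]) [set y : V | ball (x ord0 i) e (y ord0 i)].
  apply/seteqP; split => y.
    by move=> [_ H] i _; exact: (H ord0 i).
  by move=> H; split => // i j; rewrite (ord1 i); exact: (H j I).
apply: fin_bigcap_measurable => // i _.
have := measurable_coord i measurableT (measurable_ball (x ord0 i) e).
by rewrite setTI.
Qed.

(* An open set is the union of the balls with rational centre and radius that it contains. *)
Lemma open_measurable_rV (O : set V) : open O -> measurable O.
Proof.
move=> oO.
pose q (c : 'rV[rat]_n) : V := map_mx ratr c.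
pose F (c : 'rV[rat]_n * rat) := if `[< ball (q c.1) (ratr c.2) `<=` O >]
   then ball (q c.1) (ratr c.2) else set0.
have -> : O = \bigcup_c F c.
  apply/seteqP; split => [x Ox|x [c _]]; last first.
    by rewrite /F; case: asboolP => // H /H.
  have /nbhs_ballP[e /= e0 He] : nbhs x O by rewrite nbhsE; exists O.
  have e20 : 0 < e / 2 by rewrite divr_gt0.
  have [r] := rat_in_itvoo e20; rewrite in_itv /= => /andP[r0 re].
  have Hc i : exists c : rat, `|x ord0 i - ratr c| < ratr r.
    have xr : x ord0 i - ratr r < x ord0 i + ratr r by lra.
    have [c cx] := rat_in_itvoo xr; exists c.
    move: cx; rewrite in_itv /= => /andP[c1 c2].
    by rewrite ltr_norml; apply/andP; split; lra.
  have [c Hc'] := choice Hc.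
  pose c' := \row_i c i.
  have xb : ball (q c') (ratr r) x.
    apply/ball_sym/rV_ballE => // i; rewrite !mxE; exact: Hc'.
  exists (c', r) => //; rewrite /F; case: asboolP => //= Hn.
  exfalso; apply: Hn => y yb; apply: He.
  have -> : e = e / 2 + e / 2 by lra.
  apply: (@ball_triangle _ _ (q c')).
    by apply: ball_sym; apply: le_ball xb; lra.
  by apply: le_ball yb; lra.
apply: countable_bigcupT_measurable => [|c]; first exact: countableP.
rewrite /F; case: asboolP => // _.
exact: measurable_rV_ball.
Qed.

Lemma measurable_rVD d (T : measurableType d) (f g : T -> V) :
  measurable_fun setT f -> measurable_fun setT g ->
  measurable_fun setT (fun t => f t + g t).
Proof.
move=> mf mg; apply: measurable_rV => i.
rewrite (_ : (fun _ => _) = (fun t => f t ord0 i) \+ (fun t => g t ord0 i)); last first.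
  by apply/funext => t; rewrite mxE.
by apply: measurable_funD; apply: (measurableT_comp (measurable_coord i)).
Qed.

Lemma measurable_rVZ d (T : measurableType d) (f : T -> R) (g : T -> V) :
  measurable_fun setT f -> measurable_fun setT g ->
  measurable_fun setT (fun t => f t *: g t).
Proof.
move=> mf mg; apply: measurable_rV => i.
rewrite (_ : (fun _ => _) = f \* (fun t => g t ord0 i)); last first.
  by apply/funext => t; rewrite mxE.
by apply: measurable_funM => //; apply: (measurableT_comp (measurable_coord i)).
Qed.

Lemma measurable_dotv d (T : measurableType d) (a : V) (f : T -> V) :
  measurable_fun setT f -> measurable_fun setT (fun t => dotv a (f t)).
Proof.
move=> mf; rewrite /dotv; apply: measurable_sum => i.
by apply: measurable_funM => //; apply: (measurableT_comp (measurable_coord i)).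
Qed.

End measurable_rV.

Lemma measurable_mulmx {R : realType} {n m : nat} d (T : measurableType d)
    (M : 'M[R]_(n, m)) (f : T -> 'rV[R]_n) :
  measurable_fun setT f -> measurable_fun setT (fun t => f t *m M).
Proof.
move=> mf; apply: measurable_rV => i.
rewrite (_ : (fun _ => _) = fun t => \sum_(j < n) f t ord0 j * M j i); last first.
  by apply/funext => t; rewrite mxE.
apply: measurable_sum => j.
by apply: measurable_funM => //; apply: (measurableT_comp (measurable_coord j)).
Qed.

Lemma integral_sections d1 d2 (T1 : measurableType d1) (T2 : measurableType d2)
    (R : realType) (m1 : {measure set T1 -> \bar R}) (m2 : {measure set T2 -> \bar R})
    (E : set (T1 * T2)) :
  sigma_finite setT m1 -> sigma_finite setT m2 -> measurable E ->
  (\int[m1]_x m2 (xsection E x) = \int[m2]_y m1 (ysection E y))%E.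
Proof.
move=> h1 h2 mE.
have := indic_fubini_tonelli (sigma_finite_copy h1) (sigma_finite_copy h2) mE.
by rewrite indic_fubini_tonelli_FE// indic_fubini_tonelli_GE.
Qed.

Lemma eq_muleV (R : realType) (c : R) (x y : \bar R) : 0 < c ->
  (c%:E * x = y)%E -> x = (c^-1%:E * y)%E.
Proof. by move=> c0 <-; rewrite muleA -EFinM mulVf ?gt_eqF// mul1e. Qed.

Section lebesgue_like.
Context {R : realType} {n : nat}.
Local Notation V := 'rV[R]_n.
Implicit Types mu nu : {measure set V -> \bar R}.

Lemma bounded_rV_ball (x : V) (e : R) : bounded_set (ball x e).
Proof.
exists (`|x| + e); split; first exact: num_real.
move=> M xM y; rewrite -ball_normE /= => yb.
rewrite (le_trans _ (ltW xM))//.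
have -> : y = x - (x - y) by rewrite opprB addrCA subrr addr0.
by rewrite (le_trans (ler_normB _ _))// lerD2l ltW.
Qed.

(** Weaker than [lebesgue_like]: positivity on open sets is dropped. The push-forward in
    [facet_prism_le] is easily seen to be of this kind, while it vanishes for [L <= 0]. *)
Definition invariant_locally_finite mu :=
  (forall (A : set V) (t : V), measurable A -> mu [set x + t | x in A] = mu A) /\
  (forall A : set V, measurable A -> bounded_set A -> (mu A < +oo)%E).

Lemma lebesgue_like_ball mu (x : V) (e : R) : lebesgue_like mu -> 0 < e ->
  (0 < mu (ball x e) < +oo)%E.
Proof.
move=> [_ H] e0.
have bx : ball x e !=set0 by exists x; exact: ballxx.
by have [-> ->] := H _ (ball_open x e) (bounded_rV_ball x e) bx.
Qed.

Lemma bounded_sub_ball (A : set V) : bounded_set A -> exists2 r : R, 0 < r & A `<=` ball 0 r.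
Proof.
move=> [M [_ HM]]; exists (`|M| + 2); first by have := normr_ge0 M; lra.
move=> x Ax; rewrite -ball_normE /= sub0r normrN.
apply: (@le_lt_trans _ _ (`|M| + 1)); last by lra.
by apply: (HM (`|M| + 1)) => //; have := ler_norm M; lra.
Qed.

Lemma lebesgue_like_fin mu (A : set V) : lebesgue_like mu -> measurable A ->
  bounded_set A -> (mu A < +oo)%E.
Proof.
move=> lmu mA /bounded_sub_ball [r r0 Ar].
have /andP[_ H] := lebesgue_like_ball 0 lmu r0.
by apply: le_lt_trans H; apply: le_measure; rewrite ?inE//; exact: measurable_rV_ball.
Qed.

Lemma lebesgue_like_invariant mu : lebesgue_like mu -> invariant_locally_finite mu.
Proof.
by move=> lmu; split; [exact: lmu.1|move=> A mA bA; exact: lebesgue_like_fin].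
Qed.

Lemma invariant_sigma_finite mu : invariant_locally_finite mu -> sigma_finite setT mu.
Proof.
move=> lmu; exists (fun i => ball (0 : V) i.+1%:R).
  apply/esym/seteqP; split => // x _.
  exists (Num.trunc `|x|) => //; rewrite -ball_normE /= sub0r normrN.
  exact: truncnS_gt.
move=> i; split; first exact: measurable_rV_ball.
by apply: lmu.2; [exact: measurable_rV_ball|exact: bounded_rV_ball].
Qed.

Lemma invariant_shift mu (A : set V) (t : V) : invariant_locally_finite mu -> measurable A ->
  mu [set x | A (x + t)] = mu A.
Proof.
move=> [H _] mA; rewrite -(H A (- t) mA); congr (mu _).
apply/seteqP; split => [x Ax|_ [x Ax <-]] /=; last by rewrite subrK.
by exists (x + t) => //; rewrite addrK.
Qed.

Lemma measurable_shift (A : set V) (t : V) : measurable A -> measurable [set x | A (x + t)].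
Proof.
move=> mA; have := measurable_rVD (@measurable_id _ V setT) (@measurable_cst _ _ V V setT t).
by move/(_ measurableT _ mA); rewrite setTI.
Qed.

Lemma measurable_opp_rV (A : set V) : measurable A -> measurable [set x | A (- x)].
Proof.
move=> mA; suff /(_ measurableT _ mA) : measurable_fun setT (fun x : V => - x).
  by rewrite setTI.
rewrite (_ : (fun _ => _) = (fun x : V => (-1 : R) *: x)).
  exact: measurable_rVZ.
by apply/funext => x; rewrite scaleN1r.
Qed.

(* Both sides compute the [mu \x nu]-measure of {(x, y) | x + y in A, y in B}. *)
Lemma invariant_swap mu nu (A B : set V) :
  invariant_locally_finite mu -> invariant_locally_finite nu -> measurable A -> measurable B ->
  (mu A * nu B = nu A * mu [set x | B (- x)%R])%E.
Proof.
move=> lmu lnu mA mB.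
have smu := invariant_sigma_finite lmu; have snu := invariant_sigma_finite lnu.
have m1 : measurable_fun setT (fun z : V * V => z.1) by exact: measurable_fst.
have m2 : measurable_fun setT (fun z : V * V => z.2) by exact: measurable_snd.
have mD := measurable_rVD m1 m2.
have mB2 : measurable_fun setT (fun z : V * V => z.2 - z.1).
  apply: measurable_rVD => //.
  rewrite (_ : (fun _ => _) = (fun x : V * V => (-1 : R) *: x.1)).
    exact: measurable_rVZ.
  by apply/funext => x; rewrite scaleN1r.
pose E1 := [set z : V * V | A (z.1 + z.2)] `&` [set z | B z.2].
pose E2 := [set z : V * V | A z.2] `&` [set z | B (z.2 - z.1)].
have mE1 : measurable E1.
  apply: measurableI; [have := mD measurableT _ mA|have := m2 measurableT _ mB];
  by rewrite setTI.
have mE2 : measurable E2.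
  apply: measurableI; [have := m2 measurableT _ mA|have := mB2 measurableT _ mB];
  by rewrite setTI.
(* For fixed x, translating y by x carries one section onto the other. Once the order of integration
   is exchanged, the sections over a fixed y have constant measure on [B], respectively on [A], and
   the two products appear. *)
have key : (\int[mu]_x nu (xsection E1 x) = \int[mu]_x nu (xsection E2 x))%E.
  apply: eq_integral => x _.
  rewrite -(@invariant_shift nu (xsection E2 x) x)//; last exact: measurable_xsection.
  congr (nu _); apply/seteqP; split => y; rewrite /xsection /= !inE /= /E1 /E2 /=.
    by rewrite addrK addrC.
  by rewrite addrK addrC.
rewrite !integral_sections// in key.

have H1 : (\int[nu]_y mu (ysection E1 y) = mu A * nu B)%E.
  rewrite -integral_cst// [RHS]integral_mkcond; apply: eq_integral => y _.
  rewrite patchE; case: ifPn => yB /=.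
    rewrite -(invariant_shift y lmu mA); congr (mu _).
    by apply/seteqP; split => x; rewrite /ysection /E1 /= inE /=; [case|split => //; exact/set_mem].
  rewrite (_ : ysection E1 y = set0) ?measure0//.
  by apply/seteqP; split => x //; rewrite /ysection /E1 /= inE /= => -[_ /mem_set]; rewrite (negbTE yB).
have H2 : (\int[nu]_y mu (ysection E2 y) = mu [set x | B (- x)%R] * nu A)%E.
  rewrite -integral_cst// [RHS]integral_mkcond; apply: eq_integral => y _.
  rewrite patchE; case: ifPn => yA /=.
    rewrite -(invariant_shift (- y) lmu (measurable_opp_rV mB)); congr (mu _).
    apply/seteqP; split => x; rewrite /ysection /E2 /= inE /= opprB.
      by case.
    by split => //; exact/set_mem.
  rewrite (_ : ysection E2 y = set0) ?measure0//.
  by apply/seteqP; split => x //; rewrite /ysection /E2 /= inE /= => -[/mem_set]; rewrite (negbTE yA).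
by rewrite -H1 key H2 muleC.
Qed.

(** Take [nu = mu] and a ball for the first set in [invariant_swap]; the measure of the ball is
    positive and finite, so it cancels. *)
Lemma lebesgue_like_opp mu (A : set V) : lebesgue_like mu -> measurable A ->
  mu [set x | A (- x)] = mu A.
Proof.
move=> lmu mA; have mb : measurable (ball (0 : V) 1) by exact: measurable_rV_ball.
have /andP[b0 boo] := lebesgue_like_ball 0 lmu ltr01.
have imu := lebesgue_like_invariant lmu.
have := invariant_swap imu imu mb mA.
have bfin : mu (ball (0 : V) 1) = (fine (mu (ball (0 : V) 1)))%:E.
  by rewrite fineK// ge0_fin_numE// ltW.
have m0 : 0 < fine (mu (ball (0 : V) 1)) by rewrite fine_gt0// b0.
rewrite bfin => /(eq_muleV m0) ->.
by rewrite muleA -EFinM mulVf ?gt_eqF// mul1e.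
Qed.

(** Uniqueness of Haar measure: in [invariant_swap] let [B] be the unit ball, which is symmetric.
    The constant is the quotient of the two measures of that ball, possibly 0. *)
Lemma invariant_unique mu nu : invariant_locally_finite mu -> lebesgue_like nu ->
  exists2 c : R, 0 <= c & forall A, measurable A -> mu A = (c%:E * nu A)%E.
Proof.
move=> imu lnu; have mb : measurable (ball (0 : V) 1) by exact: measurable_rV_ball.
have /andP[b0' boo'] := lebesgue_like_ball 0 lnu ltr01.
have bfin : mu (ball (0 : V) 1) = (fine (mu (ball (0 : V) 1)))%:E.
  by rewrite fineK// ge0_fin_numE// imu.2//; exact: bounded_rV_ball.
have bfin' : nu (ball (0 : V) 1) = (fine (nu (ball (0 : V) 1)))%:E.
  by rewrite fineK// ge0_fin_numE// ltW.
have n0 : 0 < fine (nu (ball (0 : V) 1)) by rewrite fine_gt0// b0'.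
exists (fine (mu (ball (0 : V) 1)) / fine (nu (ball (0 : V) 1))).
  by rewrite divr_ge0// ?ltW// fine_ge0.
move=> A mA; have := invariant_swap imu (lebesgue_like_invariant lnu) mA mb.
rewrite (_ : [set x | ball 0 1 (- x)] = ball (0 : V) 1); last first.
  by apply/seteqP; split => x; rewrite -ball_normE /= !sub0r ?normrN.
rewrite bfin bfin' muleC => /(eq_muleV n0) ->.
by rewrite [in RHS]mulrC EFinM -muleA [(nu A * _)%E]muleC.
Qed.

End lebesgue_like.

Lemma pushforward_restr_measure d1 d2 (T1 : measurableType d1) (T2 : measurableType d2)
    (R : realType) (m : {measure set T1 -> \bar R}) (f : T1 -> T2) (S : set T1) :
  measurable_fun setT f -> measurable S ->
  exists m' : {measure set T2 -> \bar R}, forall A, m' A = m (f @^-1` A `&` S).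
Proof.
move=> mf mS; exists (measure_function_pushforward__canonical__measure_function_Measure
  (mrestr m mS) mf).
by move=> A.
Qed.

(** * Prisms over faces *)

Section dotv.
Context {R : realType} {n : nat}.
Local Notation V := 'rV[R]_n.
Implicit Types x y a : V.

Lemma dotvDr a x y : dotv a (x + y) = dotv a x + dotv a y.
Proof. by rewrite /dotv -big_split; apply: eq_bigr => i _; rewrite mxE mulrDr. Qed.

Lemma dotvZr a x (c : R) : dotv a (c *: x) = c * dotv a x.
Proof. by rewrite /dotv mulr_sumr; apply: eq_bigr => i _; rewrite mxE mulrCA. Qed.

Lemma dotvNr a x : dotv a (- x) = - dotv a x.
Proof. by rewrite -scaleN1r dotvZr mulN1r. Qed.

Lemma dotvBr a x y : dotv a (x - y) = dotv a x - dotv a y.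
Proof. by rewrite dotvDr dotvNr. Qed.

Lemma dotv0r a : dotv a 0 = 0.
Proof. by rewrite -(scale0r a) dotvZr mul0r. Qed.

Lemma dotvC x y : dotv x y = dotv y x.
Proof. by apply: eq_bigr => i _; rewrite mulrC. Qed.

Lemma dotv_gt0 a : a != 0 -> 0 < dotv a a.
Proof.
move=> a0; rewrite lt_neqAle sumr_ge0 ?andbT => [|i _]; last by rewrite -expr2 sqr_ge0.
apply: contra a0; rewrite eq_sym psumr_eq0 => [/allP H|i _]; last by rewrite -expr2 sqr_ge0.
apply/eqP/rowP => i; rewrite mxE; apply/eqP.
by have := H i (mem_index_enum _); rewrite -expr2 sqrf_eq0.
Qed.

Lemma coord_norm_le x (i : 'I_n) : `|x ord0 i| <= `|x|.
Proof. by rewrite [leRHS]/Num.norm /= mx_normrE; exact: (le_bigmax _ _ (ord0, i)). Qed.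

Lemma rV_norm_le x (r : R) : 0 <= r -> (forall i, `|x ord0 i| <= r) -> `|x| <= r.
Proof.
move=> r0 H; rewrite [leLHS]/Num.norm /= mx_normrE.
by apply/bigmax_leP; split => // -[i j] _ /=; rewrite (ord1 i).
Qed.

Lemma dotv_le a x : `|dotv a x| <= (\sum_(i < n) `|a ord0 i|) * `|x|.
Proof.
rewrite mulr_suml; apply: le_trans (ler_norm_sum _ _ _) _.
by apply: ler_sum => i _; rewrite normrM ler_wpM2l// coord_norm_le.
Qed.

End dotv.

Lemma mulmx_norm_le (R : realType) (m n : nat) (M : 'M[R]_(m, n)) :
  exists2 C : R, 0 <= C & forall y : 'rV[R]_m, `|y *m M| <= C * `|y|.
Proof.
exists (\sum_(i < n) \sum_(j < m) `|M j i|).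
  by apply: sumr_ge0 => i _; apply: sumr_ge0.
move=> y; apply: rV_norm_le => [|i].
  by rewrite mulr_ge0//; apply: sumr_ge0 => i _; apply: sumr_ge0.
rewrite mxE; apply: (@le_trans _ _ (\sum_(j < m) `|M j i| * `|y|)).
  apply: le_trans (ler_norm_sum _ _ _) _.
  by apply: ler_sum => j _; rewrite normrM mulrC ler_wpM2l// coord_norm_le.
rewrite -mulr_suml ler_wpM2r// (bigD1 i)//= lerDl.
by apply: sumr_ge0 => k _; apply: sumr_ge0.
Qed.

Section packing.
Context {R : realType} {n : nat}.
Local Notation V := 'rV[R]_n.
Implicit Types mu : {measure set V -> \bar R}.

(* The translates of [E] by multiples of [v] are disjoint, since [E] lies in a slab. *)
Lemma packing mu (E G : set V) (a v : V) (k : nat) :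
  lebesgue_like mu -> measurable E -> measurable G ->
  (forall x y, E x -> E y -> dotv a x - dotv a y < dotv a v) ->
  (forall i x, (i < k)%N -> E (x + i%:R *: v) -> G x) ->
  (k%:R%:E * mu E <= mu G)%E.
Proof.
move=> lmu mE mG slab EG.
pose F (i : nat) := [set x | E (x + i%:R *: v)].
have mF i : measurable (F i) by exact: measurable_shift.
have tF : trivIset setT F.
  apply/trivIsetP => i j _ _ ij; apply/seteqP; split => // x [Ei Ej] /=.
  have := slab _ _ Ei Ej; have := slab _ _ Ej Ei; rewrite !dotvDr !dotvZr => h1 h2.
  have av : 0 < dotv a v by have := slab _ _ Ei Ei; rewrite subrr.
  move: ij; rewrite neq_ltn => /orP[] ij.
    by have : i.+1%:R <= j%:R :> R; [rewrite ler_nat | rewrite -natr1; nra].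
  by have : j.+1%:R <= i%:R :> R; [rewrite ler_nat | rewrite -natr1; nra].
have -> : (k%:R%:E * mu E = \sum_(i < k) mu (F i))%E.
  rewrite (eq_bigr (fun=> mu E)) => [|i _]; last first.
    exact: invariant_shift (lebesgue_like_invariant lmu) mE.
  by rewrite sumr_const card_ord mule_natl; case: k {EG}.
rewrite -(measure_bigsetU mu)//; apply: le_measure; rewrite ?inE//.
  exact: bigsetU_measurable.
by rewrite -bigcup_mkord => x [i /= ik Ex]; apply: EG Ex.
Qed.

(** The k+1 translates of [E] by multiples of a/(k+1) are disjoint and stay in one ball whose size
    does not depend on k. *)
Lemma hyperplane_null mu (E : set V) (a : V) (c : R) :
  lebesgue_like mu -> measurable E -> bounded_set E -> a != 0 ->
  (forall x, E x -> dotv a x = c) -> mu E = 0%E.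
Proof.
move=> lmu mE /bounded_sub_ball[r r0 Er] a0 Ec.
have mG := @measurable_rV_ball R n 0 (r + `|a|).
have Goo : (mu (ball 0%R (r + `|a|)%R) < +oo)%E.
  by apply: (lebesgue_like_invariant lmu).2 => //; exact: bounded_rV_ball.
have H k : (k.+1%:R%:E * mu E <= mu (ball 0%R (r + `|a|)%R))%E.
  apply: (@packing mu E _ a (k.+1%:R^-1 *: a)) => // [x y Ex Ey|i x ik Ex].
    by rewrite (Ec _ Ex) (Ec _ Ey) subrr dotvZr mulr_gt0// ?invr_gt0// dotv_gt0.
  have := Er _ Ex; rewrite -!ball_normE /= !sub0r !normrN => xr.
  rewrite -[x](addrK (i%:R *: (k.+1%:R^-1 *: a))).
  apply: le_lt_trans (ler_normB _ _) _; apply: ltr_leD => //.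
  rewrite !normrZ mulrA ler_piMl// normfV !normr_nat.
  by rewrite ler_pdivrMr// mul1r ler_nat ltnW.
have Eoo : mu E = (fine (mu E))%:E.
  by rewrite fineK// ge0_fin_numE//; have := H 0%N; rewrite mul1e => /le_lt_trans ->.
apply/eqP; rewrite eq_le measure_ge0 andbT leNgt; apply/negP => E0.
have e0 : 0 < fine (mu E) by rewrite -lte_fin -Eoo.
have Gfin : mu (ball (0 : V) (r + `|a|)) = (fine (mu (ball (0 : V) (r + `|a|))))%:E.
  by rewrite fineK// ge0_fin_numE.
have := H (Num.trunc (fine (mu (ball (0 : V) (r + `|a|))) / fine (mu E))).
rewrite Eoo Gfin -EFinM lee_fin -ler_pdivlMr// leNgt.
by rewrite truncnS_gt.
Qed.

End packing.

Section exit.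
Context {R : realType} {n : nat}.
Local Notation V := 'rV[R]_n.
Implicit Types (a w z : V) (b : R).

Definition exit_time a b w z : R := (b - dotv a z) / dotv a w.
Definition exit_point a b w z : V := z + exit_time a b w z *: w.

Lemma dotv_exit_point a b w z : dotv a w != 0 -> dotv a (exit_point a b w z) = b.
Proof. by move=> aw; rewrite dotvDr dotvZr /exit_time; field. Qed.

Lemma exit_timeD a b w z t : dotv a w != 0 ->
  exit_time a b w (z + t *: w) = exit_time a b w z - t.
Proof. by move=> aw; rewrite /exit_time dotvDr dotvZr; field. Qed.

Lemma exit_pointD a b w z t : dotv a w != 0 ->
  exit_point a b w (z + t *: w) = exit_point a b w z.
Proof.
move=> aw; rewrite /exit_point exit_timeD// -addrA -scalerDl.
by congr (_ + _ *: _); rewrite addrC subrK.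
Qed.

Lemma measurable_exit_time a b w : measurable_fun setT (exit_time a b w).
Proof.
apply: measurable_funM => //; apply: measurable_funB => //.
exact: (measurable_dotv a (@measurable_id _ V setT)).
Qed.

Lemma measurable_exit_point a b w : measurable_fun setT (exit_point a b w).
Proof.
apply: measurable_rVD; first exact: measurable_id.
by apply: measurable_rVZ; [exact: measurable_exit_time|exact: measurable_cst].
Qed.

(** An oblique cylinder of length [L] in time along [w], lying behind its base, which is the part of
    [B] on the hyperplane. It is half open so that translates along [w] can be stacked without
    overlap. *)
Definition prism a b w (L : R) (B : set V) : set V :=
  [set z | 0 <= exit_time a b w z < L] `&` [set z | B (exit_point a b w z)].

Lemma measurable_prism a b w L B : measurable B -> measurable (prism a b w L B).
Proof.
move=> mB; apply: measurableI; last first.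
  by have := measurable_exit_point a b w measurableT mB; rewrite setTI.
have := measurable_exit_time a b w measurableT (measurable_itv `[0, L[).
by rewrite setTI; congr measurable; apply/seteqP; split => z /=; rewrite in_itv.
Qed.

End exit.

(** With k = trunc(L/delta) >= 1 one has L < (k+1) delta <= 2 k delta, so 1/k <= 2 delta/L. *)
Lemma slice_le (R : realType) (L delta : R) (x y : \bar R) : 0 < delta <= L ->
  (0 <= x)%E -> (0 <= y)%E ->
  ((Num.trunc (L / delta))%:R%:E * x <= y)%E -> (x <= (2 * delta / L)%:E * y)%E.
Proof.
move=> /andP[d0 dL] x0 y0; have L0 : 0 < L by apply: lt_le_trans dL.
set k := Num.trunc _ => H.
have Lk : L < k.+1%:R * delta by rewrite -ltr_pdivrMr// truncnS_gt.
have k0 : (0 < k)%N by rewrite truncn_gt0 ler_pdivlMr// mul1r.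
have kp : (0 : R) < k%:R by rewrite ltr0n.
have k1 : (k%:R : R)^-1 <= 2 * delta / L.
  rewrite -[leRHS]invrK lef_pV2 ?posrE ?invr_gt0 ?divr_gt0 ?mulr_gt0 ?ltr0n//.
  rewrite invf_div ler_pdivrMr ?mulr_gt0//.
  have : (1 : R) <= k%:R by rewrite ler1n.
  by move: Lk; rewrite -natr1; nra.
apply: (@le_trans _ _ ((k%:R : R)^-1%:E * y)%E).
  have kV0 : (0 <= ((k%:R : R)^-1)%:E)%E by rewrite lee_fin invr_ge0.
  have := lee_wpmul2l kV0 H.
  by rewrite muleA -EFinM mulVf ?gt_eqF// mul1e.
by apply: lee_wpmul2r; rewrite ?lee_fin.
Qed.

Section facet_prism.
Context {R : realType} {n : nat}.
Local Notation V := 'rV[R]_n.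
Variables (mu sigma : {measure set V -> \bar R}) (a w : V) (b L : R).
Hypotheses (lmu : lebesgue_like mu) (aw : dotv a w != 0).

(** A translation by [t *m M] is parallel to the hyperplane, so it preserves exit times and moves
    the chart coordinate [Y] of the exit point by [t]. Hence the image under [Y] of [mu] restricted
    to the slab of exit times is translation invariant on R^(n-1), and uniqueness makes it a
    multiple of [nu]. *)
Lemma facet_prism_le (F : set V) (nu : {measure set 'rV[R]_(n.-1) -> \bar R})
    (x0 : V) (M : 'M[R]_(n.-1, n)) :
  lebesgue_like nu -> row_free M -> measurable F ->
  (forall y, hyperplane a b (x0 + y *m M)) ->
  (forall x, hyperplane a b x -> exists y, x = x0 + y *m M) ->
  (forall A, measurable A -> sigma (A `&` F) = nu [set y | (A `&` F) (x0 + y *m M)]) ->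
  exists2 C : R, 0 <= C & forall B, measurable B ->
    (mu (prism a b w L (B `&` F)) <= C%:E * sigma (B `&` F))%E.
Proof.
move=> lnu fM mF hy hx hs.
have aM y : dotv a (y *m M) = 0.
  have := hy y; have := hy 0; rewrite /hyperplane /= mul0mx addr0 dotvDr => -> h; lra.
pose Y z := (exit_point a b w z - x0) *m pinvmx M.
have mY : measurable_fun setT Y.
  apply: measurable_mulmx; apply: measurable_rVD; last exact: measurable_cst.
  exact: measurable_exit_point.
have YM z : x0 + Y z *m M = exit_point a b w z.
  have [y ey] := hx _ (dotv_exit_point b z aw).
  have e0 : x0 + y *m M - x0 = y *m M by rewrite addrC addKr.
  by rewrite /Y ey e0 mulmxKp.
pose S := [set z | 0 <= exit_time a b w z < L].
have mS : measurable S.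
  have := measurable_prism a b w L (@measurableT _ V).
  by rewrite (_ : prism _ _ _ _ _ = S)//; apply/seteqP; split => z //= [].
have [m mE] := pushforward_restr_measure mu mY mS.
have sM t z : exit_time a b w (z - t *m M) = exit_time a b w z.
  by rewrite /exit_time dotvBr aM subr0.
have YD t z : Y (z - t *m M) = Y z - t.
  rewrite /Y /exit_point sM; set e := exit_time _ _ _ _.
  have -> : z - t *m M + e *: w - x0 = (z + e *: w - x0) - t *m M.
    by rewrite -!addrA; congr (_ + _); rewrite addrCA; congr (_ + _); rewrite addrC.
  by rewrite mulmxBl mulmxKp.
have im : invariant_locally_finite m.
  split=> [A t mA|A mA /bounded_sub_ball[r r0 Ar]].
    rewrite !mE -[in RHS](invariant_shift (- (t *m M)) (lebesgue_like_invariant lmu)).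
      congr (mu _); apply/seteqP; split => z /=.
        by move=> [[x Ax xY] Sz]; split; rewrite /= /S /= ?YD ?sM// -xY addrK.
      rewrite YD /S /= sM => -[AY Sz]; split => //.
      by exists (Y z - t) => //; rewrite subrK.
    by apply: measurableI => //; have := mY measurableT _ mA; rewrite setTI.
  rewrite mE; apply: (lebesgue_like_invariant lmu).2.
    by apply: measurableI => //; have := mY measurableT _ mA; rewrite setTI.
  have [C C0 HC] := mulmx_norm_le M.
  exists (`|x0| + C * r + `|L| * `|w|); split; first exact: num_real.
  move=> K HK z [/= AY /andP[S1 S2]]; apply: le_trans (ltW HK).
  have -> : z = x0 + Y z *m M - exit_time a b w z *: w by rewrite YM addrK.
  apply: le_trans (ler_normB _ _) _; apply: lerD.
    apply: le_trans (ler_normD _ _) _; rewrite lerD2l.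
    apply: le_trans (HC _) _; rewrite ler_wpM2l//.
    by have := Ar _ AY; rewrite -ball_normE /= sub0r normrN => /ltW.
 by rewrite normrZ ler_wpM2r// (ger0_norm S1) ger0_norm ?(le_trans S1)// ltW.
have [c c0 mc] := invariant_unique im lnu.
exists c => // B mB.
have mD : measurable [set y | (B `&` F) (x0 + y *m M)].
  have : measurable_fun setT (fun y : 'rV[R]_(n.-1) => x0 + y *m M).
    apply: measurable_rVD; first exact: measurable_cst.
    by apply: measurable_mulmx; exact: measurable_id.
  by move/(_ measurableT _ (measurableI _ _ mB mF)); rewrite setTI.
rewrite hs// -mc// mE; rewrite le_eqVlt; apply/orP; left; apply/eqP; congr (mu _).
by apply/seteqP; split => z []; rewrite /prism /S /= YM.
Qed.

(* Slicing the prism of height L into k >= L/(2 delta) translates of the one of height delta. *)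
Lemma prism_scale (G : set V) (delta : R) : measurable G -> 0 < delta <= L ->
  (mu (prism a b w delta G) <= (2 * delta / L)%:E * mu (prism a b w L G))%E.
Proof.
move=> mG /andP[d0 dL]; apply: slice_le => //; first by rewrite d0.
set k := Num.trunc _.
have kL : k%:R * delta <= L.
  by rewrite -ler_pdivlMr// truncn_le divr_ge0// ltW// (lt_le_trans d0 dL).
apply: (packing (a := (dotv a w)^-1 *: a) (v := delta *: w)) => //.
- exact: measurable_prism.
- exact: measurable_prism.
- move=> x y [/= /andP[x0 xd] _] [/= /andP[y0 yd] _]; move: x0 xd y0 yd.
  have dl z : dotv ((dotv a w)^-1 *: a) z = dotv a z / dotv a w.
    by rewrite dotvC dotvZr (dotvC z) mulrC.
  rewrite !dl dotvZr mulfK// /exit_time !mulrBl; lra.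
- move=> i x ik [/= /andP[x0 xd] xG].
  have xE : x = (x + i%:R *: (delta *: w)) + (- (i%:R * delta)) *: w.
    by rewrite scalerA scaleNr addrK.
  rewrite xE; split; rewrite /= ?exit_pointD// exit_timeD// opprK.
  apply/andP; split; first by rewrite addr_ge0// mulr_ge0// ltW.
  apply: lt_le_trans kL; rewrite -ltrBrDr -mulrBl; apply: lt_le_trans xd _.
  by rewrite ler_peMl ?(ltW d0)// lerBrDr nat1r ler_nat.
Qed.

End facet_prism.

Lemma measure_fin_cover d (T : measurableType d) (R : realType)
    (mu : {measure set T -> \bar R}) (I : finType) (A : set T) (A_ : I -> set T) :
  measurable A -> (forall i, measurable (A_ i)) -> A `<=` \bigcup_i A_ i ->
  (mu A <= \sum_i mu (A_ i))%E.
Proof.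
move=> mA mA_ AA.
have TE : [set: I] = [set` index_enum I].
  by apply/seteqP; split => i // _ /=; rewrite mem_index_enum.
rewrite (@fsbig_seq _ _ _ I (index_enum I) (fun i => mu (A_ i)) (index_enum_uniq I)) -TE.
apply: content_sub_fsum => //; rewrite TE; exact: finite_seq.
Qed.

(** Take a maximal independent family of r differences. If r < n-1, adding the row [w] gives at most
    n-1 rows, so there is still a nonzero vector orthogonal to all of them. Orthogonality to [w] is
    what makes whole prisms flat, not only their bases. *)
Lemma affine_flat (R : realType) (n : nat) (F : set 'rV[R]_n) (x0 w : 'rV[R]_n) :
  (0 < n)%N ->
  (exists M : 'M[R]_(n.-1, n), row_free M /\ forall i, F (x0 + row i M)) \/
  (exists2 a : 'rV[R]_n, a != 0 & dotv a w = 0 /\ forall y, F y -> dotv a (y - x0) = 0).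
Proof.
move=> n0.
pose Q r := exists M : 'M[R]_(r, n), row_free M /\ forall i, F (x0 + row i M).
have Q0 : Q 0%N by exists 0; split => [|[]//]; rewrite /row_free mxrank0.
have [Qn|nQn] := pselect (Q n.-1); [by left|right].
have [r [rn Qr nQr]] : exists r, [/\ (r < n.-1)%N, Q r & ~ Q r.+1].
  elim: (n.-1) nQn => [/(_ Q0)//|k IH] Qk.
  have [Qk'|/IH[r [rk ? ?]]] := pselect (Q k); first by exists k.
  by exists r; split => //; exact: ltnW.
have [M [fM FM]] := Qr.
have FsubM y : F y -> (y - x0 <= M)%MS.
  move=> Fy; apply/negPn/negP => nM; apply: nQr; suff : Q (1 + r)%N by [].
  exists (col_mx (y - x0) M); split.
    rewrite /row_free eqn_leq rank_leq_row /= leqNgt; apply/negP => H.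
    have : (M < (y - x0) + M)%MS.
      by rewrite /ltmx addsmxSr /= addsmx_sub negb_and nM.
    by move/rank_ltmx; rewrite addsmxE (eqP fM) ltnNge -ltnS H.
  move=> i; have := @splitK 1 r i; case: (fintype.split (i : 'I_(1 + r))) => j <- /=.
    by rewrite rowKu (ord1 j) row_id addrCA subrr addr0.
  by rewrite rowKd.
pose N := col_mx w M.
have : kermx N^T != 0.
  rewrite -mxrank_eq0 mxrank_ker subn_eq0 -ltnNge mxrank_tr.
  apply: leq_ltn_trans (rank_leq_row _) _.
  by rewrite add1n; move: rn; rewrite -ltnS prednK.
case/rowV0Pn => a /sub_kermxP aN a0; exists a => //.
have dE (u v : 'rV[R]_n) : dotv u v = (u *m v^T) ord0 ord0.
  by rewrite mxE; apply: eq_bigr => i _; rewrite mxE.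
move: aN; rewrite /N tr_col_mx mul_mx_row => /eqP; rewrite -row_mx0 => /eqP/eq_row_mx[aw aM].
split; first by rewrite dE aw mxE.
move=> y /FsubM/submxP[D ->].
by rewrite dE trmx_mul mulmxA aM mul0mx mxE.
Qed.

Lemma bounded_subset (R : realType) (V : normedModType R) (A B : set V) :
  A `<=` B -> bounded_set B -> bounded_set A.
Proof. by move=> AB [K [? H]]; exists K; split => // K' /H HK x /AB /HK. Qed.

Section constraint.
Context {R : realType} {n : nat}.
Local Notation V := 'rV[R]_n.
Variables (mu sigma : {measure set V -> \bar R}) (P : set V).
Hypotheses (n0 : (0 < n)%N) (lmu : lebesgue_like mu) (mP : measurable P) (bP : bounded_set P).
Hypothesis hsigma : forall F a b, facet_hyp P F a b ->
    exists (nu : {measure set 'rV[R]_(n.-1) -> \bar R})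
           (x0 : 'rV[R]_n) (M : 'M[R]_(n.-1, n)),
      lebesgue_like nu /\ row_free M /\
      (forall y, hyperplane a b (x0 + y *m M)) /\
      (forall x, hyperplane a b x -> exists y, x = x0 + y *m M) /\
      forall A, measurable A ->
        sigma (A `&` F) = nu [set y | (A `&` F) (x0 + y *m M)].

Lemma measurable_hyperplane (a : V) b : measurable (hyperplane a b).
Proof.
have := measurable_dotv a (@measurable_id _ V setT) measurableT (measurable_set1 b).
by rewrite setTI.
Qed.

Lemma bounded_prism (a w : V) b L B : bounded_set B -> bounded_set (prism a b w L B).
Proof.
move=> [K [_ BK]]; exists (`|K| + 1 + `|L| * `|w|); split; first exact: num_real.
move=> K' KK' z [/= /andP[S1 S2] zB].
have -> : z = exit_point a b w z - exit_time a b w z *: w by rewrite addrK.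
apply: le_trans (ler_normB _ _) _; apply: le_trans (ltW KK'); apply: lerD.
  by apply: BK zB; rewrite (le_lt_trans (ler_norm K))// ltrDl.
by rewrite normrZ ler_wpM2r// (ger0_norm S1) ger0_norm ?(le_trans S1)// ltW.
Qed.

(* A face of P which is not a facet is so flat that its prisms lie in a hyperplane. *)
Lemma face_prism_le (a w : V) (b L : R) : a != 0 -> (forall x, P x -> dotv a x <= b) ->
  dotv a w != 0 -> 0 < L ->
  exists2 C : R, 0 <= C & forall B delta, measurable B -> 0 < delta <= L ->
    (mu (prism a b w delta (B `&` (P `&` hyperplane a b))) <=
       (C * delta)%:E * sigma (B `&` (P `&` hyperplane a b)))%E.
Proof.
move=> a0 Pab aw L0; set F := P `&` hyperplane a b.
have mF : measurable F by apply: measurableI => //; exact: measurable_hyperplane.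
have bF : bounded_set F by apply: bounded_subset bP; exact: subIsetl.
have [[x0 Fx0]|F0] := pselect (F !=set0); last first.
  exists 0 => // B d mB _; rewrite mul0r mul0e.
  rewrite (_ : prism _ _ _ _ _ = set0) ?measure0//.
  by apply/seteqP; split => z // [_ [_ Fz]]; apply: F0; exists (exit_point a b w z).
have [[M [fM FM]]|[a' a'0 [a'w a'F]]] := affine_flat F x0 w n0.
  have [|nu [x1 [M1 [lnu [fM1 [hy [hx hs]]]]]]] := @hsigma F a b.
    by split; [split|split => //; exists x0, M].
  have [C C0 HC] := facet_prism_le L lmu aw lnu fM1 mF hy hx hs.
  exists (2 / L * C); first by rewrite mulr_ge0// divr_ge0// ltW.
  move=> B d mB dL; have mBF := measurableI _ _ mB mF.
  apply: le_trans (prism_scale b lmu aw mBF dL) _.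
  have -> : 2 / L * C * d = (2 * d / L) * C by field; rewrite gt_eqF.
  rewrite [(2 * d / L * C)%:E]EFinM -muleA; apply: lee_wpmul2l; last exact: HC.
  by case/andP: dL => d0 _; rewrite lee_fin divr_ge0// ?mulr_ge0// ltW.
exists 0 => // B d mB _; rewrite mul0r mul0e.
rewrite (@hyperplane_null _ _ mu _ a' (dotv a' x0)) //.
- by apply: measurable_prism; exact: measurableI.
- by apply: bounded_prism; apply: bounded_subset bF; exact: subIsetr.
- move=> z [_ [_ /a'F]]; rewrite dotvBr dotvDr dotvZr a'w mulr0 addr0 => h; lra.
Qed.

End constraint.

(** * Isoperimetric estimates for co-convex sets *)

Section balls.
Context {R : realType} {n : nat}.
Local Notation V := 'rV[R]_n.

(** The norm on row vectors is the maximum of the coordinates, so balls are cubes and a cubic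
    lattice of spacing [d] is a net. *)
Definition grid (D d : R) (N : nat) (f : {ffun 'I_n -> 'I_N}) : V :=
  \row_i (- D + (f i)%:R * d).

Lemma grid_net (D d : R) (x : V) : 0 < d -> ball 0 D x ->
  exists f : {ffun 'I_n -> 'I_(Num.trunc (2 * D / d)).+1}, ball (grid D d f) d x.
Proof.
move=> d0 xD.
have xi i : - D < x ord0 i < D.
  rewrite -ltr_norml; apply: le_lt_trans (coord_norm_le _ _) _.
  by move: xD; rewrite -ball_normE /= sub0r normrN.
exists [ffun i => inord (Num.trunc ((x ord0 i + D) / d))].
apply/rV_ballE => // i; rewrite !mxE ffunE.
have xD0 : 0 <= (x ord0 i + D) / d.
  by apply: divr_ge0; [have := xi i; lra|exact: ltW].
rewrite inordK; last first.
  rewrite ltnS; apply: le_truncn; rewrite ler_pM2r ?invr_gt0//.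
  by have := xi i; lra.
have : (Num.trunc ((x ord0 i + D) / d))%:R * d <= x ord0 i + D.
  by rewrite -ler_pdivlMr// truncn_le.
have : x ord0 i + D < (Num.trunc ((x ord0 i + D) / d)).+1%:R * d.
  by rewrite -ltr_pdivrMr// truncnS_gt.
rewrite -natr1 mulrDl mul1r => h1 h2; rewrite ltr_norml; lra.
Qed.

Variable mu : {measure set V -> \bar R}.
Hypothesis lmu : lebesgue_like mu.

Lemma ball_measure (x : V) (d : R) : mu (ball x d) = mu (ball 0 d).
Proof.
rewrite -(invariant_shift (- x) (lebesgue_like_invariant lmu) (measurable_rV_ball 0 d)).
congr (mu _); apply/seteqP; split => y; rewrite -!ball_normE /= sub0r normrN.
  by rewrite distrC.
by rewrite distrC.
Qed.

(** The right order d^n comes from counting: N^n translates of the ball of radius d cover the ball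
    of radius D, with N <= 3 D/d because d <= D. *)
Lemma ball_measure_ge (D : R) : 0 < D -> exists2 c : R, 0 < c &
  forall (x : V) (d : R), 0 < d <= D -> ((c * d ^+ n)%:E <= mu (ball x d))%E.
Proof.
move=> D0; have /andP[b0 boo] := lebesgue_like_ball 0 lmu D0.
have bfin : mu (ball (0 : V) D) = (fine (mu (ball (0 : V) D)))%:E.
  by rewrite fineK// ge0_fin_numE// ltW.
have m0 : 0 < fine (mu (ball (0 : V) D)) by rewrite fine_gt0// b0.
exists (fine (mu (ball (0 : V) D)) / (3 * D) ^+ n).
  by rewrite divr_gt0// exprn_gt0// mulr_gt0.
move=> x d /andP[d0 dD]; set N := (Num.trunc (2 * D / d)).+1.
have H := @measure_fin_cover _ _ _ mu {ffun 'I_n -> 'I_N} (ball 0 D)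
  (fun f => ball (grid D d f) d) (measurable_rV_ball _ _)
  (fun f => measurable_rV_ball _ _) _.
have {H}/H : ball 0 D `<=` \bigcup_f ball (grid D d (f : {ffun 'I_n -> 'I_N})) d.
  by move=> y /(grid_net d0)[f yf]; exists f.
rewrite (eq_bigr (fun=> mu (ball 0 d))) => [|f _]; last by rewrite ball_measure.
have /andP[c0 coo] := lebesgue_like_ball 0 lmu d0.
have cfin : mu (ball (0 : V) d) = (fine (mu (ball (0 : V) d)))%:E.
  by rewrite fineK// ge0_fin_numE// ltW.
rewrite bfin cfin sumEFin !lee_fin sumr_const cardT -cardE card_ffun !card_ord => H.
rewrite (ball_measure x) cfin lee_fin.
have N3 : N%:R <= 3 * D / d.
  rewrite /N -natr1; apply: (@le_trans _ _ (2 * D / d + 1)).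
    by rewrite lerD2r truncn_le; apply: divr_ge0; [apply: mulr_ge0 => //|]; exact: ltW.
  have : 1 <= D / d by rewrite ler_pdivlMr// mul1r.
  by rewrite -!mulrA; lra.
have m0' : 0 <= fine (mu (ball (0 : V) d)) by rewrite fine_ge0.
rewrite -mulr_natl natrX in H.
have H' : fine (mu (ball 0 D)) <= (3 * D / d) ^+ n * fine (mu (ball (0 : V) d)).
  apply: le_trans H _; rewrite ler_wpM2r//; apply: lerXn2r => //; rewrite nnegrE ?ler0n//.
  by apply: divr_ge0; [apply: mulr_ge0 => //|]; exact: ltW.
have E0 : 0 < (3 * D) ^+ n by rewrite exprn_gt0// mulr_gt0.
have dn0 : 0 < d ^+ n by rewrite exprn_gt0.
move: H'; rewrite expr_div_n => H'; have := ler_wpM2r (ltW dn0) H'.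
set A0 := fine _; set A1 := fine _; set K := (3 * D) ^+ n; rewrite -/K in E0.
have -> : K / d ^+ n * A1 * d ^+ n = A1 * K by field; rewrite gt_eqF.
by move=> h; rewrite mulrAC ler_pdivrMr.
Qed.

End balls.

Section polytope.
Context {R : realType} {n m : nat}.
Local Notation V := 'rV[R]_n.
Variables (aa : 'I_m -> V) (bb : 'I_m -> R) (mu sigma : {measure set V -> \bar R}).
Local Notation P := [set x | forall j, dotv (aa j) x <= bb j].
Hypotheses (n0 : (0 < n)%N) (lmu : lebesgue_like mu) (bP : bounded_set P).
Hypothesis aa0 : forall j, aa j != 0.
Hypothesis hsigma : forall F a b, facet_hyp P F a b ->
    exists (nu : {measure set 'rV[R]_(n.-1) -> \bar R})
           (x0 : 'rV[R]_n) (M : 'M[R]_(n.-1, n)),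
      lebesgue_like nu /\ row_free M /\
      (forall y, hyperplane a b (x0 + y *m M)) /\
      (forall x, hyperplane a b x -> exists y, x = x0 + y *m M) /\
      forall A, measurable A ->
        sigma (A `&` F) = nu [set y | (A `&` F) (x0 + y *m M)].

Lemma measurable_polytope : measurable P.
Proof.
rewrite (_ : P = \bigcap_(j in [set: 'I_m]) [set x | dotv (aa j) x <= bb j]); last first.
  by apply/seteqP; split => x H j; [move=> _|]; exact: H.
apply: fin_bigcap_measurable => // j _.
have := measurable_dotv (aa j) (@measurable_id _ V setT) measurableT (measurable_itv `]-oo, bb j]).
by rewrite setTI; congr measurable; apply/seteqP; split => z /=; rewrite in_itv.
Qed.

Lemma polytope_convex (x y : V) (t : R) : 0 <= t <= 1 -> P x -> P y ->
  P ((1 - t) *: x + t *: y).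
Proof.
move=> /andP[t0 t1] Px Py j; rewrite dotvDr !dotvZr.
by have := Px j; have := Py j; nra.
Qed.

Lemma face_boundary (x : V) j : P x -> dotv (aa j) x = bb j -> (P `\` P°) x.
Proof.
move=> Px jx; split => // /nbhs_ballP[e /= e0 He].
have a0 := dotv_gt0 (aa0 j).
pose t := e / 2 / (`|aa j| + 1).
have t0 : 0 < t by rewrite !divr_gt0// ltr_wpDl.
have /He/(_ j) : ball x e (x + t *: aa j).
  rewrite -ball_normE /= opprD addrA subrr sub0r normrN normrZ gtr0_norm// /t.
  rewrite mulrAC ltr_pdivrMr ?ltr_wpDl//.
  by have := normr_ge0 (aa j); nra.
by rewrite dotvDr dotvZr jx; nra.
Qed.

(** Only faces that [w] crosses outward contribute. Prisms may stick out of [P], which does no harm: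
    they serve only as covers of [A] and are bounded in measure from above. *)
Definition face_prism (w : V) (delta : R) (A : set V) j : set V :=
  if 0 < dotv (aa j) w then
    prism (aa j) (bb j) w delta (A `&` (P `&` hyperplane (aa j) (bb j))) else set0.

Definition exit_prism w delta A := \bigcup_j face_prism w delta A j.

Lemma measurable_face_prism w delta A j : measurable A -> measurable (face_prism w delta A j).
Proof.
move=> mA; rewrite /face_prism; case: ifP => // _; apply: measurable_prism.
apply: measurableI => //; apply: measurableI; first exact: measurable_polytope.
exact: measurable_hyperplane.
Qed.

Lemma measurable_exit_prism w delta A : measurable A -> measurable (exit_prism w delta A).
Proof.
move=> mA; apply: fin_bigcup_measurable => [|j _]; first exact: finite_finset.
exact: measurable_face_prism.
Qed.

(** [face_prism_le] summed over the faces. The constant depends on the direction [w], so later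
    arguments must get by with finitely many directions fixed in advance. *)
Lemma exit_prism_le (w : V) (L : R) : 0 < L -> exists2 C : R, 0 <= C &
  forall A delta, measurable A -> measurable (A `&` (P `\` P°)) -> 0 < delta <= L ->
    (mu (exit_prism w delta A) <= (C * delta)%:E * sigma (A `&` (P `\` P°)))%E.
Proof.
move=> L0; have mP := measurable_polytope.
have H j : exists C : R, 0 <= C /\ forall A delta,
    measurable A -> measurable (A `&` (P `\` P°)) -> 0 < delta <= L ->
    (mu (face_prism w delta A j) <= (C * delta)%:E * sigma (A `&` (P `\` P°)))%E.
  rewrite /face_prism; case jw : (0 < dotv (aa j) w); last first.
    by exists 0; split => // A d _ _ _; rewrite measure0 mul0r mul0e.
  have jw0 : dotv (aa j) w != 0 by rewrite gt_eqF.
  have [C C0 HC] := face_prism_le n0 lmu mP bP hsigma (aa0 j) (fun x (Px : P x) => Px j) jw0 L0.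
  exists C; split => // A d mA mAP dL; apply: le_trans (HC _ _ mA dL) _.
  apply: lee_wpmul2l; first by rewrite lee_fin mulr_ge0// ltW//; case/andP: dL.
  apply: le_measure; rewrite ?inE//.
    apply: measurableI => //; apply: measurableI => //; exact: measurable_hyperplane.
  by move=> x [Ax [Px hx]]; split => //; exact: face_boundary hx.
have [C HC] := choice H.
exists (\sum_j C j); first by apply: sumr_ge0 => j _; exact: (HC j).1.
move=> A d mA mAP dL.
apply: le_trans (measure_fin_cover mu _ _ (@subset_refl _ (exit_prism w d A))) _.
- exact: measurable_exit_prism.
- by move=> j; exact: measurable_face_prism.
apply: (@le_trans _ _ (\sum_j ((C j * d)%:E * sigma (A `&` (P `\` P°))))%E).
  by apply: lee_sum => j _; exact: (HC j).2.
rewrite -ge0_sume_distrl => [|j _]; last first.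
  by rewrite lee_fin mulr_ge0// ?(HC j).1// ltW//; case/andP: dL.
by rewrite sumEFin -mulr_suml.
Qed.

(** The exit face is the constraint that first becomes tight along the ray; one exists because the
    bounded set [P] contains no ray. *)
Lemma exit_exists (z w : V) : P z -> w != 0 ->
  exists j, [/\ 0 < dotv (aa j) w, 0 <= exit_time (aa j) (bb j) w z &
    P (exit_point (aa j) (bb j) w z)].
Proof.
move=> Pz w0.
have [j0 j0w] : exists j, 0 < dotv (aa j) w.
  apply: contrapT => /forallNP H.
  have [r r0 Pr] := bounded_sub_ball bP.
  have nw : 0 < `|w| by rewrite normr_gt0.
  pose t := (r + `|z|) / `|w|.
  have t0 : 0 <= t by rewrite divr_ge0// addr_ge0// ltW.
  have tw : t * `|w| = r + `|z| by rewrite mulfVK// gt_eqF.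
  have : P (z + t *: w).
    by move=> j; rewrite dotvDr dotvZr; have := Pz j; have /negP := H j; rewrite -leNgt; nra.
  move/Pr; rewrite -ball_normE /= sub0r normrN => h.
  have : `|t *: w| <= `|z + t *: w| + `|z|.
    by rewrite -{1}[t *: w](addKr z) addrC ler_normB.
  by rewrite normrZ (ger0_norm t0) tw; move: h; lra.
pose j := [arg min_(i < j0 | 0 < dotv (aa i) w) exit_time (aa i) (bb i) w z]%O.
have [jw jmin] : 0 < dotv (aa j) w /\ forall i, 0 < dotv (aa i) w ->
    exit_time (aa j) (bb j) w z <= exit_time (aa i) (bb i) w z.
  by rewrite /j; case: arg_minP.
have s0 : 0 <= exit_time (aa j) (bb j) w z by apply: divr_ge0; [rewrite subr_ge0; exact: Pz|exact: ltW].
exists j; split => // i; rewrite dotvDr dotvZr.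
have [iw|iw] := ltP 0 (dotv (aa i) w).
  by have := jmin _ iw; rewrite [X in _ <= X -> _]/exit_time ler_pdivlMr//; lra.
by have := Pz i; nra.
Qed.

End polytope.

Definition co_convex (R : realType) (n : nat) (P A : set 'rV[R]_n) : Prop :=
  A `<=` P /\ forall x y t, 0 <= t <= 1 -> P x -> P y ->
    A ((1 - t) *: x + t *: y) -> A x \/ A y.

Section polytope.
Context {R : realType} {n m : nat}.
Local Notation V := 'rV[R]_n.
Variables (aa : 'I_m -> V) (bb : 'I_m -> R) (mu sigma : {measure set V -> \bar R}).
Local Notation P := [set x | forall j, dotv (aa j) x <= bb j].
Hypotheses (n0 : (0 < n)%N) (lmu : lebesgue_like mu) (bP : bounded_set P).
Hypothesis aa0 : forall j, aa j != 0.
Hypothesis hsigma : forall F a b, facet_hyp P F a b ->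
    exists (nu : {measure set 'rV[R]_(n.-1) -> \bar R})
           (x0 : 'rV[R]_n) (M : 'M[R]_(n.-1, n)),
      lebesgue_like nu /\ row_free M /\
      (forall y, hyperplane a b (x0 + y *m M)) /\
      (forall x, hyperplane a b x -> exists y, x = x0 + y *m M) /\
      forall A, measurable A ->
        sigma (A `&` F) = nu [set y | (A `&` F) (x0 + y *m M)].

(** About L/tau translates of [E] by multiples of [tau *: w] are disjoint, since [E] is thin in the
    direction [a]. Moving back by at most [L] keeps them in the exit prism of length 2L, whose
    measure is known. The normal [a] of the slab need not be related to the faces. *)
Lemma tower_le (w : V) (L : R) : 0 < L -> exists2 C : R, 0 <= C &
  forall A E (a : V) tau, measurable A -> measurable (A `&` (P `\` P°)) ->
    measurable E -> E `<=` exit_prism aa bb w L A -> 0 < tau <= L ->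
    (forall x y, E x -> E y -> dotv a x - dotv a y < tau * dotv a w) ->
    (mu E <= (C * tau)%:E * sigma (A `&` (P `\` P°)))%E.
Proof.
move=> L0; have L20 : 0 < 2 * L by rewrite mulr_gt0.
have [C C0 HC] := exit_prism_le n0 lmu bP aa0 hsigma w L20.
exists (4 * C); first by rewrite mulr_ge0.
move=> A E a tau mA mAP mE EL tauL slab; case/andP: (tauL) => t0 tL.
have mG := measurable_exit_prism aa bb w (2 * L) mA.
set k := Num.trunc (L / tau).
have kL : k%:R * tau <= L.
  by rewrite -ler_pdivlMr// truncn_le; apply: divr_ge0; exact: ltW.
have H : (k%:R%:E * mu E <= mu (exit_prism aa bb w (2 * L) A))%E.
  apply: (packing (a := a) (v := tau *: w)) => //.
    by move=> x y Ex Ey; rewrite dotvZr; exact: slab.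
  move=> i x ik /EL[j _]; rewrite /face_prism; case: ifP => // jw [/= /andP[s0 sL] xG].
  exists j => //; rewrite /face_prism jw.
  have xE : x = (x + i%:R *: (tau *: w)) + (- (i%:R * tau)) *: w.
    by rewrite scalerA scaleNr addrK.
  rewrite xE; split; rewrite /= ?exit_pointD ?gt_eqF//.
  rewrite exit_timeD ?gt_eqF// opprK; apply/andP; split.
    by rewrite addr_ge0// mulr_ge0// ltW.
  apply: (@lt_le_trans _ _ (L + i%:R * tau)); first by rewrite ltrD2r.
  have : i%:R * tau <= k%:R * tau by rewrite ler_pM2r// ler_nat ltnW.
  by move: kL; lra.
have {H} := slice_le tauL (measure_ge0 _ _) (measure_ge0 _ _) H.
move/le_trans; apply.
have L2L : 0 < 2 * L <= 2 * L by rewrite L20 lexx.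
have c0 : (0 <= (2 * tau / L)%:E)%E by rewrite lee_fin divr_ge0// ?mulr_ge0// ltW.
apply: le_trans (lee_wpmul2l c0 (HC A _ mA mAP L2L)) _.
rewrite muleA -EFinM.
by have -> : 2 * tau / L * (C * (2 * L)) = 4 * C * tau by field; rewrite gt_eqF.
Qed.

(* Along a line through z one of the two exit points from P lies in A. *)
Lemma co_convex_exit (A : set V) (L r : R) (z w : V) : co_convex P A -> A z -> w != 0 ->
  P `<=` ball 0 r -> 2 * r < L * `|w| ->
  (exit_prism aa bb w L A `|` exit_prism aa bb (- w) L A) z.
Proof.
move=> [AP coA] Az w0 Pr rL; have Pz := AP _ Az.
have w0' : - w != 0 by rewrite oppr_eq0.
have [j [jw s0 Py]] := exit_exists bP Pz w0.
have [j' [jw' s0' Py']] := exit_exists bP Pz w0'.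
have nw : 0 < `|w| by rewrite normr_gt0.
have sL i v : `|v| = `|w| -> 0 <= exit_time (aa i) (bb i) v z -> P (exit_point (aa i) (bb i) v z) ->
    exit_time (aa i) (bb i) v z < L.
  move=> vw si /Pr; have := Pr _ Pz; rewrite -!ball_normE /= !sub0r !normrN => zr yr.
  have : `|exit_time (aa i) (bb i) v z *: v| < 2 * r.
    rewrite -[_ *: v](addKr z) addrC; apply: le_lt_trans (ler_normB _ _) _.
    by move: yr; rewrite /exit_point; lra.
  rewrite normrZ ger0_norm// vw => h; rewrite -(ltr_pM2r nw); lra.
have hA i v : 0 < dotv (aa i) v -> `|v| = `|w| -> 0 <= exit_time (aa i) (bb i) v z ->
    P (exit_point (aa i) (bb i) v z) -> A (exit_point (aa i) (bb i) v z) ->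
    exit_prism aa bb v L A z.
  move=> iv vw si Pi Ai; exists i => //; rewrite /face_prism iv; split.
    by rewrite /= si sL.
  by split => //; split => //; by rewrite /hyperplane /= dotv_exit_point// gt_eqF.
set s := exit_time _ _ _ _ in s0; set s' := exit_time _ _ _ _ in s0'.
(* If both exit times vanish, [z] is itself an exit point; otherwise [z] is a convex combination of
   the two exit points and co-convexity applies. *)
have [ss|ss] := eqVneq (s + s') 0.
  have s00 : s = 0 by apply/eqP; rewrite eq_le s0 andbT -ss lerDl.
  by left; apply: (hA j) => //; rewrite /exit_point -/s s00 scale0r addr0.
have ss0 : 0 < s + s' by rewrite lt_neqAle eq_sym ss addr_ge0.
have t01 : 0 <= s' / (s + s') <= 1.
  by apply/andP; split; [exact: divr_ge0 (ltW ss0)|rewrite ler_pdivrMr// mul1r lerDr].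
have zE : (1 - s' / (s + s')) *: exit_point (aa j') (bb j') (- w) z
    + (s' / (s + s')) *: exit_point (aa j) (bb j) w z = z.
  rewrite /exit_point -/s -/s'; apply/rowP => i; rewrite !mxE; field.
  by [].
have [Ay'|Ay] := coA _ _ _ t01 Py' Py (eq_ind_r A Az zE).
  by right; apply: (hA j') => //; rewrite ?normrN.
by left; apply: (hA j).
Qed.

End polytope.

Section polytope.
Context {R : realType} {n m : nat}.
Local Notation V := 'rV[R]_n.
Variables (aa : 'I_m -> V) (bb : 'I_m -> R) (mu sigma : {measure set V -> \bar R}).
Local Notation P := [set x | forall j, dotv (aa j) x <= bb j].
Hypotheses (n0 : (0 < n)%N) (lmu : lebesgue_like mu) (bP : bounded_set P).
Hypothesis aa0 : forall j, aa j != 0.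
Hypothesis hsigma : forall F a b, facet_hyp P F a b ->
    exists (nu : {measure set 'rV[R]_(n.-1) -> \bar R})
           (x0 : 'rV[R]_n) (M : 'M[R]_(n.-1, n)),
      lebesgue_like nu /\ row_free M /\
      (forall y, hyperplane a b (x0 + y *m M)) /\
      (forall x, hyperplane a b x -> exists y, x = x0 + y *m M) /\
      forall A, measurable A ->
        sigma (A `&` F) = nu [set y | (A `&` F) (x0 + y *m M)].

Lemma ball_reflect (x y : V) d : ball x d y -> ball x d (x + x - y).
Proof.
rewrite -!ball_normE /= => h; suff -> : x - (x + x - y) = - (x - y) by rewrite normrN.
by apply/rowP => i; rewrite !mxE; ring.
Qed.

(* Of two points symmetric about x one lies in A, so A fills half of the ball. *)
Lemma co_convex_half_ball (A : set V) (x : V) (d : R) : measurable A -> co_convex P A ->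
  A x -> ball x d `<=` P -> (mu (ball x d) <= 2%:E * mu (ball x d `&` A))%E.
Proof.
move=> mA [AP coA] Ax xdP.
have mB := measurable_rV_ball x d; set E := ball x d `&` A.
have mE : measurable E by exact: measurableI.
pose E' := [set y | E (y + (x + x))].
have mE' : measurable E' by exact: measurable_shift.
have EE' : mu [set y | E' (- y)] = mu E.
  rewrite lebesgue_like_opp//; exact: invariant_shift (lebesgue_like_invariant lmu) mE.
have -> : (2%:E * mu E = mu E + mu [set y | E' (- y)%R])%E.
  by rewrite EE' mule_natl.
have mE'' := measurable_opp_rV mE'.
apply: le_trans (measureU2 _ mE mE''); apply: le_measure; rewrite ?inE//.
  exact: measurableU.
move=> y By; have By' := ball_reflect By.
have half : 0 <= (2^-1 : R) <= 1 by lra.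
have xE : (1 - 2^-1) *: y + 2^-1 *: (x + x - y) = x.
  by apply/rowP => i; rewrite !mxE; field.
have [Ay|Ay] := coA _ _ _ half (xdP _ By) (xdP _ By') (eq_ind_r A Ax xE).
  by left.
by right; rewrite /E' /= addrC.
Qed.

(** By co-convexity [A] fills half of the ball, so it has measure of order d^n there. On the other
    hand the ball has width 2d along the coordinate vector [e], and every point of [A] lies in an
    exit prism for [e] or [- e]; so [tower_le] bounds the same measure by a constant times d sigma(A
    /\ dP). Dividing by d gives the claim. *)
Lemma depth_le : exists2 C : R, 0 <= C & forall A x d,
  measurable A -> measurable (A `&` (P `\` P°)) -> co_convex P A ->
  A x -> 0 < d -> ball x d `<=` P ->
  ((d ^+ n.-1)%:E <= C%:E * sigma (A `&` (P `\` P°)))%E.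
Proof.
have [r r0 Pr] := bounded_sub_ball bP.
pose e : V := delta_mx ord0 (Ordinal n0).
have ee : dotv e e = 1.
  rewrite /dotv (bigD1 (Ordinal n0))//= mxE !eqxx mulr1 big1 ?addr0// => i /negbTE i0.
  by rewrite mxE eqxx i0 mulr0.
have e0 : e != 0 by apply: contra_eq_neq ee => ->; rewrite dotv0r eq_sym oner_eq0.
have de (z : V) : dotv e z = z ord0 (Ordinal n0).
  rewrite /dotv (bigD1 (Ordinal n0))//= mxE !eqxx mul1r big1 ?addr0// => i /negbTE i0.
  by rewrite mxE eqxx i0 mul0r.
have ne : `|e| = 1.
  apply/eqP; rewrite eq_le; apply/andP; split.
    by apply: rV_norm_le => // i; rewrite mxE; case: (_ && _); rewrite ?normr1 ?normr0.
  by have := coord_norm_le e (Ordinal n0); rewrite mxE !eqxx normr1.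
(* Since [|e| = 1] and [P] lies in the ball of radius r, this [L] exceeds every exit time, and it is
   at least 2d once d <= r. *)
pose L := 2 * r + 1; have L0 : 0 < L by rewrite /L; lra.
have [C1 C10 HC1] := tower_le n0 lmu bP aa0 hsigma e L0.
have [C2 C20 HC2] := tower_le n0 lmu bP aa0 hsigma (- e) L0.
have [c c0 Hc] := ball_measure_ge lmu r0.
exists (2 / c * (2 * (C1 + C2))); first by apply: mulr_ge0; [apply: divr_ge0; rewrite ?ltW|rewrite mulr_ge0// addr_ge0].
move=> A x d mA mAP coA Ax d0 xdP; have [AP _] := coA.
(* A ball inside [P] has radius at most r: otherwise [x + r *: e] and [x - r *: e] would lie in the
   open ball of radius r, though their distance is 2r. *)
have dr : d <= r.
  rewrite leNgt; apply/negP => rd.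
  have xr : ball 0 r x by apply: Pr; exact: AP.
  have hx (s : R) : `|s| < d -> `|x + s *: e| < r.
    move=> sd; have : ball x d (x + s *: e).
      by rewrite -ball_normE /= opprD addrA subrr sub0r normrN normrZ ne mulr1.
    by move/xdP/Pr; rewrite -ball_normE /= sub0r normrN.
  have r' : `|r| < d by rewrite gtr0_norm.
  have h1 := hx _ r'; have h2 := hx (- r); rewrite normrN in h2; have {}h2 := h2 r'.
  have : `|(x + r *: e) - (x + (- r) *: e)| < r + r.
    by apply: le_lt_trans (ler_normB _ _) _; exact: ltrD.
  rewrite opprD addrACA subrr add0r scaleNr opprK -scalerDl normrZ ne mulr1.
  by rewrite gtr0_norm ?addr_gt0// ltxx.
set B := A `&` _; pose E := ball x d `&` A.
have mB := measurable_rV_ball x d.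
have mE : measurable E by exact: measurableI.
have [mG1 mG2] := (measurable_exit_prism aa bb e L mA, measurable_exit_prism aa bb (- e) L mA).
have slab (s : R) y z : `|s| = 1 -> E y -> E z -> dotv (s *: e) y - dotv (s *: e) z < 2 * d * dotv (s *: e) (s *: e).
  move=> s1 [+ _] [+ _]; rewrite -!ball_normE /= => yd zd.
  have dse u : dotv (s *: e) u = s * dotv e u by rewrite dotvC dotvZr (dotvC u).
  have ss : s * s = 1 by rewrite -expr2 -real_normK ?num_real// s1 expr1n.
  rewrite !dse dotvZr ee mulr1 ss mulr1 -mulrBr; apply: le_lt_trans (ler_norm _) _.
  rewrite normrM s1 mul1r -dotvBr de; apply: le_lt_trans (coord_norm_le _ _) _.
  have -> : y - z = (x - z) - (x - y) by apply/rowP => i; rewrite !mxE; ring.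
  apply: le_lt_trans (ler_normB _ _) _; lra.
have dL : 0 < 2 * d <= L by rewrite /L; lra.
have H1 : (mu (E `&` exit_prism aa bb e L A) <= (C1 * (2 * d))%:E * sigma B)%E.
  apply: (HC1 _ _ e) => //; first exact: measurableI.
  by move=> y z [Ey _] [Ez _]; have := slab 1 y z; rewrite scale1r; apply; rewrite ?normr1.
have H2 : (mu (E `&` exit_prism aa bb (- e) L A) <= (C2 * (2 * d))%:E * sigma B)%E.
  apply: (HC2 _ _ (- e)) => //; first exact: measurableI.
  by move=> y z [Ey _] [Ez _]; have := slab (-1) y z; rewrite scaleN1r; apply; rewrite ?normrN1.
have H3 : (mu E <= (C1 * (2 * d))%:E * sigma B + (C2 * (2 * d))%:E * sigma B)%E.
  apply: le_trans (leeD H1 H2).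
  apply: le_trans (measureU2 _ _ _); try by exact: measurableI.
  apply: le_measure; rewrite ?inE//; first by apply: measurableU; exact: measurableI.
  move=> y Ey; rewrite -setIUr; split => //.
  by apply: (co_convex_exit bP coA _ e0 Pr); [case: Ey|rewrite ne /L; lra].
have := Hc x d; rewrite d0 dr => /(_ isT).
move/le_trans => /(_ _ (co_convex_half_ball mA coA Ax xdP)).
have two0 : (0 <= 2%:E :> \bar R)%E by rewrite lee_fin.
move/le_trans => /(_ _ (lee_wpmul2l two0 H3)).
have dp : 0 <= 2 * d by lra.
rewrite -ge0_muleDl; [|by rewrite lee_fin mulr_ge0|by rewrite lee_fin mulr_ge0].
rewrite -EFinD muleA -EFinM => H.
have cd : 0 <= (c * d)^-1 by rewrite invr_ge0 mulr_ge0// ltW.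
have cd' : (0 <= ((c * d)^-1)%:E)%E by rewrite lee_fin.
have := lee_wpmul2l cd' H; rewrite muleA -!EFinM.
have -> : (c * d)^-1 * (c * d ^+ n) = d ^+ n.-1.
  by rewrite -{1}(prednK n0) exprS; field; rewrite !gt_eqF.
suff -> : (c * d)^-1 * (2 * (C1 * (2 * d) + C2 * (2 * d))) = 2 / c * (2 * (C1 + C2)) by [].
by field; rewrite !gt_eqF.
Qed.

Variables (x0 : V) (rho : R).
Hypotheses (rho0 : 0 < rho) (x0P : ball x0 (2 * rho) `<=` P).

(** A set without deep points misses the ball of radius rho about [x0]. For x in [A] a grid point
    near x gives one of finitely many directions [w f] with [x - w f] in that ball, hence outside
    [A]. As x lies between [x - w f] and the exit point along [w f], co-convexity puts the exit
    point in [A]. The exit time is short because x is not deep, so [A] is covered by finitely many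
    prisms of length proportional to r. *)
Lemma thin_le : exists2 C : R, 0 <= C & forall A r,
  measurable A -> measurable (A `&` (P `\` P°)) -> co_convex P A ->
  0 < r <= rho / 4 ->
  (forall x d, A x -> 0 < d -> ball x d `<=` P -> d <= r) ->
  (mu A <= (C * r)%:E * sigma (A `&` (P `\` P°)))%E.
Proof.
have [D D0 PD] := bounded_sub_ball bP.
set N := (Num.trunc (2 * D / rho)).+1.
pose w (f : {ffun 'I_n -> 'I_N}) : V := grid D rho f - x0.
have H f : exists C : R, 0 <= C /\ forall A delta,
    measurable A -> measurable (A `&` (P `\` P°)) -> 0 < delta <= 1 ->
    (mu (exit_prism aa bb (w f) delta A) <= (C * delta)%:E * sigma (A `&` (P `\` P°)))%E.
  by have [C C0 HC] := exit_prism_le n0 lmu bP aa0 hsigma (w f) ltr01; exists C.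
have [C HC] := choice H.
exists (\sum_f C f * (2 / rho)).
  by apply: sumr_ge0 => f _; rewrite mulr_ge0 ?(HC f).1// divr_ge0// ltW.
move=> A r mA mAP coA /andP[r0 rrho] Ar; have [AP coA2] := coA.
have r4 : r * 4 <= rho by rewrite -ler_pdivlMr.
(* The depth argument below yields s rho <= r (1 + s); with r <= rho/4 this forces s < 2 r/rho. *)
pose delta := 2 * r / rho.
have d0 : 0 < delta by rewrite divr_gt0// mulr_gt0.
have d01 : 0 < delta <= 1 by rewrite d0 ler_pdivrMr// mul1r; lra.
have nA y : ball x0 rho y -> ~ A y.
  move=> y0 Ay; have : rho <= r; last by lra.
  apply: (Ar y) => // z yz; apply: x0P; rewrite mulr_natl mulr2n.
  exact: ball_triangle y0 yz.
have cover : A `<=` \bigcup_f exit_prism aa bb (w f) delta A.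
  move=> x Ax; have Px := AP _ Ax; have [f xf] := grid_net rho0 (PD _ Px).
  exists f => //; have xw : ball x0 rho (x - w f).
    move: xf; rewrite -!ball_normE /w /= => xf.
    suff -> : x0 - (x - (grid D rho f - x0)) = grid D rho f - x by [].
    by apply/rowP => i; rewrite !mxE; ring.
  have w0 : w f != 0 by apply/eqP => wf; apply: (nA x) => //; rewrite -[x]subr0 -wf.
  have [j [jw s0 Py]] := exit_exists bP Px w0.
  exists j => //; rewrite /face_prism jw; set s := exit_time _ _ _ _ in s0.
  have s1 : 0 < 1 + s by lra.
  have yE : exit_point (aa j) (bb j) (w f) x = x + s *: w f by [].
  split.
    rewrite /= -/s s0 /=; have [->//|s00] := eqVneq s 0.
    have sp : 0 < s by rewrite lt_neqAle eq_sym s00.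
    (* The homothety centred at the exit point that sends [x - w f] to x has ratio s/(1+s). It maps
       the ball of radius rho about [x - w f], which lies in [P], to a ball about x that convexity
       keeps in [P]; its radius is then bounded by the depth hypothesis. *)
    have : s * rho / (1 + s) <= r.
      apply: (Ar x) => //; first by apply: divr_gt0 => //; exact: mulr_gt0.
      move=> u; rewrite -ball_normE /= => xu.
      pose p := x - w f; pose v := p + ((1 + s) / s) *: (u - x).
      have Pv : P v.
        apply: x0P; rewrite mulr_natl mulr2n; apply: (@ball_triangle _ _ p) => //.
        rewrite -ball_normE /= /v opprD addrA subrr sub0r normrN normrZ.
        have k0 : 0 < (1 + s) / s by exact: divr_gt0.
        have k1 : 0 < s / (1 + s) by exact: divr_gt0.
        rewrite (gtr0_norm k0) distrC -(ltr_pM2l k1).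
        rewrite mulrA [X in X * _](_ : _ = 1) ?mul1r; last by field; rewrite s00 gt_eqF.
        by rewrite mulrAC.
      have uE : (1 - (1 + s)^-1) *: v + (1 + s)^-1 *: exit_point (aa j) (bb j) (w f) x = u.
        by rewrite yE /v /p; apply/rowP => i; rewrite !mxE; field; rewrite s00 gt_eqF.
      suff : P ((1 - (1 + s)^-1) *: v + (1 + s)^-1 *: exit_point (aa j) (bb j) (w f) x).
        by rewrite uE; exact.
      apply: polytope_convex => //; rewrite invr_ge0 ltW//= invf_le1//; lra.
    rewrite ler_pdivrMr// => h; rewrite ltr_pdivlMr//; nra.
  split; last by split => //; rewrite /hyperplane /= dotv_exit_point// gt_eqF.
  have xE : (1 - (1 + s)^-1) *: (x - w f) + (1 + s)^-1 *: exit_point (aa j) (bb j) (w f) x = x.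
    by rewrite yE; apply/rowP => i; rewrite !mxE; field; rewrite gt_eqF.
  have t01 : 0 <= (1 + s)^-1 <= 1 by rewrite invr_ge0 ltW//= invf_le1//; lra.
  have Pxw : P (x - w f).
    by apply: x0P; apply: le_ball xw; lra.
  by have [/(nA _ xw)|] := coA2 _ _ _ t01 Pxw Py (eq_ind_r A Ax xE).
apply: le_trans (measure_fin_cover mu mA (fun f => measurable_exit_prism aa bb (w f) delta mA) cover) _.
apply: (@le_trans _ _ (\sum_f ((C f * delta)%:E * sigma (A `&` (P `\` P°))))%E).
  by apply: lee_sum => f _; exact: (HC f).2.
rewrite -ge0_sume_distrl => [|f _]; last by rewrite lee_fin mulr_ge0// ?(HC f).1// ltW.
rewrite sumEFin mulr_suml.
suff -> : \sum_f C f * delta = \sum_f C f * (2 / rho) * r by [].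
by apply: eq_bigr => f _; rewrite /delta; ring.
Qed.

End polytope.

Section polytope_facts.
Context {R : realType} {n : nat}.
Local Notation V := 'rV[R]_n.
Variable P : set V.
Hypothesis hP : is_polytope P.

Lemma is_polytope_bounded : bounded_set P.
Proof. by case: hP => cP _; exact: compact_bounded. Qed.

Lemma is_polytope_measurable : measurable P.
Proof. by case: hP => _ [_ [m [a [b [_ ->]]]]]; exact: measurable_polytope. Qed.

Lemma is_polytope_convex x y t : 0 <= t <= 1 -> P x -> P y ->
  P ((1 - t) *: x + t *: y).
Proof. by case: hP => _ [_ [m [a [b [_ ->]]]]]; exact: polytope_convex. Qed.

Lemma interior_ball x : P° x -> exists2 r : R, 0 < r & ball x r `<=` P.
Proof. by move=> /nbhs_ballP[r r0 xr]; exists r. Qed.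

Lemma ball_interior x (r : R) y : ball x r `<=` P -> ball x r y -> P° y.
Proof.
move=> xrP xy; apply: filterS xrP _; rewrite nbhsE; exists (ball x r) => //.
by split => //; exact: ball_open.
Qed.

Lemma measurable_interior : measurable (P°).
Proof. by apply: open_measurable_rV; exact: open_interior. Qed.

Lemma measurable_boundary : measurable (P `\` P°).
Proof. exact: measurableD is_polytope_measurable measurable_interior. Qed.

(* The ball around the image of x is the homothetic image of the ball around x. *)
Lemma ball_segment x y t r : 0 <= t < 1 -> ball x r `<=` P -> P y ->
  ball ((1 - t) *: x + t *: y) ((1 - t) * r) `<=` P.
Proof.
move=> /andP[t0 t1] xr Py u; have t1' : 0 < 1 - t by lra.
rewrite -ball_normE /= => hu.
pose v := (1 - t)^-1 *: (u - t *: y).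
have uE : (1 - t) *: v + t *: y = u.
  by rewrite /v scalerA divff ?gt_eqF// scale1r subrK.
have xv : ball x r v.
  rewrite -ball_normE /= -(ltr_pM2l t1') -(gtr0_norm t1') -normrZ (gtr0_norm t1').
  suff -> : (1 - t) *: (x - v) = (1 - t) *: x + t *: y - u by [].
  by rewrite -uE scalerBr opprD addrACA subrr addr0.
by rewrite -uE; apply: is_polytope_convex => //; [lra|exact: xr].
Qed.

Lemma interior_segment x y t : 0 <= t < 1 -> P° x -> P y -> P° ((1 - t) *: x + t *: y).
Proof.
move=> t01 /interior_ball[r r0 xr] Py.
apply: (@ball_interior ((1 - t) *: x + t *: y) ((1 - t) * r)).
  exact: ball_segment.
by apply: ballxx; case/andP: t01 => t0 t1; rewrite mulr_gt0// subr_gt0.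
Qed.

Variable mu : {measure set V -> \bar R}.
Hypothesis lmu : lebesgue_like mu.

Lemma is_polytope_measure : (0 < mu P < +oo)%E.
Proof.
apply/andP; split; last exact: lebesgue_like_fin is_polytope_measurable is_polytope_bounded.
have [_ [[x /interior_ball[r r0 xr]] _]] := hP.
have /andP[b0 _] := lebesgue_like_ball x lmu r0.
apply: lt_le_trans b0 _; apply: le_measure; rewrite ?inE//.
  exact: measurable_rV_ball.
exact: is_polytope_measurable.
Qed.

(** A point satisfying all constraints strictly is interior, so the boundary is covered by finitely
    many pieces of hyperplanes. *)
Lemma boundary_null : mu (P `\` P°) = 0%E.
Proof.
have mP := is_polytope_measurable; have bP := is_polytope_bounded.
have [_ [_ [m [a [b [a0 PE]]]]]] := hP.
apply/eqP; rewrite eq_le measure_ge0 andbT.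
have cover : P `\` P° `<=` \bigcup_(j in [set: 'I_m]) (P `&` hyperplane (a j) (b j)).
  move=> x [Px nPx]; apply: contrapT => nx; apply: nPx.
  have lt j : dotv (a j) x < b j.
    rewrite lt_neqAle; apply/andP; split; last by move: Px; rewrite PE; exact.
    by apply/eqP => e; apply: nx; exists j.
  have H j : \forall y \near x, dotv (a j) y <= b j.
    apply/nbhs_ballP; exists ((b j - dotv (a j) x) / (1 + \sum_(i < n) `|a j ord0 i|)) => /=.
      by rewrite divr_gt0 ?subr_gt0// ltr_pwDl// sumr_ge0.
    move=> y; rewrite -ball_normE /= ltr_pdivlMr; last by rewrite ltr_pwDl// sumr_ge0.
    rewrite distrC => h; have := dotv_le (a j) (y - x); rewrite dotvBr.
    move/(le_trans (ler_norm _)); have := normr_ge0 (y - x).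
    by move: h; rewrite mulrDr mulr1; lra.
  suff : nbhs x P by [].
  rewrite PE; exact: (@filter_forall _ _ (fun j y => dotv (a j) y <= b j) (nbhs x) _ H).
apply: le_trans (measure_fin_cover mu measurable_boundary _ cover) _.
  by move=> j; apply: measurableI => //; exact: measurable_hyperplane.
rewrite big1// => j _; apply: (hyperplane_null (c := b j) lmu _ _ (a0 j)) => [||x []//].
  by apply: measurableI => //; exact: measurable_hyperplane.
by apply: bounded_subset bP; exact: subIsetl.
Qed.

End polytope_facts.

(** The hypothesis on [sigma] bounds the depth of [A] by a multiple of r through [depth_le], and
    [thin_le] turns small depth into small measure. Values of r too large for [thin_le] are covered
    by the finiteness of [mu P]. *)
Lemma system_depth_iso (R : realType) (n : nat) (P : set 'rV[R]_n)
    (mu sigma : {measure set 'rV[R]_n -> \bar R}) : (2 <= n)%N -> is_system P mu sigma ->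
  exists C : R, [/\ 0 < C,
    forall A x d, measurable A -> co_convex P A -> A x -> 0 < d -> ball x d `<=` P ->
      ((d ^+ n.-1)%:E <= C%:E * sigma (A `&` (P `\` P°)))%E &
    forall A r, measurable A -> co_convex P A -> 0 < r ->
      (sigma (A `&` (P `\` P°)) <= (r ^+ n.-1)%:E)%E ->
      (mu A <= (C * r)%:E * sigma (A `&` (P `\` P°)))%E].
Proof.
move=> n2 [[hP _] [lmu [_ hs]]].
have bP := is_polytope_bounded hP; have mdP := measurable_boundary hP.
have mP := is_polytope_measurable hP; have /andP[P0 Poo] := is_polytope_measure hP lmu.
have [_ [[x0 /interior_ball[rho' rho0' x0P]] [m [a [b [a0 PE]]]]]] := hP.
pose rho := rho' / 2; have rho0 : 0 < rho by rewrite divr_gt0.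
have {}x0P : ball x0 (2 * rho) `<=` P by rewrite mulrC divfK.
have n0 : (0 < n)%N by exact: ltnW.
have n10 : (0 < n.-1)%N by rewrite -ltnS prednK.
rewrite PE in hs bP mdP x0P.
have [C0 C00 HC0] := depth_le n0 lmu bP a0 hs.
have [C1 C10 HC1] := thin_le n0 lmu bP a0 hs rho0 x0P.
rewrite -PE in hs bP mdP x0P HC0 HC1.
(* Since K0 >= 1 and n-1 >= 1, K0^(n-1) >= K0 >= C0; thus C0 r^(n-1) <= (K0 r)^(n-1), and the depth
   is at most K0 r. *)
pose K0 := 1 + C0; have K00 : 0 < K0 by rewrite /K0; lra.
have C0K : C0 <= K0 by rewrite /K0; lra.
have K01 : 1 <= K0 by rewrite /K0; lra.
pose r1 := rho / 4 / K0; have r10 : 0 < r1 by rewrite !divr_gt0.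
pose p := fine (mu P); have pE : mu P = p%:E by rewrite fineK// ge0_fin_numE.
have p0 : 0 < p by rewrite -lte_fin -pE.
have rn0 : 0 < r1 ^+ n by rewrite exprn_gt0.
pose C := K0 + C1 * K0 + p / r1 ^+ n.
have C1K : 0 <= C1 * K0 by rewrite mulr_ge0// ltW.
have pr0 : 0 < p / r1 ^+ n by rewrite divr_gt0.
exists C; split; first by rewrite /C; lra.
  move=> A x d mA coA Ax d0 xdP; apply: le_trans (HC0 _ _ _ mA (measurableI _ _ mA mdP) coA Ax d0 xdP) _.
  by apply: lee_wpmul2r => //; rewrite lee_fin /C; lra.
move=> A r mA coA r0 sr; have mB := measurableI _ _ mA mdP.
have small s : 0 < s <= r1 -> (sigma (A `&` (P `\` P°)) <= (s ^+ n.-1)%:E)%E ->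
    (mu A <= (C1 * K0 * s)%:E * sigma (A `&` (P `\` P°)))%E.
  move=> /andP[s0 sr1] sB.
  rewrite -mulrA; apply: HC1 => //.
    by rewrite mulr_gt0//= -ler_pdivlMl// mulrC.
  move=> x d Ax d0 xdP; have := HC0 _ _ _ mA mB coA Ax d0 xdP.
  have C0' : (0 <= C0%:E)%E by rewrite lee_fin.
  move/le_trans => /(_ _ (lee_wpmul2l C0' sB)); rewrite -EFinM lee_fin => h.
  rewrite -(ler_pXn2r n10) ?nnegrE; [|exact: ltW|by apply: ltW; rewrite mulr_gt0].
  apply: le_trans h _.
  rewrite exprMn; apply: ler_wpM2r; first by rewrite exprn_ge0// ltW.
  by apply: (le_trans C0K); exact: ler_eXnr.
have mono c c' : 0 <= c <= c' -> (c%:E * sigma (A `&` (P `\` P°)) <= c'%:E * sigma (A `&` (P `\` P°)))%E.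
  by move=> /andP[? ?]; apply: lee_wpmul2r.
(* [r1] is the largest r for which K0 r <= rho/4. Beyond it, either the boundary measure is still at
   most r1^(n-1) and the estimate at [r1] suffices, or it exceeds r1^(n-1) and the term p/r1^n of
   [C] dominates mu(P). *)
have [rr1|rr1] := leP r r1.
  apply: le_trans (small _ _ sr) _; first by rewrite r0.
  apply: mono; rewrite (mulr_ge0 C1K (ltW r0)) ler_pM2r// /C; lra.
have [sr1|sr1] := leP (sigma (A `&` (P `\` P°))) (r1 ^+ n.-1)%:E.
  apply: le_trans (small r1 _ sr1) _; first by rewrite r10 lexx.
  apply: mono; rewrite (mulr_ge0 C1K (ltW r10)) /=.
  by apply: ler_pM; [exact: C1K|exact: ltW|rewrite /C; lra|exact: ltW].
apply: (@le_trans _ _ (mu P)).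
  by apply: le_measure; rewrite ?inE//; case: coA.
have Cr0 : (0 <= (C * r)%:E)%E by rewrite lee_fin mulr_ge0 ?ltW// /C; lra.
apply: le_trans _ (lee_wpmul2l Cr0 (ltW sr1)); rewrite pE -EFinM lee_fin.
apply: (@le_trans _ _ (p / r1 ^+ n * r1 * r1 ^+ n.-1)).
  by rewrite -mulrA -exprS prednK// divfK// gt_eqF.
apply: ler_wpM2r; first by rewrite exprn_ge0// ltW.
apply: ler_pM; [exact: ltW|exact: ltW|by rewrite /C; lra|exact: ltW].
Qed.

(** * Estimates for log-convex functions *)

Section admissible.
Context {R : realType} {n : nat}.
Local Notation V := 'rV[R]_n.
Implicit Types (P : set V) (u : V -> \bar R).

Definition admissible P u :=
  [/\ lsc_on P u, forall x, P x -> (0 < u x)%E & log_convex_on P u].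

Definition superlevel P u (t : R) := P `&` [set x | (t%:E < u x)%E].

(** Lower semicontinuity makes superlevel sets relatively open; adjoining the complement of [P]
    before taking the interior exhibits them as [P] intersected with an open set. *)
Lemma measurable_superlevel P u t : measurable P -> lsc_on P u -> measurable (superlevel P u t).
Proof.
move=> mP lsc.
have -> : superlevel P u t = P `&` (~` P `|` superlevel P u t)°.
  apply/seteqP; split => [x [Px xt]|x [Px /interior_subset[//|]]] //.
  split => //; have [e e0 xe] := lsc x Px t xt.
  apply/nbhs_ballP; exists e => //= y; rewrite -ball_normE /= distrC => yx.
  by have [Py|nPy] := pselect (P y); [right; split => //; exact: xe|left].
by apply: measurableI => //; apply: open_measurable_rV; exact: open_interior.
Qed.

Lemma admissible_measurable P u : measurable P -> lsc_on P u -> measurable_fun P u.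
Proof.
move=> mP lsc; apply: (measurability _ (ErealGenOInfty.measurableE R)).
move=> /= _ [_ [a ->]] <-.
have := measurable_superlevel a mP lsc; congr measurable.
by apply/seteqP; split => x [Px]; rewrite /= in_itv /= andbT.
Qed.

Lemma log_convex_le P u x y t (a b : R) : admissible P u -> P x -> P y -> 0 <= t <= 1 ->
  (u x <= a%:E)%E -> (u y <= b%:E)%E ->
  (u ((1 - t) *: x + t *: y)%R <= (a `^ (1 - t) * b `^ t)%:E)%E.
Proof.
move=> [_ u0 lcu] Px Py t01 xa yb; apply: le_trans (lcu x y Px Py t t01) _.
case: (u x) (u0 _ Px) xa => // r; case: (u y) (u0 _ Py) yb => // s.
rewrite !lte_fin !lee_fin => s0 sb r0 ra.
have [a0 b0] := (le_trans (ltW r0) ra, le_trans (ltW s0) sb).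
case/andP: t01 => t0 t1; apply: ler_pM; rewrite ?powR_ge0//.
  by apply: ge0_ler_powR; rewrite ?nnegrE ?subr_ge0// ltW.
by apply: ge0_ler_powR; rewrite ?nnegrE// ltW.
Qed.

Lemma superlevel_co_convex P u t : admissible P u -> 0 < t -> co_convex P (superlevel P u t).
Proof.
move=> au t0; split; first exact: subIsetl.
move=> x y s s01 Px Py [_ /= ut]; have [xt|xt] := leP (u x) t%:E; last by left.
have [yt|yt] := leP (u y) t%:E; last by right.
have := log_convex_le au Px Py s01 xt yt.
rewrite -powRD; last by rewrite subrK oner_eq0.
by rewrite subrK powRr1 ?(ltW t0)// leNgt ut.
Qed.

End admissible.

(** A geometric sum is at most twice its largest term, and that term is below [x]. *)
Lemma pow2_sum_le (R : realType) (x : \bar R) (N : nat) : (0 <= x)%E ->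
  (\sum_(k < N) (if ((2 ^+ k)%:E < x)%E then (2 ^+ k)%:E else 0) <= 2%:E * x)%E.
Proof.
move=> x0; elim: N => [|N IH]; first by rewrite big_ord0 mule_ge0// lee_fin.
have [Nx|Nx] := ltP (2 ^+ N)%:E x; last by rewrite big_ord_recr /= ltNge Nx adde0.
apply: (@le_trans _ _ (2 * 2 ^+ N)%:E); last first.
  by rewrite EFinM; apply: lee_wpmul2l; [rewrite lee_fin|exact: ltW].
apply: (@le_trans _ _ (\sum_(k < N.+1) (2 ^+ k)%:E)%E).
  apply: lee_sum => k _; case: ifP => // _; rewrite lee_fin; exact: exprn_ge0.
rewrite sumEFin lee_fin.
suff : \sum_(k < N.+1) 2 ^+ k + 1 = 2 * 2 ^+ N :> R by lra.
elim: N {IH Nx} => [|N IH]; first by rewrite big_ord_recr big_ord0 /= expr0; lra.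
by rewrite big_ord_recr /= exprS; lra.
Qed.

Lemma nneseries_le (R : realType) (f : nat -> \bar R) (M : \bar R) :
  (forall k, 0 <= f k)%E -> (forall N, \sum_(k < N) f k <= M)%E ->
  (\sum_(k <oo) f k <= M)%E.
Proof.
move=> f0 fM; apply: lime_le; first exact: is_cvg_nneseries.
by apply: nearW => N; rewrite big_mkord; exact: fM.
Qed.

Lemma nneseries_term_le (R : realType) (f : nat -> \bar R) k :
  (forall k, 0 <= f k)%E -> (f k <= \sum_(k <oo) f k)%E.
Proof.
move=> f0; apply: le_trans (nneseries_lim_ge k.+1 _) => //.
by rewrite big_nat_recr//= leeDr// sume_ge0.
Qed.

(** If 2^N < x <= 2^(N+1), the term k = N alone suffices; the summand 1 handles x <= 1, and at +oo
    the series diverges. *)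
Lemma poweR_le_dyadic (R : realType) (x : \bar R) (p : R) : (0 <= x)%E -> 1 <= p ->
  (poweR x p <= 1 + (2 `^ p)%:E *
    \sum_(k <oo) (if ((2 ^+ k)%:E < x)%E then ((2 ^+ k) `^ p)%:E else 0))%E.
Proof.
move=> x0 p1; set S := (\sum_(k <oo) _)%E.
have p0 : 0 < p by lra.
have t0 k : (0 <= if ((2 ^+ k)%:E < x)%E then ((2 ^+ k) `^ p)%:E else 0 :> \bar R)%E.
  by case: ifP => // _; rewrite lee_fin powR_ge0.
have S0 : (0 <= S)%E by apply: nneseries_ge0.
have Sk k : ((2 ^+ k)%:E < x)%E -> (((2 ^+ k) `^ p)%:E <= S)%E.
  by move=> kx; have := nneseries_term_le k t0; rewrite kx.
have twop : (0 <= (2 `^ p)%:E :> \bar R)%E by rewrite lee_fin powR_ge0.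
case: x x0 @S t0 S0 Sk => [a| |] x0 S t0 S0 Sk //; last first.
  rewrite poweRyr ?gt_eqF//.
  have -> : S = +oo%E.
    apply/eqyP => A A0; apply: le_trans (Sk (Num.trunc A).+1 (ltry _)).
    rewrite lee_fin; apply: (@le_trans _ _ (2 ^+ (Num.trunc A).+1)).
      apply: (@le_trans _ _ (Num.trunc A).+1%:R); first exact/ltW/truncnS_gt.
      by rewrite -natrX ler_nat ltnW// ltn_expl.
    by rewrite -[leLHS]powRr1 ?exprn_ge0//; apply: ler_powR => //; apply: exprn_ege1; lra.
  by rewrite gt0_muley ?lte_fin ?powR_gt0// addey.
rewrite lee_fin in x0; rewrite poweR_EFin.
have [a1|a1] := leP a 1.
  apply: (@le_trans _ _ 1%E); last by rewrite leeDl// mule_ge0.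
  rewrite lee_fin; apply: (@le_trans _ _ (1 `^ p)); last by rewrite powR1.
  by apply: ge0_ler_powR; rewrite ?nnegrE// ltW.
have exN : exists N, a <= 2 ^+ N.
  exists (Num.trunc a).+1; apply: (@le_trans _ _ (Num.trunc a).+1%:R); first exact/ltW/truncnS_gt.
  by rewrite -natrX ler_nat ltnW// ltn_expl.
case: (ex_minnP exN) => -[|N] aN minN; first by move: aN; rewrite expr0 leNgt a1.
have Na : 2 ^+ N < a by rewrite ltNge; apply/negP => /minN; rewrite ltnn.
have := Sk N; rewrite lte_fin => /(_ Na) h.
apply: (@le_trans _ _ ((2 `^ p)%:E * ((2 ^+ N) `^ p)%:E)%E).
  rewrite -EFinM lee_fin -powRM// ?exprn_ge0// -exprS.
  by apply: ge0_ler_powR; rewrite ?nnegrE ?exprn_ge0// ltW.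
apply: (@le_trans _ _ ((2 `^ p)%:E * S)%E); first exact: lee_wpmul2l.
by rewrite leeDr// lee_fin.
Qed.

Section boundary_estimates.
Context {R : realType} {n : nat}.
Local Notation V := 'rV[R]_n.
Variables (P : set V) (mu sigma : {measure set V -> \bar R}).
Hypotheses (n2 : (2 <= n)%N) (hS : is_system P mu sigma).
Let hP : is_polytope P := (hS.1).1.
Let lmu : lebesgue_like mu := (hS.2).1.
Let mP : measurable P := is_polytope_measurable hP.
Let mdP : measurable (P `\` P°) := measurable_boundary hP.

Lemma admissible_measurable_boundary u : admissible P u -> measurable_fun (P `\` P°) u.
Proof.
by move=> [lu _ _]; apply: measurable_funS (admissible_measurable mP lu) => //; exact: subDsetl.
Qed.

Lemma boundary_markov u t : admissible P u -> 0 <= t ->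
  (t%:E * sigma (superlevel P u t `&` (P `\` P°)) <= \int[sigma]_(x in P `\` P°) u x)%E.
Proof.
move=> au t0; have [lu u0 _] := au.
have mA := measurable_superlevel t mP lu.
have mB := measurableI _ _ mA mdP.
rewrite -integral_cst//.
apply: (@le_trans _ _ (\int[sigma]_(x in superlevel P u t `&` (P `\` P°)) u x)%E).
  apply: ge0_le_integral => //.
  - by apply: measurable_funS (admissible_measurable_boundary au) => //; exact: subIsetr.
  - by move=> x [[_ /ltW]].
apply: ge0_subset_integral => //; first exact: admissible_measurable_boundary.
by move=> x [Px _]; exact/ltW/u0.
Qed.

Lemma pointwise_bound : exists2 C : R, 0 < C & forall u (W : R) x d,
  admissible P u -> 0 < W -> (\int[sigma]_(x in P `\` P°) u x <= W%:E)%E ->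
  0 < d -> ball x d `<=` P -> (u x <= (C * W / d ^+ n.-1)%:E)%E.
Proof.
have [C [C0 HC _]] := system_depth_iso n2 hS.
exists (2 * C); first by rewrite mulr_gt0.
move=> u W x d au W0 uW d0 xdP; rewrite leNgt; apply/negP => ut.
set t := _ / _ in ut.
have dn0 : 0 < d ^+ n.-1 by rewrite exprn_gt0.
have t0 : 0 < t by rewrite divr_gt0// !mulr_gt0.
have [lu _ _] := au; have mA := measurable_superlevel t mP lu.
have Px : P x by apply: xdP; exact: ballxx.
have h := HC _ _ _ mA (superlevel_co_convex au t0) (conj Px ut) d0 xdP.
have tE : (0 <= t%:E)%E by rewrite lee_fin ltW.
have CE : (0 <= C%:E)%E by rewrite lee_fin ltW.
have := lee_wpmul2l tE h; rewrite muleCA.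
move/le_trans => /(_ _ (lee_wpmul2l CE (le_trans (boundary_markov au (ltW t0)) uW))).
rewrite -!EFinM lee_fin /t divfK ?gt_eqF//.
have : 0 < C * W by rewrite mulr_gt0.
by nra.
Qed.

Local Notation p := (n%:R / (n%:R - 1) : R).
Local Notation q := (n.-1%:R^-1 : R).

Lemma conjugate_exponent : [/\ n.-1%:R > 0 :> R, 0 < q, p = 1 + q & 1 < p].
Proof.
have n10 : (0 < n.-1)%N by rewrite -ltnS prednK// ltnW.
have h : 0 < n.-1%:R :> R by rewrite ltr0n.
have nE : n%:R = n.-1%:R + 1 :> R by rewrite natr1 prednK// ltnW.
have q0 : 0 < q by rewrite invr_gt0.
have pE : p = 1 + q by rewrite nE addrK; field; rewrite gt_eqF.
by split => //; rewrite pE; lra.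
Qed.

(** For the level 2^k choose r with r^(n-1) = W/2^k, which Markov's inequality permits. Since 2^(kp)
    r = 2^k W^(1/(n-1)), the weighted volume 2^(kp) mu(A_k) is at most C W^(1/(n-1)) 2^k s_k, with
    s_k the boundary measure of the level set. Summing under the boundary integral gives at most 2W
    for the sum of the 2^k s_k. *)
Lemma Lp_boundary_estimate : exists2 C : R, 0 < C & forall u (W : R),
  admissible P u -> 1 <= W -> (\int[sigma]_(x in P `\` P°) u x <= W%:E)%E ->
  (\int[mu]_(x in P) poweR (u x) p <= (C * W `^ p)%:E)%E.
Proof.
have [n10 q0 pq p1] := conjugate_exponent.
have /andP[P0 Poo] := is_polytope_measure hP lmu.
pose m := fine (mu P); have mE : mu P = m%:E by rewrite fineK// ge0_fin_numE.
have m0 : 0 < m by rewrite -lte_fin -mE.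
have [C [C0 _ HC]] := system_depth_iso n2 hS.
(* [m] is the integral of the constant 1 in the dyadic bound, absorbed because W^p >= 1; 2^p comes
   from the same bound and 2 C from the sum over the levels. *)
exists (m + 2 `^ p * (2 * C)).
  by rewrite addr_gt0// mulr_gt0 ?powR_gt0// mulr_gt0.
move=> u W au W1 uW; have [lu u0 _] := au.
have W0 : 0 < W by lra.
pose A k := superlevel P u (2 ^+ k).
have mA k : measurable (A k) by exact: measurable_superlevel.
have mB k : measurable (A k `&` (P `\` P°)) by exact: measurableI.
have k0 k : 0 < 2 ^+ k :> R by rewrite exprn_gt0.
have k0' k : 0 <= 2 ^+ k :> R by rewrite exprn_ge0.
pose s k := sigma (A k `&` (P `\` P°)).
have sV k : ((2 ^+ k)%:E * s k <= W%:E)%E.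
  by apply: le_trans uW; exact: boundary_markov.
have level k : (((2 ^+ k) `^ p)%:E * mu (A k) <= (C * W `^ q)%:E * ((2 ^+ k)%:E * s k))%E.
  pose r := (W / 2 ^+ k) `^ q.
  have Wk : 0 < W / 2 ^+ k by rewrite divr_gt0.
  have r0 : 0 < r by rewrite powR_gt0.
  have rn : r ^+ n.-1 = W / 2 ^+ k.
    by rewrite -powR_mulrn ?powR_ge0// -powRrM mulVf ?gt_eqF// powRr1// ltW.
  have sr : (s k <= (r ^+ n.-1)%:E)%E.
    rewrite rn; have := lee_wpmul2l (_ : (0 <= ((2 ^+ k)^-1)%:E)%E) (sV k).
    rewrite lee_fin invr_ge0 muleA -EFinM mulVf ?gt_eqF// mul1e mulrC EFinM.
    by rewrite muleC; exact.
  have := HC _ _ (mA k) (superlevel_co_convex au (k0 k)) r0 sr.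
  have kp : (0 <= ((2 ^+ k) `^ p)%:E :> \bar R)%E by rewrite lee_fin powR_ge0.
  move/(lee_wpmul2l kp)/le_trans; apply.
  rewrite !muleA -!EFinM; suff -> : (2 ^+ k) `^ p * (C * r) = C * W `^ q * 2 ^+ k by [].
  have Ep : (2 ^+ k) `^ p = 2 ^+ k * (2 ^+ k) `^ q :> R.
    by rewrite pq powRD ?powRr1//; apply/implyP => _; rewrite gt_eqF.
  have Eq : (2 ^+ k)^-1 `^ q * (2 ^+ k) `^ q = 1 :> R.
    by rewrite -powRM ?invr_ge0// mulVf ?gt_eqF// powR1.
  rewrite Ep /r powRM ?invr_ge0//; last exact: ltW.
  set a := (2 ^+ k) `^ q in Eq *; set b := (2 ^+ k)^-1 `^ q in Eq *.
  have -> : 2 ^+ k * a * (C * (W `^ q * b)) = C * W `^ q * 2 ^+ k * (b * a) by ring.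
  by rewrite Eq mulr1.
have mi k : measurable_fun (P `\` P°) (fun x => ((2 ^+ k)%:E : \bar R) * (\1_(A k) x)%:E)%E.
  by apply/measurable_EFinP; apply: measurable_funM => //; exact: measurable_indic.
have i0 k x : (0 <= ((2 ^+ k)%:E : \bar R) * (\1_(A k) x)%:E)%E.
  by rewrite mule_ge0// lee_fin.
have sumk N : (\sum_(k < N) ((2 ^+ k)%:E * s k) <= (2 * W)%:E)%E.
  have -> : (\sum_(k < N) ((2 ^+ k)%:E * s k) = \int[sigma]_(x in P `\` P°)
      \sum_(k < N) ((2 ^+ k)%:E * (\1_(A k) x)%:E))%E.
    rewrite (ge0_integral_sum sigma mdP (fun k : 'I_N => mi k) (fun k x _ => i0 k x)).
    apply: eq_bigr => k _; rewrite ge0_integralZl_EFin//; last first.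
    - by apply/measurable_EFinP; exact: measurable_indic.
    by rewrite integral_indic.
  apply: (@le_trans _ _ (\int[sigma]_(x in P `\` P°) (2%:E * u x))%E).
    apply: ge0_le_integral => //.
    - by move=> x _; apply: sume_ge0 => k _; rewrite mule_ge0// lee_fin.
    - by apply: emeasurable_sum => k; exact: mi.
    - by apply: emeasurable_funM => //; exact: admissible_measurable_boundary.
    move=> x [Px _]; apply: le_trans (pow2_sum_le N (ltW (u0 _ Px))).
    apply: lee_sum => k _; rewrite indicE.
    case: ifPn => kx; first by rewrite mem_set ?mule1.
    by rewrite memNset ?mule0// => -[_ /=]; rewrite (negbTE kx).
  rewrite ge0_integralZl_EFin//; last 2 first.
  - by move=> x [Px _]; exact/ltW/u0.
  - exact: admissible_measurable_boundary.
  by rewrite EFinM; apply: lee_wpmul2l; rewrite ?lee_fin.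
pose f k x := (((2 ^+ k) `^ p)%:E * (\1_(A k) x)%:E : \bar R)%E.
have f0 k x : (0 <= f k x)%E by rewrite mule_ge0// lee_fin// powR_ge0.
have mf k : measurable_fun P (f k).
  by apply/measurable_EFinP; apply: measurable_funM => //; exact: measurable_indic.
have mS : measurable_fun P (fun x => \sum_(k <oo) f k x)%E by exact: ge0_emeasurable_sum.
have S0 x : (0 <= \sum_(k <oo) f k x)%E by exact: nneseries_ge0.
have p2 : 0 <= (2 `^ p : R) by exact: powR_ge0.
apply: (@le_trans _ _ (\int[mu]_(x in P) (1 + (2 `^ p)%:E * \sum_(k <oo) f k x))%E).
  apply: ge0_le_integral => //.
  - by move=> x _; exact: poweR_ge0.
  - by apply: (measurableT_comp (measurable_poweR _)); exact: admissible_measurable.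
  - by apply: emeasurable_funD => //; apply: emeasurable_funM.
  move=> x Px; apply: le_trans (poweR_le_dyadic (ltW (u0 _ Px)) (ltW p1)) _.
  rewrite leeD2l//; apply: lee_wpmul2l; first by rewrite lee_fin.
  apply: lee_nneseries => [k _ _|k _]; first by case: ifP => // _; rewrite lee_fin powR_ge0.
  rewrite /f indicE; case: ifPn => kx; first by rewrite mem_set ?mule1.
  by rewrite mule_ge0// lee_fin// powR_ge0.
rewrite ge0_integralD//; last 2 first.
- by move=> x _; rewrite mule_ge0.
- by apply: emeasurable_funM.
rewrite integral_cst// mul1e ge0_integralZl_EFin// integral_nneseries//.
have W1p : 1 <= W `^ p.
  by rewrite -[leLHS](powRr0 W); apply: ler_powR => //; lra.
have WW : W `^ p = W * W `^ q.
  by rewrite pq powRD ?powRr1 ?ltW//; apply/implyP => _; rewrite gt_eqF.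
apply: (@le_trans _ _ (m%:E + (2 `^ p)%:E * (C * W `^ q * (2 * W))%:E)%E).
  rewrite mE leeD2l//; apply: lee_wpmul2l; first by rewrite lee_fin.
  apply: nneseries_le => [k|N]; first exact: integral_ge0.
  apply: (@le_trans _ _ (\sum_(k < N) ((C * W `^ q)%:E * ((2 ^+ k)%:E * s k)))%E).
    apply: lee_sum => k _; rewrite ge0_integralZl_EFin ?powR_ge0//; last first.
      by apply/measurable_EFinP; exact: measurable_indic.
    rewrite integral_indic// (_ : A k `&` P = A k)//.
    by apply/setIidPl; exact: subIsetl.
  rewrite -ge0_sume_distrr => [|k _]; last by rewrite mule_ge0// lee_fin.
  by rewrite [leRHS]EFinM; apply: lee_wpmul2l => //; rewrite lee_fin mulr_ge0 ?powR_ge0// ltW.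
rewrite -EFinM -EFinD lee_fin WW [leRHS]mulrDl; apply: lerD.
  by rewrite -WW ler_peMr// ltW.
by rewrite le_eqVlt; apply/orP; left; apply/eqP; ring.
Qed.

End boundary_estimates.

(** * Entropy against the boundary integral *)

Section xlogx.
Context {R : realType}.
Implicit Types (r lambda p : R) (s : \bar R).

Lemma rlogr_ge r : 0 <= r -> -1 <= r * ln r.
Proof.
rewrite le_eqVlt => /orP[/eqP <-|r0]; first by rewrite mul0r; lra.
have rV : 0 < r^-1 by rewrite invr_gt0.
have := ln_sublinear rV; rewrite lnV ?posrE// => h.
have : r * r^-1 = 1 by rewrite divff// gt_eqF.
by nra.
Qed.

(** The inequality ln x < x at x = r^(p-1)/lambda, multiplied by r. The parameter [lambda] stays
    free: it is a constant in [xlogx_le_powR] and a power of the boundary integral in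
    [entropy_sublinear]. *)
Lemma rlogr_le r lambda p : 0 <= r -> 1 < p -> 0 < lambda ->
  r * ln r <= (p - 1)^-1 * (r `^ p / lambda + r * ln lambda).
Proof.
move=> r0 p1 l0; have q0 : 0 < p - 1 by lra.
rewrite ler_pdivlMl//; move: r0; rewrite le_eqVlt => /orP[/eqP <-|r0].
  by rewrite mul0r mulr0 powR0 ?mul0r ?addr0// gt_eqF//; lra.
have rq : 0 < r `^ (p - 1) by exact: powR_gt0.
have rl : 0 < r `^ (p - 1) / lambda by rewrite divr_gt0.
have := ln_sublinear rl; rewrite ln_div ?posrE// ln_powR => h.
rewrite -(mulr_powRB1 (ltW r0)); last by lra.
by nra.
Qed.

Lemma xlogx_abs_le s lambda p : (0 <= s)%E -> 1 < p -> 1 <= lambda ->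
  (`|xlogx s| <= 1 + (((p - 1)^-1 / lambda)%:E * poweR s p + ((p - 1)^-1 * ln lambda)%:E * s))%E.
Proof.
move=> s0 p1 l1; have l0 : 0 < lambda by lra.
have q0 : 0 < (p - 1)^-1 by rewrite invr_gt0; lra.
have c0 : 0 < (p - 1)^-1 / lambda by rewrite divr_gt0.
have d0 : 0 <= (p - 1)^-1 * ln lambda by rewrite mulr_ge0 ?ln_ge0// ltW.
case: s s0 => [r| |] // s0; last first.
  rewrite poweRyr; last by rewrite gt_eqF//; lra.
  rewrite gt0_muley ?lte_fin//; set d := (_ * ln lambda)%:E.
  have : (0 <= d * +oo)%E by rewrite mule_ge0// lee_fin.
  by case: (d * +oo)%E => [r| |] // _; rewrite !(addye, addey).
rewrite lee_fin in s0; rewrite poweR_EFin /= -!EFinM -!EFinD lee_fin.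
have h1 := rlogr_ge s0; have h2 := rlogr_le s0 p1 l0.
have h3 : 0 <= (p - 1)^-1 / lambda * r `^ p by rewrite mulr_ge0 ?powR_ge0// ltW.
have h4 : 0 <= (p - 1)^-1 * ln lambda * r by rewrite mulr_ge0.
rewrite ler_norml; apply/andP; split; first by lra.
apply: le_trans h2 _; set c := (p - 1)^-1; set l := lambda^-1; set a := r `^ p.
have -> : c * (a * l + r * ln lambda) = c * l * a + c * ln lambda * r by ring.
by rewrite lerDr.
Qed.

(** The constant is the threshold beyond which r <= eps r^p. *)
Lemma self_le_powR s p (eps : R) : (0 <= s)%E -> 1 < p -> 0 < eps ->
  (s <= (eps^-1 `^ (p - 1)^-1)%:E + eps%:E * poweR s p)%E.
Proof.
move=> s0 p1 e0; have q0 : 0 < p - 1 by lra.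
have p0 : p != 0 by rewrite gt_eqF//; lra.
case: s s0 => [r| |] // s0; last first.
  by rewrite poweRyr// gt0_muley ?lte_fin// addey.
rewrite lee_fin in s0; rewrite poweR_EFin -EFinM -EFinD lee_fin.
have M0 := powR_ge0 eps^-1 (p - 1)^-1; set M := _ `^ _ in M0 *.
have [rM|Mr] := leP r M; first by rewrite ler_wpDr// mulr_ge0 ?powR_ge0// ltW.
rewrite ler_wpDl// -(mulr_powRB1 s0); last by lra.
rewrite mulrCA ler_peMr// mulrC -ler_pdivrMr// mul1r.
have -> : eps^-1 = M `^ (p - 1).
  by rewrite /M -powRrM mulVf ?gt_eqF// powRr1// invr_ge0 ltW.
by apply: ge0_ler_powR; rewrite ?nnegrE// ltW.
Qed.

(** [l] makes the coefficient of s^p at most eps/2; the remaining linear term b s is absorbed by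
    [self_le_powR], with [d] chosen so that b d <= eps/2. *)
Lemma xlogx_le_powR p (eps : R) : 1 < p -> 0 < eps -> exists2 C : R, 0 <= C &
  forall s, (0 <= s)%E -> (`|xlogx s| <= C%:E + eps%:E * poweR s p)%E.
Proof.
move=> p1 e0; have q0 : 0 < (p - 1)^-1 by rewrite invr_gt0; lra.
pose l := 1 + 2 * (p - 1)^-1 / eps.
have l1 : 1 <= l by rewrite /l lerDl divr_ge0// ?ltW// mulr_gt0.
have l0 : 0 < l by lra.
pose b := (p - 1)^-1 * ln l; have b0 : 0 <= b by rewrite mulr_ge0 ?ln_ge0// ltW.
pose d := eps / 2 / (b + 1); have b1 : 0 < b + 1 by lra.
have d0 : 0 < d by rewrite !divr_gt0.
exists (1 + b * d^-1 `^ (p - 1)^-1); first by rewrite addr_ge0// mulr_ge0// powR_ge0.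
move=> s s0; apply: le_trans (xlogx_abs_le s0 p1 l1) _.
have bE : (0 <= b%:E)%E by rewrite lee_fin.
have h := lee_wpmul2l bE (self_le_powR s0 p1 d0).
have pp := poweR_ge0 s p.
rewrite ge0_muleDr ?mule_ge0 ?lee_fin ?powR_ge0 ?(ltW d0)// muleA -!EFinM in h.
rewrite EFinD -addeA leeD2l//.
apply: le_trans (leeD2l _ h) _.
rewrite addeCA leeD2l// -ge0_muleDl ?lee_fin; last 2 first.
- by rewrite divr_ge0// ltW.
- by rewrite mulr_ge0// ltW.
rewrite -EFinD; apply: lee_wpmul2r => //; rewrite lee_fin.
have : (p - 1)^-1 / l <= eps / 2.
  rewrite ler_pdivrMr// /l mulrDr mulr1.
  have -> : eps / 2 * (2 * (p - 1)^-1 / eps) = (p - 1)^-1 by field; rewrite !gt_eqF//; lra.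
  by lra.
have : b * d <= eps / 2.
  rewrite /d mulrA ler_pdivrMr//; have : 0 < eps / 2 by lra.
  by nra.
lra.
Qed.

(** [xlogx] differs from the extension of r ln r by [er_map] only at -oo, which nonnegativity
    excludes. *)
Lemma measurable_xlogx d (T : measurableType d) (D : set T) (u : T -> \bar R) :
  measurable D -> (forall x, D x -> (0 <= u x)%E) -> measurable_fun D u ->
  measurable_fun D (fun x => xlogx (u x)).
Proof.
move=> mD u0 mu; have mr : measurable_fun setT (fun r : R => r * ln r).
  by apply: measurable_funM => //; exact: measurable_ln.
apply: (eq_measurable_fun (fun x => er_map (fun r => r * ln r) (u x))).
  by move=> x /set_mem /u0; case: (u x).
by apply: (measurableT_comp _ mu); exact: measurable_er_map.
Qed.

End xlogx.

Section entropy_bound.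
Context {R : realType} {n : nat}.
Local Notation V := 'rV[R]_n.
Variables (P : set V) (mu sigma : {measure set V -> \bar R}).
Hypotheses (n2 : (2 <= n)%N) (hS : is_system P mu sigma).
Let hP : is_polytope P := (hS.1).1.
Let lmu : lebesgue_like mu := (hS.2).1.
Let mP : measurable P := is_polytope_measurable hP.
Local Notation p := (n%:R / (n%:R - 1) : R).

Lemma xlogx_integral_le (u : V -> \bar R) (lambda : R) :
  admissible P u -> (\int[mu]_(x in P) u x = mu P)%E -> 1 <= lambda ->
  (\int[mu]_(x in P) `|xlogx (u x)| <= mu P +
    (((p - 1)^-1 / lambda)%:E * \int[mu]_(x in P) poweR (u x) p +
     ((p - 1)^-1 * ln lambda)%:E * mu P))%E.
Proof.
move=> au um l1; have [lu u0 _] := au.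
have [_ _ _ p1] := conjugate_exponent (R := R) n2.
have u0' x : P x -> (0 <= u x)%E by move=> Px; exact/ltW/u0.
have mu_ := admissible_measurable mP lu.
have mup : measurable_fun P (fun x => poweR (u x) p).
  exact: (measurableT_comp (measurable_poweR _)).
have q0 : 0 < (p - 1)^-1 by rewrite invr_gt0; lra.
have a0 : 0 <= (p - 1)^-1 / lambda by rewrite divr_ge0 ?ltW//; lra.
have b0 : 0 <= (p - 1)^-1 * ln lambda by rewrite mulr_ge0 ?ln_ge0// ltW.
apply: (@le_trans _ _ (\int[mu]_(x in P) (1 + (((p - 1)^-1 / lambda)%:E * poweR (u x) p
    + ((p - 1)^-1 * ln lambda)%:E * u x)))%E).
  apply: ge0_le_integral => //.
  - by apply: measurableT_comp => //; exact: measurable_xlogx.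
  - apply: emeasurable_funD => //; apply: emeasurable_funD; exact: emeasurable_funM.
  by move=> x Px; exact: xlogx_abs_le (u0' _ Px) p1 l1.
have e1 x : P x -> (0 <= ((p - 1)^-1 / lambda)%:E * poweR (u x) p)%E.
  by move=> Px; rewrite mule_ge0 ?lee_fin// poweR_ge0.
have e2 x : P x -> (0 <= ((p - 1)^-1 * ln lambda)%:E * u x)%E.
  by move=> Px; rewrite mule_ge0 ?lee_fin// u0'.
have m1 : measurable_fun P (fun x => ((p - 1)^-1 / lambda)%:E * poweR (u x) p)%E.
  exact: emeasurable_funM.
have m2 : measurable_fun P (fun x => ((p - 1)^-1 * ln lambda)%:E * u x)%E.
  exact: emeasurable_funM.
rewrite ge0_integralD//; last 2 first.
- by move=> x Px; rewrite adde_ge0 ?e1 ?e2.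
- exact: emeasurable_funD.
rewrite ge0_integralD// integral_cst// mul1e.
rewrite ge0_integralZl_EFin//; last by move=> x Px; exact: poweR_ge0.
by rewrite ge0_integralZl_EFin// um.
Qed.

(* Optimising over lambda makes the entropy sublinear in the boundary integral. *)
Lemma entropy_sublinear (eta : R) : 0 < eta -> exists2 K : R, 0 <= K &
  forall u (W : R), admissible P u -> (\int[mu]_(x in P) u x = mu P)%E -> 0 <= W ->
    (\int[sigma]_(x in P `\` P°) u x <= W%:E)%E ->
    (\int[mu]_(x in P) `|xlogx (u x)| <= (eta * W + K)%:E)%E.
Proof.
move=> e0; have /andP[P0 Poo] := is_polytope_measure hP lmu.
have [_ _ _ p1] := conjugate_exponent (R := R) n2.
pose m := fine (mu P); have mE : mu P = m%:E by rewrite fineK// ge0_fin_numE.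
have m0 : 0 < m by rewrite -lte_fin -mE.
have [C C0 HC] := Lp_boundary_estimate n2 hS.
set q := p - 1; have q0 : 0 < q by rewrite /q; lra.
(* Chosen so that C/(q M) <= eta/2. *)
pose M := 1 + 2 * C / (q * eta).
have M1 : 1 <= M by rewrite /M lerDl divr_ge0// mulr_ge0// ltW.
have M0 : 0 < M by lra.
(* For the remaining logarithm: m ln w <= m (e w - ln e), and m e = eta/2. *)
pose e := eta / (2 * m); have ee0 : 0 < e by rewrite divr_gt0// mulr_gt0.
have lnM0 : 0 <= ln M by exact: ln_ge0.
have qlnM : 0 <= q^-1 * (m * ln M) by rewrite mulr_ge0 ?invr_ge0 ?mulr_ge0// ltW.
exists (eta + m + q^-1 * (m * ln M) + m * `|ln e|).
  by rewrite !addr_ge0// ?mulr_ge0// ltW.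
move=> u W au um W0 uW; pose w := 1 + W.
have w1 : 1 <= w by rewrite /w; lra.
have w0 : 0 < w by lra.
have uw : (\int[sigma]_(x in P `\` P°) u x <= w%:E)%E.
  by apply: le_trans uW _; rewrite lee_fin /w; lra.
have wq : 1 <= w `^ q by rewrite -[leLHS](powRr0 w); apply: ler_powR => //; exact: ltW.
(* With lambda proportional to w^(p-1) the term w^p/lambda becomes linear in w with small
   coefficient, while ln lambda costs only a logarithm of w. *)
pose l := M * w `^ q.
have l1 : 1 <= l by rewrite /l; nra.
have l0 : 0 < l by lra.
apply: le_trans (xlogx_integral_le au um l1) _.
have c0 : (0 <= (q^-1 / l)%:E)%E by rewrite lee_fin divr_ge0 ?invr_ge0// ltW.
rewrite mE; apply: (@le_trans _ _ (m%:E + ((q^-1 / l)%:E * (C * w `^ p)%:E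
     + (q^-1 * ln l)%:E * m%:E))%E).
  by rewrite leeD2l// leeD2r//; apply: lee_wpmul2l => //; exact: HC.
rewrite -!EFinM -!EFinD lee_fin.
have wp : w `^ p = w * w `^ q by rewrite mulr_powRB1 ?ltW//; lra.
have -> : q^-1 / l * (C * w `^ p) = q^-1 * C / M * w.
  by rewrite wp /l; field; rewrite !gt_eqF// powR_gt0.
have h1 : q^-1 * C / M <= eta / 2.
  rewrite ler_pdivrMr// /M.
  have -> : eta / 2 * (1 + 2 * C / (q * eta)) = eta / 2 + q^-1 * C.
    by field; rewrite !gt_eqF.
  lra.
have -> : q^-1 * ln l * m = q^-1 * (m * ln M) + m * ln w.
  rewrite /l lnM ?posrE ?powR_gt0// ln_powR; field.
  by rewrite gt_eqF.
have h2 : m * ln w <= eta / 2 * w + m * `|ln e|.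
  have ew : 0 < e * w by rewrite mulr_gt0.
  have := ln_sublinear ew; rewrite lnM ?posrE// => h.
  have -> : eta / 2 * w = m * (e * w) by rewrite /e; field; rewrite gt_eqF.
  rewrite -mulrDr ler_pM2l//; have := ler_norm (- ln e); rewrite normrN; lra.
have h3 : q^-1 * C / M * w <= eta / 2 * w by rewrite ler_pM2r.
rewrite /w in h2 h3 *; lra.
Qed.

End entropy_bound.

(** * Passing to the limit under a bound in L^p *)

Section integral_limit.
Context d (T : measurableType d) (R : realType) (mu : {measure set T -> \bar R}).
Variables (D : set T) (p M : R) (w : T -> R) (w_ : nat -> T -> R) (phi : R -> R).
Hypotheses (mD : measurable D) (Doo : (mu D < +oo)%E).
Hypotheses (mphiw : measurable_fun D (phi \o w)) (mphiw_ : forall k, measurable_fun D (phi \o w_ k)).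
Hypotheses (mw : measurable_fun D w) (mw_ : forall k, measurable_fun D (w_ k)).
Hypotheses (w0 : forall x, D x -> 0 <= w x) (w_0 : forall k x, D x -> 0 <= w_ k x).
Hypothesis M0 : 0 <= M.
Hypothesis wM : (\int[mu]_(x in D) (w x `^ p)%:E <= M%:E)%E.
Hypothesis w_M : forall k, (\int[mu]_(x in D) (w_ k x `^ p)%:E <= M%:E)%E.
Hypothesis phiw : forall x, D x -> (fun k => phi (w_ k x)) @ \oo --> phi (w x).
(** [phi] is negligible against the p-th power at infinity; together with the L^p bounds this is
    uniform integrability. It is applied to the identity for the mass and to r ln r for the
    entropy. *)
Hypothesis phi_le : forall e : R, 0 < e ->
  exists2 C : R, 0 <= C & forall r, 0 <= r -> `|phi r| <= C + e * r `^ p.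

Let mpow (f : T -> R) : measurable_fun D f -> measurable_fun D (fun x => f x `^ p).
Proof. by move=> mf; exact: (measurableT_comp (@measurable_powR R p) mf). Qed.

Let Cpow_integrable (f : T -> R) (C e : R) : measurable_fun D f -> 0 <= C -> 0 <= e ->
  (\int[mu]_(x in D) (f x `^ p)%:E <= M%:E)%E ->
  mu.-integrable D (fun x => (C + e * f x `^ p)%:E).
Proof.
move=> mf C0 e0 fM; apply/integrableP; split.
  apply/measurable_EFinP; apply: measurable_funD => //; apply: measurable_funM => //.
  exact: mpow.
under eq_integral do rewrite /= ger0_norm ?addr_ge0 ?mulr_ge0 ?powR_ge0// EFinD EFinM.
rewrite ge0_integralD//; last 2 first.
- by move=> x _; rewrite -EFinM lee_fin mulr_ge0// powR_ge0.
- by apply: emeasurable_funM => //; apply/measurable_EFinP; exact: mpow.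
rewrite integral_cst// ge0_integralZl_EFin//; last 2 first.
- by move=> x _; rewrite lee_fin powR_ge0.
- by apply/measurable_EFinP; exact: mpow.
apply: lte_add_pinfty; rewrite lte_mul_pinfty ?lee_fin//.
exact: le_lt_trans fM (ltry _).
Qed.

Lemma phi_integrable (f : T -> R) : measurable_fun D f -> measurable_fun D (phi \o f) ->
  (forall x, D x -> 0 <= f x) -> (\int[mu]_(x in D) (f x `^ p)%:E <= M%:E)%E ->
  mu.-integrable D (fun x => (phi (f x))%:E).
Proof.
move=> mf mphif f0 fM; have [C C0 HC] := phi_le ltr01.
apply: (le_integrable mD _ _ (Cpow_integrable mf C0 ler01 fM)).
  exact/measurable_EFinP.
move=> x Dx /=; rewrite lee_fin (ger0_norm (_ : 0 <= C + _)) ?HC ?f0//.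
by rewrite addr_ge0// mulr_ge0// powR_ge0.
Qed.

(* |phi(w_k) - phi(w)| <= min(|phi(w_k) - phi(w)|, 2C + e w^p) + e w_k^p, and the first
   term is handled by dominated convergence. *)
Lemma integral_limit :
  (fun k => fine (\int[mu]_(x in D) (phi (w_ k x))%:E)) @ \oo -->
    fine (\int[mu]_(x in D) (phi (w x))%:E).
Proof.
have i_ k := phi_integrable (mw_ k) (mphiw_ k) (w_0 k) (w_M k).
have i := phi_integrable mw mphiw w0 wM.
apply/cvgrPdist_le => eps eps0.
pose e := eps / 2 / (M + 1); have e0 : 0 < e by rewrite !divr_gt0// ltr_wpDl.
have [C C0 HC] := phi_le e0.
pose g x := 2 * C + e * w x `^ p.
have ig : mu.-integrable D (EFin \o g).
  by apply: Cpow_integrable => //; [rewrite mulr_ge0|exact: ltW].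
have ee0 := ltW e0.
have g0 x : 0 <= g x by rewrite /g addr_ge0// mulr_ge0// powR_ge0.
pose Delta k x := `|phi (w_ k x) - phi (w x)|.
pose h k x := Num.min (Delta k x) (g x).
have mDelta k : measurable_fun D (Delta k).
  exact: (measurableT_comp (@normr_measurable R setT) (measurable_funB (mphiw_ k) mphiw)).
have mg : measurable_fun D g by case/integrableP : ig => /measurable_EFinP.
have mh k : measurable_fun D (h k) by exact: measurable_minr.
have h0 k x : 0 <= h k x by rewrite le_min normr_ge0 g0.
have hcvg x : D x -> (fun k => h k x) @ \oo --> (0 : R).
  move=> Dx; apply/cvgrPdist_le => z z0.
  have /cvgrPdist_le/(_ z z0) := phiw Dx; apply: filterS => k hk.
  rewrite sub0r normrN ger0_norm// /h ge_min /Delta distrC hk//.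
have [_ _ dc] : [/\ mu.-integrable D (fun=> 0%E),
    [sequence \int[mu]_(x in D) `|(h k x)%:E - 0|]_k @ \oo --> 0 &
    [sequence \int[mu]_(x in D) (h k x)%:E]_k @ \oo --> \int[mu]_(x in D) 0]%E.
  apply: (@dominated_convergence _ _ _ mu D mD (fun k x => (h k x)%:E) (fun=> 0%E) (EFin \o g)) => //.
  - by move=> k; exact/measurable_EFinP.
  - by apply: aeW => x Dx; apply: cvg_EFin; [exact: nearW|exact: hcvg].
  - by apply: aeW => x k Dx; rewrite /= lee_fin ger0_norm// ge_min lexx orbT.
have e20 : 0 < eps / 2 by rewrite divr_gt0.
rewrite integral0 in dc.
have ih k : mu.-integrable D (fun x => (h k x)%:E).
  apply: (le_integrable mD _ _ ig); first exact/measurable_EFinP.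
  by move=> x Dx; rewrite /= lee_fin ger0_norm// ger0_norm// ge_min lexx orbT.
have dc' : (fun k => fine (\int[mu]_(x in D) (h k x)%:E)) @ \oo --> (0 : R).
  exact: (@fine_cvg _ _ _ _ _ 0 dc).
move/cvgrPdist_lt : dc' => /(_ _ e20); apply: filterS => k.
rewrite sub0r normrN /= => /(le_lt_trans (ler_norm _)) hk.
have hkE : (\int[mu]_(x in D) (h k x)%:E <= (eps / 2)%:E)%E.
  by rewrite -[leLHS](fineK (integrable_fin_num mD (ih k))) lee_fin ltW.
rewrite -lee_fin -abse_EFin EFinB (fineK (integrable_fin_num mD (i_ k))) (fineK (integrable_fin_num mD i)).
rewrite -integralB//.
apply: le_trans (le_abse_integral _ mD _) _.
  exact: emeasurable_funB (measurable_int _ i) (measurable_int _ (i_ k)).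
apply: (@le_trans _ _ (\int[mu]_(x in D) ((h k x)%:E + e%:E * (w_ k x `^ p)%:E))%E).
  apply: ge0_le_integral => //.
  - apply: measurableT_comp => //.
    exact: emeasurable_funB (measurable_int _ i) (measurable_int _ (i_ k)).
  - apply: emeasurable_funD; first exact/measurable_EFinP.
    by apply: emeasurable_funM => //; apply/measurable_EFinP; exact: mpow.
  move=> x Dx; rewrite -EFinB abse_EFin -EFinM -EFinD lee_fin distrC.
  rewrite -/(Delta k x) /h; have [_|gD] := leP (Delta k x) (g x).
    by rewrite lerDl mulr_ge0 ?powR_ge0// ltW.
  apply: le_trans (ler_normB _ _) _.
  by have := HC _ (w_0 k Dx); have := HC _ (w0 Dx); rewrite /g; lra.
rewrite ge0_integralD//; first last.
- by apply: emeasurable_funM => //; apply/measurable_EFinP; exact: mpow.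
- by move=> x _; rewrite -EFinM lee_fin mulr_ge0 ?powR_ge0// ltW.
- exact/measurable_EFinP.
- by move=> x _; rewrite lee_fin.
rewrite ge0_integralZl_EFin//; last 2 first.
- by move=> x _; rewrite lee_fin powR_ge0.
- by apply/measurable_EFinP; exact: mpow.
have eE : (0 <= e%:E)%E by rewrite lee_fin ltW.
apply: le_trans (leeD hkE (lee_wpmul2l eE (w_M k))) _.
rewrite -EFinM -EFinD lee_fin.
have : e * M <= eps / 2.
  by rewrite /e mulrAC ler_pdivrMr ?ltr_wpDl//; nra.
lra.
Qed.

End integral_limit.

(** * Compactness *)

Section real_tools.
Context {R : realType}.

(** The tangent line of ln at the weighted geometric mean [c] lies above ln; the weighted sum of the
    two tangent inequalities makes the logarithms cancel. *)
Lemma powR_amgm (a b t : R) : 0 < a -> 0 < b -> 0 <= t <= 1 ->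
  a `^ (1 - t) * b `^ t <= (1 - t) * a + t * b.
Proof.
move=> a0 b0 /andP[t0 t1]; set c := a `^ (1 - t) * b `^ t.
have c0 : 0 < c by rewrite mulr_gt0// powR_gt0.
have tangent x : 0 < x -> ln x - ln c <= x / c - 1.
  move=> x0; have xc : 0 < x / c by rewrite divr_gt0.
  rewrite -ln_div ?posrE//.
  have := @le_ln1Dx _ (x / c - 1); rewrite addrCA subrr addr0; apply; lra.
have lc : ln c = (1 - t) * ln a + t * ln b.
  by rewrite /c lnM ?posrE ?powR_gt0// !ln_powR.
have ha := tangent _ a0; have hb := tangent _ b0.
have : 1 <= (1 - t) * (a / c) + t * (b / c) by rewrite lc in ha hb; nra.
have -> : (1 - t) * (a / c) + t * (b / c) = ((1 - t) * a + t * b) / c by rewrite mulrDl; ring.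
by rewrite ler_pdivlMr// mul1r.
Qed.

Lemma cvg_powR (w : nat -> R) (v p : R) : 0 < p -> (forall k, 0 <= w k) -> 0 <= v ->
  w @ \oo --> v -> (fun k => w k `^ p) @ \oo --> v `^ p.
Proof.
move=> p0 w0 v0 wv; move: v0; rewrite le_eqVlt => /orP[/eqP v0|v0].
  rewrite -v0 powR0 ?gt_eqF//; apply/cvgrPdist_lt => e e0.
  have e0' : 0 < e `^ p^-1 by rewrite powR_gt0.
  rewrite -v0 in wv; move/cvgrPdist_lt : wv => /(_ _ e0'); apply: filterS => k.
  rewrite !sub0r !normrN !ger0_norm ?powR_ge0// => we.
  have -> : e = (e `^ p^-1) `^ p by rewrite -powRrM mulVf ?gt_eqF// powRr1// ltW.
  by apply: gt0_ltr_powR; rewrite ?nnegrE// ltW.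
have cv : {for v, continuous (fun x : R => x `^ p)}.
  apply: differentiable_continuous; apply/derivable1_diffP.
  by apply: derivable_powR; rewrite in_itv/= v0.
exact: (cvg_comp _ _ wv cv).
Qed.

Lemma cvg_rlogr (w : nat -> R) (v : R) : 0 < v -> w @ \oo --> v ->
  (fun k => w k * ln (w k)) @ \oo --> v * ln v.
Proof.
move=> v0 wv; apply: cvgM => //.
exact: (cvg_comp _ _ wv (continuous_ln v0)).
Qed.

Lemma le_limn_einf (f : nat -> \bar R) (a : R) :
  (forall c : R, c < a -> \forall k \near \oo, (c%:E <= f k)%E) -> (a%:E <= limn_einf f)%E.
Proof.
move=> H; rewrite limn_einf_lim; apply/lee_subgt0Pr => e e0.
have [N _ HN] : \forall k \near \oo, ((a - e)%:E <= f k)%E by apply: H; lra.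
apply: lime_ge; first exact: is_cvg_einfs.
exists N => // k /= Nk; rewrite -EFinB; apply: le_ereal_inf_tmp => _ [j /= kj <-].
by apply: HN => /=; exact: leq_trans kj.
Qed.

End real_tools.

(* An ultrafilter on nat gives simultaneous cluster values at all points. *)
Lemma pointwise_cluster (R : realType) (T : eqType) (D : set T) (w : nat -> T -> R) (C : T -> R) :
  (forall k x, D x -> 0 <= w k x <= C x) ->
  exists v : T -> R, forall (s : seq T) (e : R) (N : nat), {in s, forall x, D x} -> 0 < e ->
    exists2 k, (N <= k)%N & {in s, forall x, `|w k x - v x| < e}.
Proof.
move=> wC; have [U [uU oU]] := ultraFilterLemma (@eventually_filter).
have H x : exists v : R, D x -> forall e : R, 0 < e -> U [set k | `|w k x - v| < e].
  have [Dx|nDx] := pselect (D x); last by exists 0.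
  have FU : ProperFilter (w ^~ x @ U) by exact: fmap_proper_filter.
  have cU : (w ^~ x @ U) `[0, C x]%classic.
    apply: (@filterS _ U _ setT); last exact: filterT.
    by move=> k _ /=; rewrite in_itv /=; exact: wC.
  have [v [_ cv]] := @segment_compact R 0 (C x) _ FU cU.
  exists v => _ e e0; have [//|nU] := in_ultra_setVsetC [set k | `|w k x - v| < e] uU.
  have [y [yA yB]] := cv [set y | ~ `|y - v| < e] (ball v e) nU (nbhsx_ballx _ _ e0).
  by exfalso; apply: yA; rewrite distrC.
have [v Hv] := choice H; exists v => s e N sD e0.
have : U [set k | {in s, forall x, `|w k x - v x| < e}].
  elim: s sD => [|x s IH] sD; first by apply: filterS filterT => k _ y.
  have Ds : {in s, forall x, D x} by move=> y ys; apply: sD; rewrite inE ys orbT.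
  have Dx : D x by apply: sD; rewrite inE eqxx.
  apply: filterS (filterI (Hv x Dx e e0) (IH Ds)) => k [kx ks] y.
  by rewrite inE => /orP[/eqP ->|/ks].
have UN : U [set k | (N <= k)%N] by apply: oU; exists N.
by move=> /(filterI UN) /filter_ex[k [Nk ks]]; exists k.
Qed.

Section convex_real.
Context {R : realType} {n : nat}.
Local Notation V := 'rV[R]_n.

(** Extend the chord from x to y on both sides to points [x1] and [x2] at distance r/2 from x. Then
    y lies on [x, x1] with parameter [th], and x on [y, x2] with parameter th/(1+th); convexity
    bounds the difference in each direction by th C. *)
Lemma convex_lipschitz (f : V -> R) (x : V) (r C : R) : 0 < r ->
  (forall y z t, ball x r y -> ball x r z -> 0 <= t <= 1 ->
     f ((1 - t) *: y + t *: z) <= (1 - t) * f y + t * f z) ->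
  (forall y, ball x r y -> 0 <= f y <= C) ->
  forall y, `|x - y| < r / 2 -> `|f x - f y| <= 2 * C / r * `|x - y|.
Proof.
move=> r0 cf fC y yr; have [->|xy] := eqVneq x y.
  by rewrite !subrr !normr0 mulr0.
set d := `|x - y|; have d0 : 0 < d by rewrite normr_gt0 subr_eq0.
pose th := 2 * d / r; have th0 : 0 < th by rewrite divr_gt0// mulr_gt0.
have th1 : th < 1 by rewrite ltr_pdivrMr// mul1r /d; lra.
have bx : ball x r x by exact: ballxx.
have dir s : `|s| = th^-1 -> ball x r (x + s *: (y - x)).
  move=> sth; rewrite -ball_normE /= opprD addrA subrr sub0r normrN normrZ sth.
  rewrite distrC -/d /th invf_div mulrC mulrA ltr_pdivrMr ?mulr_gt0//.
  by rewrite mulrC ltr_pM2l//; lra.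
have nth : `|th^-1| = th^-1 by rewrite ger0_norm// invr_ge0 ltW.
pose x1 := x + th^-1 *: (y - x); pose x2 := x + (- th^-1) *: (y - x).
have b1 : ball x r x1 by exact: dir.
have b2 : ball x r x2 by apply: dir; rewrite normrN.
have by_ : ball x r y by rewrite -ball_normE /=; lra.
have y1 : (1 - th) *: x + th *: x1 = y.
  by rewrite /x1; apply/rowP => i; rewrite !mxE; field; rewrite gt_eqF.
have x12 : (1 - th / (1 + th)) *: y + (th / (1 + th)) *: x2 = x.
  by rewrite /x2; apply/rowP => i; rewrite !mxE; field; rewrite !gt_eqF//; lra.
have t01 : 0 <= th <= 1 by lra.
have t01' : 0 <= th / (1 + th) <= 1.
  by apply/andP; split; [apply: divr_ge0; lra|rewrite ler_pdivrMr; lra].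
have := cf _ _ _ bx b1 t01; rewrite y1 => h1.
have := cf _ _ _ by_ b2 t01'; rewrite x12 => h2.
have := fC _ bx; have := fC _ b1; have := fC _ b2; have := fC _ by_ => fy f2 f1 fx.
have -> : 2 * C / r * d = th * C by rewrite /th; ring.
have h2' : (1 + th) * f x <= f y + th * f x2.
  have e1 : (1 + th) * ((1 - th / (1 + th)) * f y + th / (1 + th) * f x2) = f y + th * f x2.
    by field; rewrite gt_eqF//; lra.
  by rewrite -e1 ler_pM2l//; lra.
by rewrite ler_norml; apply/andP; split; nra.
Qed.

(* The strict bounds a, b avoid extended-valued powers. *)
Lemma log_convex_onP (P : set V) (u : V -> \bar R) :
  (forall x, P x -> (0 < u x)%E) ->
  (forall x y t (a b : R), P x -> P y -> 0 <= t <= 1 -> (u x < a%:E)%E -> (u y < b%:E)%E ->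
     (u ((1 - t) *: x + t *: y)%R <= (a `^ (1 - t) * b `^ t)%:E)%E) ->
  log_convex_on P u.
Proof.
move=> u0 H x y Px Py t t01; case/andP: (t01) => t0 t1.
have [->|tN0] := eqVneq t 0.
  by rewrite subr0 scale1r scale0r addr0 poweRe0 mule1 poweRe1// ltW// u0.
have [->|tN1] := eqVneq t 1.
  by rewrite subrr scale1r scale0r add0r poweRe0 mul1e poweRe1// ltW// u0.
have tp : 0 < t by rewrite lt_neqAle eq_sym tN0.
have tq : 0 < 1 - t by rewrite subr_gt0 lt_neqAle tN1.
have := H x y t; have := u0 _ Px; have := u0 _ Py.
case: (u x) => [r| |] // ; case: (u y) => [s| |] // s0 r0 h.
- rewrite lte_fin in s0 r0; rewrite !poweR_EFin -EFinM.
  apply/lee_addgt0Pr => e e0; set X := r `^ (1 - t) * s `^ t.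
  have X0 : 0 < X by rewrite mulr_gt0// powR_gt0.
  pose c := 1 + e / X; have c1 : 1 < c by rewrite ltrDl divr_gt0.
  have c0 : 0 < c by lra.
  have := h (c * r) (c * s) Px Py t01; rewrite !lte_fin !ltr_pMl// => /(_ c1 c1).
  have cc : c `^ (1 - t) * c `^ t = c.
    rewrite -powRD; last by rewrite subrK oner_eq0.
    by rewrite subrK powRr1// ltW.
  have cr : (c * r) `^ (1 - t) = c `^ (1 - t) * r `^ (1 - t) by rewrite powRM// ltW.
  have cs : (c * s) `^ t = c `^ t * s `^ t by rewrite powRM// ltW.
  move/le_trans; apply; rewrite -EFinD lee_fin cr cs mulrACA cc -/X.
  by rewrite /c mulrDl mul1r divfK// gt_eqF.
- by rewrite poweRyr ?gt_eqF// gt0_muley ?leey// poweR_gt0.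
- by rewrite poweRyr ?gt_eqF// gt0_mulye ?leey// poweR_gt0.
- by rewrite !poweRyr ?gt_eqF// mulyy leey.
Qed.

End convex_real.

Lemma rat_dense (R : realType) (n : nat) (x : 'rV[R]_n) (e : R) : 0 < e ->
  exists c : 'rV[rat]_n, ball x e (map_mx ratr c).
Proof.
move=> e0; have Hc i : exists c : rat, `|x ord0 i - ratr c| < e.
  have xr : x ord0 i - e < x ord0 i + e by lra.
  have [c cx] := rat_in_itvoo xr; exists c.
  move: cx; rewrite in_itv /= => /andP[c1 c2].
  by rewrite ltr_norml; apply/andP; split; lra.
have [c Hc'] := choice Hc; exists (\row_i c i).
by apply/rV_ballE => // i; rewrite !mxE.
Qed.

Section interior_values.
Context {R : realType} {n : nat}.
Local Notation V := 'rV[R]_n.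
Variables (P : set V) (mu sigma : {measure set V -> \bar R}).
Hypotheses (n2 : (2 <= n)%N) (hS : is_system P mu sigma).
Let hP : is_polytope P := (hS.1).1.

Lemma interior_convex x y (t : R) : P° x -> P° y -> 0 <= t <= 1 ->
  P° ((1 - t) *: x + t *: y).
Proof.
move=> Px Py /andP[t0]; rewrite le_eqVlt => /orP[/eqP ->|t1].
  by rewrite subrr scale0r scale1r add0r.
by apply: interior_segment => //; [rewrite t0|exact: (interior_subset Py)].
Qed.

Lemma admissible_interior_fin u (W : R) x : admissible P u -> 0 < W ->
  (\int[sigma]_(x in P `\` P°) u x <= W%:E)%E -> P° x ->
  u x = (fine (u x))%:E /\ 0 < fine (u x).
Proof.
move=> au W0 uW Px; have [d d0 xd] := interior_ball Px.
have [C C0 HC] := pointwise_bound n2 hS.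
have h := HC _ _ _ _ au W0 uW d0 xd; have [_ u0 _] := au.
have u0x := u0 x (interior_subset Px).
have ufin : u x \is a fin_num by rewrite ge0_fin_numE ?ltW// (le_lt_trans h)// ltry.
by rewrite fineK//; split => //; rewrite fine_gt0// u0x (le_lt_trans h)// ltry.
Qed.

Lemma interior_log_convex u (W : R) x y t : admissible P u -> 0 < W ->
  (\int[sigma]_(x in P `\` P°) u x <= W%:E)%E -> P° x -> P° y -> 0 <= t <= 1 ->
  fine (u ((1 - t) *: x + t *: y)) <= fine (u x) `^ (1 - t) * fine (u y) `^ t.
Proof.
move=> au W0 uW Px Py t01.
have [ux ux0] := admissible_interior_fin au W0 uW Px.
have [uy uy0] := admissible_interior_fin au W0 uW Py.
have [uz _] := admissible_interior_fin au W0 uW (interior_convex Px Py t01).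
rewrite -lee_fin -uz; apply: (log_convex_le au (interior_subset Px) (interior_subset Py) t01).
- by rewrite -ux.
- by rewrite -uy.
Qed.

(** The point is that [r] and [L] do not depend on u: [pointwise_bound] is uniform on a small ball
    about x, and log-convex functions are convex by [powR_amgm]. *)
Lemma interior_equilipschitz (W : R) x : 0 < W -> P° x ->
  exists r L : R, [/\ 0 < r, 0 <= L & forall u, admissible P u ->
    (\int[sigma]_(x in P `\` P°) u x <= W%:E)%E ->
    forall y, `|x - y| < r -> P° y /\ `|fine (u x) - fine (u y)| <= L * `|x - y| ].
Proof.
move=> W0 Px; have [d d0 xd] := interior_ball Px.
have [C C0 HC] := pointwise_bound n2 hS.
pose r := d / 2; have r0 : 0 < r by rewrite divr_gt0.
pose B := C * W / r ^+ n.-1.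
have B0 : 0 <= B.
  by apply: divr_ge0; [apply: mulr_ge0; exact: ltW|apply: exprn_ge0; exact: ltW].
exists (r / 2), (2 * B / r); split; first by rewrite divr_gt0.
  by apply: divr_ge0; [rewrite mulr_ge0|exact: ltW].
move=> u au uW y yr.
have sub z : ball x r z -> ball z r `<=` P.
  move=> xz z' zz'; apply: xd; have -> : d = r + r by rewrite /r; lra.
  exact: ball_triangle xz zz'.
have int z : ball x r z -> P° z.
  by move=> xz; apply: (ball_interior (sub z xz)); exact: ballxx.
split; first by apply: int; rewrite -ball_normE /=; lra.
apply: (@convex_lipschitz R n (fun x => fine (u x)) x r B) => //.
- move=> y1 z t hy hz t01.
  have [_ uy] := admissible_interior_fin au W0 uW (int _ hy).
  have [_ uz] := admissible_interior_fin au W0 uW (int _ hz).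
  apply: le_trans (interior_log_convex au W0 uW (int _ hy) (int _ hz) t01) _.
  exact: powR_amgm.
- move=> z hz; have [uz uz0] := admissible_interior_fin au W0 uW (int _ hz).
  rewrite (ltW uz0) /= -lee_fin -uz; exact: (HC _ _ _ _ au W0 uW r0 (sub _ hz)).
Qed.

(** The index [phi j] brings the values at the first j+1 rational points within 1/(j+1) of a cluster
    value; the common local Lipschitz bound carries convergence from these points to the whole
    interior. [phi] need not be increasing: j <= phi j is enough for a minimizing sequence. *)
Lemma convergent_subsequence (u_ : nat -> V -> \bar R) (W : R) : 0 < W ->
  (forall k, admissible P (u_ k)) ->
  (forall k, (\int[sigma]_(x in P `\` P°) u_ k x <= W%:E)%E) ->
  exists (phi : nat -> nat) (v : V -> R), (forall j, (j <= phi j)%N) /\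
    forall x, P° x -> (fun j => fine (u_ (phi j) x)) @ \oo --> v x.
Proof.
move=> W0 au uW; pose w k x := fine (u_ k x).
have wpos k x : P° x -> 0 <= w k x.
  by move=> Px; have [_ /ltW] := admissible_interior_fin (au k) W0 (uW k) Px.
have [C HC] : exists C : V -> R, forall k x, P° x -> 0 <= w k x <= C x.
  have [K K0 HK] := pointwise_bound n2 hS.
  have H x : exists c : R, P° x -> forall k, w k x <= c.
    have [Px|nPx] := pselect (P° x); last by exists 0.
    have [d d0 xd] := interior_ball Px; exists (K * W / d ^+ n.-1) => _ k.
    have [ux _] := admissible_interior_fin (au k) W0 (uW k) Px.
    by rewrite -lee_fin /w -ux; exact: HK.
  have [c Hc] := choice H; exists c => k x Px; rewrite wpos//=; exact: Hc.
have [v Hv] := pointwise_cluster HC.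
(* An enumeration of the rational points; codes that decode to nothing give 0, and points outside
   the interior are skipped by the guard in [Hphi]. *)
pose d (i : nat) : V := if unpickle i is Some c then map_mx ratr (c : 'rV[rat]_n) else 0.
have dense x (e : R) : 0 < e -> exists i, `|x - d i| < e.
  move=> e0; have [c xc] := rat_dense x e0; exists (pickle c).
  by rewrite /d pickleK; move: xc; rewrite -ball_normE.
have Hphi j : exists k, (j <= k)%N /\ forall i, (i <= j)%N -> P° (d i) ->
    `|w k (d i) - v (d i)| < j.+1%:R^-1.
  have [||k jk Hk] := Hv [seq d i | i <- iota 0 j.+1 & `[< P° (d i) >]] j.+1%:R^-1 j _ _.
  - by move=> x /mapP[i]; rewrite mem_filter => /andP[/asboolP Pi _] ->.
  - by rewrite invr_gt0.
  exists k; split => // i ij Pi; apply: Hk; apply/mapP; exists i => //.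
  by rewrite mem_filter mem_iota /= add0n ltnS ij andbT; apply/asboolP.
have [phi Hphi'] := choice Hphi; exists phi, v; split=> [j|x Px]; first exact: (Hphi' j).1.
apply/cvgrPdist_lt => e e0.
have [r [L [r0 L0 HL]]] := interior_equilipschitz W0 Px.
have wL k y : `|x - y| < r -> P° y /\ `|w k x - w k y| <= L * `|x - y|.
  exact: (HL _ (au k) (uW k)).
(* Cluster values at x and y are attained approximately by one and the same index, so [v] inherits
   the Lipschitz bound. *)
have vL y : `|x - y| < r -> `|v x - v y| <= L * `|x - y|.
  move=> xy; have Py := (wL 0%N y xy).1; apply/ler_addgt0Pr => z z0.
  have z20 : 0 < z / 2 by rewrite divr_gt0.
  have [|k _ Hk] := Hv [:: x; y] (z / 2) 0%N _ z20.
    by move=> t; rewrite !inE => /orP[]/eqP ->.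
  have hx : `|w k x - v x| < z / 2 by apply: Hk; rewrite !inE eqxx.
  have hy : `|w k y - v y| < z / 2 by apply: Hk; rewrite !inE eqxx orbT.
  have hxy := (wL k y xy).2.
  have -> : v x - v y = (w k x - w k y) - (w k x - v x) + (w k y - v y) by ring.
  apply: le_trans (ler_normD _ _) _.
  have := ler_normB (w k x - w k y) (w k x - v x); lra.
pose s := Num.min r (e / 4 / (L + 1)).
have s0 : 0 < s by rewrite lt_min r0 !divr_gt0//; lra.
have [i xi] := dense x s s0.
have xir : `|x - d i| < r by apply: lt_le_trans xi _; rewrite ge_min lexx.
have xie : L * `|x - d i| <= e / 4.
  have : `|x - d i| <= e / 4 / (L + 1) by apply: le_trans (ltW xi) _; rewrite ge_min lexx orbT.
  rewrite ler_pdivlMr; last by lra.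
  by have := normr_ge0 (x - d i); nra.
have Pi := (wL 0%N _ xir).1.
have e40 : 0 < e / 4 by rewrite divr_gt0.
near=> j.
have [_ /(_ i) hj] := Hphi' j.
have ij : (i <= j)%N by near: j; exact: nbhs_infty_ge.
have {}hj := hj ij Pi.
have je : j.+1%:R^-1 < e / 4 by near: j; exact: (near_infty_natSinv_lt (PosNum e40)).
have h1 := le_trans (vL _ xir) xie; have h2 := le_trans (wL (phi j) _ xir).2 xie.
rewrite -/(w (phi j) x).
have -> : v x - w (phi j) x = (v x - v (d i)) - (w (phi j) x - w (phi j) (d i)) - (w (phi j) (d i) - v (d i)) by ring.
apply: le_lt_trans (ler_normB _ _) _.
apply: (@le_lt_trans _ _ (e / 4 + e / 4 + e / 4)); last by lra.
apply: lerD; last exact: le_trans (ltW hj) (ltW je).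
by apply: le_trans (ler_normB _ _) _; exact: lerD.
Unshelve. all: by end_near. Qed.

End interior_values.

(** * The limit function *)

Section interior_limit.
Context {R : realType} {n : nat}.
Local Notation V := 'rV[R]_n.
Variables (P : set V) (mu sigma : {measure set V -> \bar R}).
Hypotheses (n2 : (2 <= n)%N) (hS : is_system P mu sigma).
Let hP : is_polytope P := (hS.1).1.
Let lmu : lebesgue_like mu := (hS.2).1.
Let mP : measurable P := is_polytope_measurable hP.
Let mPo : measurable (P°) := measurable_interior P.
Local Notation p := (n%:R / (n%:R - 1) : R).

Lemma integral_interior (f : V -> \bar R) : measurable_fun P f ->
  (forall x, P x -> 0 <= f x)%E -> (\int[mu]_(x in P) f x = \int[mu]_(x in P°) f x)%E.
Proof.
move=> mf f0; rewrite (@ge0_negligible_integral _ _ _ mu P (P `\` P°))//; last 2 first.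
- exact: measurable_boundary.
- exact: boundary_null.
congr (integral _ _ _); rewrite setDD; apply/setIidPr; exact: interior_subset.
Qed.

Variables (u_ : nat -> V -> \bar R) (W : R) (v : V -> R).
Hypotheses (W1 : 1 <= W) (au : forall k, admissible P (u_ k)).
Hypothesis um : forall k, (\int[mu]_(x in P) u_ k x = mu P)%E.
Hypothesis uW : forall k, (\int[sigma]_(x in P `\` P°) u_ k x <= W%:E)%E.
Hypothesis uv : forall x, P° x -> (fun k => fine (u_ k x)) @ \oo --> v x.

Let W0 : 0 < W. Proof. by apply: lt_le_trans W1. Qed.
Let fin k x (Px : P° x) := admissible_interior_fin n2 hS (au k) W0 (uW k) Px.

Lemma limit_ge0 x : P° x -> 0 <= v x.
Proof.
move=> Px; apply: (ler_cvg_to (cvg_cst (0 : R)) (uv Px)).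
by apply: nearW => k; have [_ /ltW] := fin k Px.
Qed.

(** Strict upper bounds pass to the sequence eventually. They are also all that is known of the
    nearby points produced by [envelope_lt]. *)
Lemma limit_log_convex x y t (a b : R) : P° x -> P° y -> 0 <= t <= 1 -> v x < a -> v y < b ->
  v ((1 - t) *: x + t *: y) <= a `^ (1 - t) * b `^ t.
Proof.
move=> Px Py t01 xa yb; have Pz := interior_convex hS Px Py t01.
apply: (ler_cvg_to (uv Pz) (cvg_cst (a `^ (1 - t) * b `^ t))).
near=> k; apply: le_trans (interior_log_convex n2 hS (au k) W0 (uW k) Px Py t01) _.
have xk : fine (u_ k x) < a by near: k; exact: (cvgr_lt _ (uv Px)).
have yk : fine (u_ k y) < b by near: k; exact: (cvgr_lt _ (uv Py)).
have [_ x0] := fin k Px; have [_ y0] := fin k Py; case/andP: t01 => t0 t1.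
apply: ler_pM; rewrite ?powR_ge0//; apply: ge0_ler_powR; rewrite ?nnegrE ?subr_ge0//; lra.
Unshelve. all: by end_near. Qed.

Lemma limit_lipschitz x : P° x -> exists r L : R, [/\ 0 < r, 0 <= L &
  forall y, `|x - y| < r -> P° y /\ `|v x - v y| <= L * `|x - y| ].
Proof.
move=> Px; have [r [L [r0 L0 HL]]] := interior_equilipschitz n2 hS W0 Px.
exists r, L; split => // y xy; have Py := (HL _ (au 0) (uW 0) y xy).1; split => //.
have cn : (fun k => `|fine (u_ k x) - fine (u_ k y)|) @ \oo --> `|v x - v y|.
  by apply: cvg_norm; apply: cvgB; exact: uv.
apply: (ler_cvg_to cn (cvg_cst (L * `|x - y|))).
by apply: nearW => k; exact: (HL _ (au k) (uW k) y xy).2.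
Qed.

Lemma limit_bounded x : P° x -> exists r B : R, [/\ 0 < r, 0 < B &
  forall y, ball x r y -> P° y /\ v y <= B].
Proof.
move=> Px; have [r [L [r0 L0 HL]]] := limit_lipschitz Px.
exists r, (v x + L * r + 1); split => //.
  have := limit_ge0 Px; have : 0 <= L * r by rewrite mulr_ge0// ltW.
  by lra.
move=> y; rewrite -ball_normE /= => xy; have [Py h] := HL y xy; split => //.
have : `|v x - v y| <= L * r by apply: le_trans h _; rewrite ler_wpM2l// ltW.
by rewrite ler_norml => /andP[]; lra.
Qed.

Let mw k : measurable_fun (P°) (fun x => fine (u_ k x)).
Proof.
apply: measurableT_comp => //; apply: measurable_funS mP _ _; first exact: interior_subset.
by have [lu _ _] := au k; exact: admissible_measurable.
Qed.

Lemma measurable_limit : measurable_fun (P°) v.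
Proof. exact: (measurable_fun_cvg mw uv). Qed.

Let Poo : (mu P < +oo)%E. Proof. by have /andP[] := is_polytope_measure hP lmu. Qed.

Let Poo' : (mu (P°) < +oo)%E.
Proof.
apply: le_lt_trans Poo; apply: le_measure; rewrite ?inE//; exact: interior_subset.
Qed.

Lemma limit_Lp : exists2 M : R, 0 <= M &
  (forall k, (\int[mu]_(x in P°) (fine (u_ k x) `^ p)%:E <= M%:E)%E) /\
  (\int[mu]_(x in P°) (v x `^ p)%:E <= M%:E)%E.
Proof.
have [C C0 HC] := Lp_boundary_estimate n2 hS.
exists (C * W `^ p); first by rewrite mulr_ge0 ?powR_ge0// ltW.
have wM k : (\int[mu]_(x in P°) (fine (u_ k x) `^ p)%:E <= (C * W `^ p)%:E)%E.
  apply: le_trans (HC _ _ (au k) W1 (uW k)).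
  rewrite integral_interior//.
  - rewrite le_eqVlt; apply/orP; left; apply/eqP; apply: eq_integral => x /set_mem Px.
    by have [ux _] := fin k Px; rewrite {2}ux.
  - apply: (measurableT_comp (measurable_poweR _)).
    by have [lu _ _] := au k; exact: admissible_measurable.
  - by move=> x _; exact: poweR_ge0.
split => //.
have [_ _ _ p1] := conjugate_exponent (R := R) n2.
have mpk k : measurable_fun (P°) (fun x => (fine (u_ k x) `^ p)%:E).
  by apply/measurable_EFinP; apply: (measurableT_comp (@measurable_powR R p) (mw k)).
have := @fatou _ _ _ mu (P°) mPo (fun k x => (fine (u_ k x) `^ p)%:E) mpk
  (fun k x _ => powR_ge0 _ _).
have -> : (\int[mu]_(x in P°) limn_einf (fun k => (fine (u_ k x) `^ p)%:E) =
    \int[mu]_(x in P°) (v x `^ p)%:E)%E.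
  apply: eq_integral => x /set_mem Px.
  suff /cvg_limn_einf_sup[-> _] : (fun k => (fine (u_ k x) `^ p)%:E) @ \oo --> (v x `^ p)%:E by [].
  apply: cvg_EFin; first exact: nearW.
  rewrite (_ : fine \o _ = fun k => fine (u_ k x) `^ p)//.
  apply: cvg_powR; [lra| |exact: limit_ge0|exact: uv].
  by move=> k; have [_ /ltW] := fin k Px.
move=> h; apply: le_trans h _.
rewrite limn_einf_lim.
apply: lime_le; first exact: is_cvg_einfs.
apply: nearW => k; apply: le_trans (wM k); apply: ereal_inf_lbound.
by exists k => /=; [exact: leqnn|].
Qed.

(** No mass escapes to the boundary: [integral_limit] for the identity, with uniform integrability
    from [self_le_powR]. *)
Lemma limit_mass : (\int[mu]_(x in P°) (v x)%:E = mu P)%E.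
Proof.
have [M M0 [wM vM]] := limit_Lp.
have [_ _ _ p1] := conjugate_exponent (R := R) n2.
have id_le (e : R) : 0 < e -> exists2 C : R, 0 <= C & forall r, 0 <= r -> `|idfun r| <= C + e * r `^ p.
  move=> e0; exists (e^-1 `^ (p - 1)^-1); first exact: powR_ge0.
  move=> r r0; rewrite ger0_norm//.
  by have := @self_le_powR R r%:E p e; rewrite lee_fin => /(_ r0 p1 e0).
have vi := phi_integrable (phi := idfun) mPo Poo' id_le measurable_limit measurable_limit limit_ge0 vM.
have w0 k x : P° x -> 0 <= fine (u_ k x) by move=> Px; have [_ /ltW] := fin k Px.
have := integral_limit mPo Poo' (phi := idfun) measurable_limit mw measurable_limit mw
  limit_ge0 w0 M0 vM wM uv id_le.
have wm k : (\int[mu]_(x in P°) (fine (u_ k x))%:E = mu P)%E.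
  rewrite -(um k) integral_interior//.
  - by apply: eq_integral => x /set_mem Px; have [<- _] := fin k Px.
  - by have [lu _ _] := au k; exact: admissible_measurable.
  - by have [_ u0 _] := au k; move=> x Px; exact/ltW/u0.
under eq_fun do rewrite wm.
move/(cvg_unique _ (cvg_cst (fine (mu P)))) => h.
have vf : (\int[mu]_(x in P°) (v x)%:E)%E \is a fin_num := integrable_fin_num mPo vi.
have Pf : mu P \is a fin_num by rewrite ge0_fin_numE.
rewrite -(fineK vf) -(fineK Pf); congr EFin; exact/esym/h.
Qed.

(** Positive mass gives a point z with v(z) > 0. Any x is opposite, through z, to a point z' near z
    where v is at most [B], so log-convexity at z prevents v(x) from being small. As [P] is bounded,
    one ratio [s] works for all x, and the bound is uniform. It yields positivity of the envelope up
    to the boundary and keeps r ln r away from 0. *)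
Lemma limit_lower_bound : exists2 c : R, 0 < c & forall x, P° x -> c <= v x.
Proof.
have [z [Pz vz]] : exists z, P° z /\ 0 < v z.
  apply: contrapT => /forallNP H.
  have := limit_mass; rewrite (eq_integral (fun=> 0%E)); last first.
    move=> x /set_mem Px; congr EFin; apply/eqP; rewrite eq_le limit_ge0// andbT leNgt.
    by apply/negP => v0; apply: (H x).
  by rewrite integral0 => m0; have /andP[] := is_polytope_measure hP lmu; rewrite -m0 ltxx.
have [r [B [r0 B0 zB]]] := limit_bounded Pz.
have [D D0 PD] := bounded_sub_ball (is_polytope_bounded hP).
pose s := r / (4 * D); have s0 : 0 < s by rewrite divr_gt0// mulr_gt0.
have s1 : 0 < 1 + s by lra.
pose t := (1 + s)^-1; have t0 : 0 < t by rewrite invr_gt0.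
have t1 : t < 1 by rewrite invf_lt1//; lra.
pose b := B + 1; have b0 : 0 < b by rewrite /b; lra.
have bt : 0 < b `^ t by exact: powR_gt0.
pose c := (v z / b `^ t) `^ (1 - t)^-1.
exists c; first by rewrite powR_gt0// divr_gt0.
move=> x Px; apply/ler_addgt0Pr => e e0.
pose z' := z + s *: (z - x).
have zz' : ball z r z'.
  rewrite -ball_normE /= /z' opprD addrA subrr sub0r normrN normrZ gtr0_norm//.
  have : `|z - x| < 2 * D.
    have := PD _ (interior_subset Px); have := PD _ (interior_subset Pz).
    rewrite -!ball_normE /= !sub0r !normrN => hz hx.
    by apply: le_lt_trans (ler_normB _ _) _; lra.
  rewrite -(ltr_pM2l s0) => /lt_trans; apply.
  have -> : s * (2 * D) = r / 2 by rewrite /s; field; rewrite gt_eqF.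
  lra.
have [Pz' vz'] := zB _ zz'.
have t01 : 0 <= t <= 1 by rewrite !ltW.
have xe : v x < v x + e by lra.
have vb : v z' < b by rewrite /b; lra.
have := limit_log_convex Px Pz' t01 xe vb.
have -> : (1 - t) *: x + t *: z' = z.
  by rewrite /z' /t; apply/rowP => i; rewrite !mxE; field; rewrite gt_eqF.
rewrite -ler_pdivrMr// => h.
have xe0 : 0 <= v x + e by have := limit_ge0 Px; lra.
have tq : 0 < 1 - t by lra.
have -> : v x + e = ((v x + e) `^ (1 - t)) `^ (1 - t)^-1.
  by rewrite -powRrM divff ?gt_eqF// powRr1.
by apply: ge0_ler_powR => //; rewrite ?nnegrE ?powR_ge0 ?invr_ge0 ?divr_ge0// ?ltW.
Qed.

End interior_limit.

Lemma common_scale (R : realFieldType) (a b e f : R) : 0 <= a -> 0 <= b -> 0 < e -> 0 < f ->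
  exists s, [/\ 0 < s, s <= 1, s * a < e & s * b < f].
Proof.
move=> a0 b0 e0 f0; have ae : 0 <= a / e by rewrite divr_ge0// ltW.
have bf : 0 <= b / f by rewrite divr_ge0// ltW.
exists (1 + a / e + b / f)^-1; have K0 : 0 < 1 + a / e + b / f by lra.
split; first by rewrite invr_gt0.
- by rewrite invf_le1//; lra.
- rewrite mulrC ltr_pdivrMr// -ltr_pdivrMl// mulrC; lra.
- rewrite mulrC ltr_pdivrMr// -ltr_pdivrMl// mulrC; lra.
Qed.

Section envelope.
Context {R : realType} {n : nat}.
Local Notation V := 'rV[R]_n.

(* The lower limit of v(z) as z in D tends to y. *)
Definition envelope (D : set V) (v : V -> R) (y : V) : \bar R :=
  ereal_sup [set a%:E | a in [set a | exists2 e : R, 0 < e &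
    forall z, D z -> `|y - z| < e -> a <= v z]].

Variables (D : set V) (v : V -> R).

Lemma envelope_ge (a e : R) y : 0 < e -> (forall z, D z -> `|y - z| < e -> a <= v z) ->
  (a%:E <= envelope D v y)%E.
Proof. by move=> e0 H; apply: ereal_sup_ubound; exists a => //; exists e. Qed.

Lemma envelope_gt (a : R) y : (a%:E < envelope D v y)%E ->
  exists b e : R, [/\ a < b, 0 < e & forall z, D z -> `|y - z| < e -> b <= v z].
Proof.
by move=> /ereal_sup_gt[_ [b [e e0 H] <-]]; rewrite lte_fin => ab; exists b, e.
Qed.

Lemma envelope_lt (a : R) y : (envelope D v y < a%:E)%E -> forall e : R, 0 < e ->
  exists z, [/\ D z, `|y - z| < e & v z < a].
Proof.
move=> ya e e0; apply: contrapT => /forallNP H.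
move: ya; apply/negP; rewrite -leNgt; apply: (envelope_ge e0) => z Dz yz.
by rewrite leNgt; apply/negP => vz; apply: (H z).
Qed.

Lemma envelope_lsc (P : set V) : lsc_on P (envelope D v).
Proof.
move=> x _ a /envelope_gt[b [e [ab e0 H]]].
have e20 : 0 < e / 2 by lra.
exists (e / 2) => // y _ yx; apply: (@lt_le_trans _ _ b%:E); first by rewrite lte_fin.
apply: (envelope_ge e20) => z Dz yz; apply: H => //.
have := ler_distD y x z; rewrite (distrC x y); lra.
Qed.

Lemma envelope_continuous x (L r : R) : D x -> 0 < r -> 0 <= L ->
  (forall y, `|x - y| < r -> `|v x - v y| <= L * `|x - y|) ->
  envelope D v x = (v x)%:E.
Proof.
move=> Dx r0 L0 H; apply/eqP; rewrite eq_le; apply/andP; split.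
  apply: ub_ereal_sup => _ [a [e e0 ae] <-]; rewrite lee_fin; apply: ae => //.
  by rewrite subrr normr0.
apply/lee_subgt0Pr => d d0; rewrite -EFinB.
have [s [s0 s1 sL _]] := common_scale L0 (lexx 0) d0 d0.
have sr0 : 0 < Num.min s r by rewrite lt_min s0.
apply: (envelope_ge sr0) => z Dz; rewrite lt_min => /andP[xs xr].
have := H _ xr; rewrite ler_norml => /andP[_].
have : L * `|x - z| <= L * s by rewrite ler_wpM2l// ltW.
lra.
Qed.

End envelope.

Section envelope_limit.
Context {R : realType} {n : nat}.
Local Notation V := 'rV[R]_n.
Variables (P : set V) (mu sigma : {measure set V -> \bar R}).
Hypotheses (n2 : (2 <= n)%N) (hS : is_system P mu sigma).
Let hP : is_polytope P := (hS.1).1.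
Let lmu : lebesgue_like mu := (hS.2).1.
Let mP : measurable P := is_polytope_measurable hP.
Let mPo : measurable (P°) := measurable_interior P.
Local Notation p := (n%:R / (n%:R - 1) : R).

Let Poo : (mu P < +oo)%E. Proof. by have /andP[] := is_polytope_measure hP lmu. Qed.

Let Poo' : (mu (P°) < +oo)%E.
Proof.
apply: le_lt_trans Poo; apply: le_measure; rewrite ?inE//; exact: interior_subset.
Qed.

Lemma xlogx_integrable u (W : R) : admissible P u -> (\int[mu]_(x in P) u x = mu P)%E ->
  0 <= W -> (\int[sigma]_(x in P `\` P°) u x <= W%:E)%E ->
  mu.-integrable P (fun x => xlogx (u x)).
Proof.
move=> au um W0 uW; have [K K0 HK] := entropy_sublinear n2 hS (@ltr01 R).
have [lu u0 _] := au; apply/integrableP; split.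
  by apply: measurable_xlogx => //; [move=> x /u0/ltW|exact: admissible_measurable].
exact: le_lt_trans (HK _ _ au um W0 uW) (ltry _).
Qed.

Lemma xlogx_integral_interior u (W : R) : admissible P u ->
  (\int[mu]_(x in P) u x = mu P)%E ->
  0 < W -> (\int[sigma]_(x in P `\` P°) u x <= W%:E)%E ->
  (\int[mu]_(x in P) xlogx (u x) =
   \int[mu]_(x in P°) (fine (u x) * ln (fine (u x)))%:E)%E.
Proof.
move=> au um W0 uW; have ui := xlogx_integrable au um (ltW W0) uW.
rewrite (@negligible_integral _ _ _ mu P (P `\` P°))//; last 2 first.
- exact: measurable_boundary.
- exact: boundary_null.
have -> : P `\` (P `\` P°) = P°.
  by rewrite setDD; apply/setIidPr; exact: interior_subset.
apply: eq_integral => x /set_mem Px.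
by have [-> _] := admissible_interior_fin n2 hS au W0 uW Px.
Qed.

Variables (u_ : nat -> V -> \bar R) (W : R) (v : V -> R).
Hypotheses (W1 : 1 <= W) (au : forall k, admissible P (u_ k)).
Hypothesis um : forall k, (\int[mu]_(x in P) u_ k x = mu P)%E.
Hypothesis uW : forall k, (\int[sigma]_(x in P `\` P°) u_ k x <= W%:E)%E.
Hypothesis uv : forall x, P° x -> (fun k => fine (u_ k x)) @ \oo --> v x.
Let W0 : 0 < W. Proof. by apply: lt_le_trans W1. Qed.
Let fin k x (Px : P° x) := admissible_interior_fin n2 hS (au k) W0 (uW k) Px.
Local Notation u := (envelope (P°) v).

Lemma envelope_interior x : P° x -> u x = (v x)%:E.
Proof.
move=> Px; have [r [L [r0 L0 H]]] := limit_lipschitz n2 hS W1 au uW uv Px.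
by apply: (envelope_continuous Px r0 L0) => y /H[].
Qed.

Lemma envelope_gt0 x : (0 < u x)%E.
Proof.
have [c c0 H] := limit_lower_bound n2 hS W1 au um uW uv.
apply: (@lt_le_trans _ _ c%:E); first by rewrite lte_fin.
by apply: (envelope_ge ltr01) => z /H.
Qed.

(** Near x and y there are interior points where [v] is below [a] and [b]; their convex combination
    is just as near to that of x and y, so any local lower bound for [v] there is at most the
    product of powers. *)
Lemma envelope_log_convex : log_convex_on P u.
Proof.
apply: log_convex_onP; first by move=> x _; exact: envelope_gt0.
move=> x y t a b Px Py t01 xa yb; apply: ub_ereal_sup => _ [al [e e0 H] <-].
have [x' [Px' xx' vx']] := envelope_lt xa e0.
have [y' [Py' yy' vy']] := envelope_lt yb e0.
rewrite lee_fin.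
apply: le_trans (limit_log_convex n2 hS W1 au uW uv Px' Py' t01 vx' vy').
apply: H; first exact: (interior_convex hS).
rewrite (_ : _ - _ = (1 - t) *: (x - x') + t *: (y - y')); last first.
  by apply/rowP => i; rewrite !mxE; ring.
case/andP: t01 => t0 t1; apply: le_lt_trans (ler_normD _ _) _.
rewrite !normrZ (ger0_norm t0) ger0_norm ?subr_ge0//.
pose m := Num.max `|x - x'| `|y - y'|.
apply: (@le_lt_trans _ _ m); last by rewrite gt_max xx' yy'.
have xm : `|x - x'| <= m by rewrite le_max lexx.
have ym : `|y - y'| <= m by rewrite le_max lexx orbT.
nra.
Qed.

Lemma envelope_admissible : admissible P u.
Proof.
split; [exact: envelope_lsc| |exact: envelope_log_convex].
by move=> x _; exact: envelope_gt0.
Qed.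

Lemma envelope_mass : (\int[mu]_(x in P) u x = mu P)%E.
Proof.
have [lu u0 _] := envelope_admissible.
rewrite (integral_interior hS); first last.
- by move=> x /u0/ltW.
- exact: admissible_measurable.
rewrite -(limit_mass n2 hS W1 au um uW uv).
by apply: eq_integral => x /set_mem; exact: envelope_interior.
Qed.

(** At a boundary point the sequence need not converge, but it does at an interior point z = s x0 +
    (1-s) y close to y, with limit at least a. If u_k(y) <= c < a, convexity would give u_k(z) <= s
    B + c < (a+c)/2 once s B < (a-c)/2, contradicting the convergence at z. *)
Lemma envelope_le_liminf y : P y -> (u y <= limn_einf (fun k => u_ k y))%E.
Proof.
move=> Py; apply: ub_ereal_sup => _ [a [e e0 H] <-].
apply: le_limn_einf => c ca.
have [_ [[x0 Px0] _]] := hP.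
have [c0|c0] := leP c 0.
  apply: nearW => k; have [_ u0 _] := au k.
  by apply: le_trans (ltW (u0 _ Py)); rewrite lee_fin.
pose B := v x0 + 1.
have B0 : 0 < B by have := limit_ge0 n2 hS W1 au uW uv Px0; rewrite /B; lra.
have ac : 0 < (a - c) / 2 by lra.
have [s [s0 s1 sd sB]] := common_scale (normr_ge0 (y - x0)) (ltW B0) e0 ac.
pose z := (1 - (1 - s)) *: x0 + (1 - s) *: y.
have Pz : P° z by apply: interior_segment => //; apply/andP; split; lra.
have yz : `|y - z| < e.
  rewrite (_ : y - _ = s *: (y - x0)); first by rewrite normrZ gtr0_norm.
  by apply/rowP => i; rewrite !mxE; ring.
have az := H _ Pz yz.
near=> k; rewrite leNgt; apply/negP => kc.
have kB : fine (u_ k x0) < B.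
  by near: k; apply: (cvgr_lt _ (uv Px0)); rewrite /B; lra.
have kz : (a + c) / 2 < fine (u_ k z).
  by near: k; apply: (cvgr_gt _ (uv Pz)); lra.
have [x0E _] := fin k Px0; have [zE _] := fin k Pz.
have xB : (u_ k x0 <= B%:E)%E by rewrite x0E lee_fin ltW.
have s01 : 0 <= 1 - s <= 1 by apply/andP; split; lra.
have := log_convex_le (au k) (interior_subset Px0) Py s01 xB (ltW kc).
rewrite -/z zE lee_fin => h.
have := powR_amgm B0 c0 s01; nra.
Unshelve. all: by end_near. Qed.

Lemma envelope_energy : (\int[sigma]_(x in P `\` P°) u x <=
  limn_einf (fun k => \int[sigma]_(x in P `\` P°) u_ k x))%E.
Proof.
have mB : measurable (P `\` P°) by exact: measurable_boundary.
have mu_ k : measurable_fun (P `\` P°) (u_ k) by exact: (admissible_measurable_boundary hS).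
have u0 k x : (P `\` P°) x -> (0 <= u_ k x)%E.
  by move=> [Px _]; have [_ u0 _] := au k; exact/ltW/u0.
apply: le_trans (fatou sigma mB mu_ u0).
apply: ge0_le_integral => //.
- by move=> x [Px _]; have [_ h _] := envelope_admissible; exact/ltW/h.
- by apply: (admissible_measurable_boundary hS); exact: envelope_admissible.
- have -> : (fun x => limn_einf (u_^~ x)) = (fun x => - limn_esup (fun k => - u_ k x))%E.
    apply/funext => x; rewrite -limn_einfN; congr limn_einf.
    by apply/funext => k /=; rewrite oppeK.
  by apply: measurableT_comp => //; apply: measurable_fun_limn_esup => k; exact: measurableT_comp.
- by move=> x [Px _]; exact: envelope_le_liminf.
Qed.

Lemma envelope_energy_bound : (\int[sigma]_(x in P `\` P°) u x <= W%:E)%E.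
Proof.
apply: le_trans envelope_energy _; rewrite limn_einf_lim.
apply: lime_le; first exact: is_cvg_einfs.
apply: nearW => k; apply: le_trans (uW k); apply: ereal_inf_lbound.
by exists k => /=; [exact: leqnn|].
Qed.

(** A genuine limit rather than a one-sided bound, as needed when the sign of the temperature is
    arbitrary. *)
Lemma envelope_entropy : (fun k => fine (\int[mu]_(x in P) xlogx (u_ k x))) @ \oo -->
  fine (\int[mu]_(x in P) xlogx (u x)).
Proof.
have ue := xlogx_integral_interior envelope_admissible envelope_mass W0 envelope_energy_bound.
under eq_fun do rewrite (xlogx_integral_interior (au _) (um _) W0 (uW _)).
rewrite {}ue.
have -> : (\int[mu]_(x in P°) (fine (u x) * ln (fine (u x)))%:E =
    \int[mu]_(x in P°) (v x * ln (v x))%:E)%E.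
  by apply: eq_integral => x /set_mem Px; rewrite envelope_interior.
have [M M0 [wM vM]] := limit_Lp n2 hS W1 au uW uv.
have [_ _ _ p1] := conjugate_exponent (R := R) n2.
have mf : measurable_fun setT (fun r : R => r * ln r).
  by apply: measurable_funM => //; exact: measurable_ln.
have mw k : measurable_fun (P°) (fun x => fine (u_ k x)).
  apply: measurableT_comp => //; apply: measurable_funS mP _ _; first exact: interior_subset.
  by have [lu _ _] := au k; exact: admissible_measurable.
have mv := measurable_limit hS au uv.
have w0 k x : P° x -> 0 <= fine (u_ k x) by move=> Px; have [_ /ltW] := fin k Px.
have v0 x : P° x -> 0 <= v x := limit_ge0 n2 hS W1 au uW uv (x := x).
have [c c0 vc] := limit_lower_bound n2 hS W1 au um uW uv.
apply: (@integral_limit _ _ _ mu (P°) p M v (fun k x => fine (u_ k x)) (fun r => r * ln r)) => //.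
- exact: measurableT_comp.
- by move=> k; exact: measurableT_comp.
- by move=> x Px; apply: cvg_rlogr; [apply: lt_le_trans c0 (vc _ Px)|exact: uv].
- move=> eps e0; have [C C0 HC] := xlogx_le_powR p1 e0; exists C => // r r0.
  by have := HC r%:E; rewrite lee_fin => /(_ r0).
Qed.

End envelope_limit.

(** * Minimization *)

Section free_energy.
Context {R : realType} {n : nat}.
Local Notation V := 'rV[R]_n.
Variables (P : set V) (mu sigma : {measure set V -> \bar R}).
Hypotheses (n2 : (2 <= n)%N) (hS : is_system P mu sigma).
Let hP : is_polytope P := (hS.1).1.
Let lmu : lebesgue_like mu := (hS.2).1.
Let mP : measurable P := is_polytope_measurable hP.
Local Notation bint v := (\int[sigma]_(x in P `\` P°) v x)%E.
Local Notation xint v := (\int[mu]_(x in P) xlogx (v x))%E.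
Variable T : R.

Let m := fine (mu P).
Let mE : mu P = m%:E.
Proof. by have /andP[P0 Poo] := is_polytope_measure hP lmu; rewrite fineK// ge0_fin_numE. Qed.
Let m0 : 0 < m.
Proof. by have /andP[P0 _] := is_polytope_measure hP lmu; rewrite -lte_fin -mE. Qed.

(** The sign in front of [T] is plus because the entropy carries a minus. [fine] sends infinities to
    0, so the value is meaningful only when both integrals are finite, that is for finite boundary
    integral. *)
Let real_energy (v : V -> \bar R) := m^-1 * (fine (bint v) + T * fine (xint v)).

Lemma bint_ge0 v : admissible P v -> (0 <= bint v)%E.
Proof. by move=> [_ v0 _]; apply: integral_ge0 => x [/v0/ltW]. Qed.

(** The negative part is at most 1 since r ln r >= -1, and [mu P] is finite. Hence the entropy is
    never +oo, and no indeterminate difference arises in the free energy. *)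
Lemma xlogx_integral_neq v : admissible P v -> xint v != -oo%E.
Proof.
move=> [lv v0 _]; rewrite integralE.
have mx : measurable_fun P (fun x => xlogx (v x)).
  by apply: measurable_xlogx => //; [move=> x /v0/ltW|exact: admissible_measurable].
have h : (\int[mu]_(x in P) (fun x => xlogx (v x))^\- x <= mu P)%E.
  rewrite -[leRHS]mul1e -integral_cst//; apply: ge0_le_integral => //.
  - exact: measurable_funeneg.
  move=> x /v0; rewrite funenegE; case: (v x) => [r| |]//= r0.
    have := rlogr_ge (ltW r0); rewrite ge_max lee_fin !lee_fin ler01 andbT; lra.
  by rewrite ge_max leNye lee_fin ler01.
rewrite adde_eq_ninfty negb_or; apply/andP; split.
  by rewrite -ltNye; apply: lt_le_trans (ltNyr 0) _; exact: integral_ge0.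
by rewrite eqe_oppLR /= -ltey; apply: le_lt_trans h _; rewrite mE ltry.
Qed.

Lemma free_energy_pinfty v : admissible P v -> bint v = +oo%E ->
  free_energy P mu sigma T v = +oo%E.
Proof.
move=> av vy; rewrite /free_energy; case: ifPn => // eN.
rewrite /internal_energy vy gt0_muley ?lte_fin ?invr_gt0//.
have := xlogx_integral_neq av; move: eN; rewrite /entropy -/m.
case: (xint v) => [r| |]//.
by rewrite mulNe gt0_muley ?lte_fin ?invr_gt0// eqxx.
Qed.

Lemma free_energy_fin v (W : R) : admissible P v -> (\int[mu]_(x in P) v x = mu P)%E ->
  0 <= W -> (bint v <= W%:E)%E -> free_energy P mu sigma T v = (real_energy v)%:E.
Proof.
move=> av vm W0 vW; have xf := integrable_fin_num mP (xlogx_integrable n2 hS av vm W0 vW).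
have bf : bint v \is a fin_num.
  by rewrite ge0_fin_numE ?bint_ge0//; apply: le_lt_trans vW (ltry _).
rewrite /free_energy /entropy /internal_energy -/m -(fineK xf) -(fineK bf) /=.
by congr EFin; rewrite /real_energy; ring.
Qed.

(* With eta |T| <= 1/2 the entropy term absorbs at most half of the boundary integral. *)
Lemma boundary_le_energy : exists2 K : R, 0 <= K & forall v, admissible P v ->
  (\int[mu]_(x in P) v x = mu P)%E -> (bint v < +oo)%E ->
  fine (bint v) <= 2 * (m * real_energy v) + K.
Proof.
pose eta := (2 * (`|T| + 1))^-1.
have T1 : 0 < `|T| + 1 by rewrite ltr_wpDl.
have e0 : 0 < eta by rewrite invr_gt0 mulr_gt0.
have [K K0 HK] := entropy_sublinear n2 hS e0.
exists (2 * `|T| * K); first by rewrite !mulr_ge0.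
move=> v av vm vy; have b0 := bint_ge0 av.
have bf : bint v \is a fin_num by rewrite ge0_fin_numE.
have b0' : 0 <= fine (bint v) by exact: fine_ge0.
have vW : (bint v <= (fine (bint v))%:E)%E by rewrite fineK.
have vi := xlogx_integrable n2 hS av vm b0' vW.
have := HK v _ av vm b0' vW.
move/(le_trans (le_abse_integral _ mP (measurable_int _ vi))).
rewrite -{1}(fineK (integrable_fin_num mP vi)) lee_fin.
rewrite /real_energy mulVKf ?gt_eqF//.
set b := fine (bint v); set X := fine _ => h.
have h1 : - (`|T| * `|X|) <= T * X.
  by rewrite -normrM lerNl -normrN ler_norm.
have h2 : `|T| * `|X| <= `|T| * (eta * b + K) by rewrite ler_wpM2l.
have h3 : `|T| * (eta * b) <= b / 2.
  rewrite mulrA [leRHS]mulrC ler_wpM2r// /eta invfM mulrCA ger_pMr// ler_pdivrMr//; lra.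
move: h2; rewrite mulrDr; lra.
Qed.

Lemma Mp_admissible q v : Mp P mu q v -> admissible P v /\ (\int[mu]_(x in P) v x = mu P)%E.
Proof. by move=> [? [? [? [? _]]]]. Qed.

Lemma Mp_cst1 q : Mp P mu q (cst 1%E).
Proof.
split; first by move=> x _ a a1; exists 1.
split; first by move=> x _; rewrite lte01.
split; first by move=> x y _ _ t _; rewrite !poweR1r mule1.
rewrite integral_cst// mul1e; split => //.
by under eq_integral do rewrite poweR1r; rewrite integral_cst// mul1e mE ltry.
Qed.

Lemma free_energy_minimizer : exists u, Mp P mu (n%:R / (n%:R - 1)) u /\
  forall v, Mp P mu 1 v -> (free_energy P mu sigma T u <= free_energy P mu sigma T v)%E.
Proof.
pose A := [set r | exists v, [/\ Mp P mu 1 v, (bint v < +oo)%E & r = real_energy v]].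
have energy_ge v : Mp P mu 1 v -> (bint v < +oo)%E ->
    free_energy P mu sigma T v = (real_energy v)%:E.
  move=> /Mp_admissible[av vm] vy; have b0 := bint_ge0 av.
  apply: (free_energy_fin av vm (fine_ge0 b0)).
  by rewrite fineK// ge0_fin_numE.
have energy_y v : Mp P mu 1 v -> ~ (bint v < +oo)%E -> free_energy P mu sigma T v = +oo%E.
  move=> /Mp_admissible[av _] vy; apply: free_energy_pinfty => //.
  by apply/eqP; rewrite -leye_eq leNgt; apply/negP.
(* If no competitor has finite boundary integral, every free energy is +oo and any member of the
   class minimizes. *)
have [A0|/set0P A0] := eqVneq A set0.
  exists (cst 1%E); split; first exact: Mp_cst1.
  move=> v Mv; rewrite (energy_y v)// ?leey// => vy.
  suff : A (real_energy v) by rewrite A0.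
  by exists v.
have [K K0 HK] := boundary_le_energy.
have lbA : lbound A (- (m^-1 * K)).
  move=> _ [v [/Mp_admissible[av vm] vy ->]]; have := HK v av vm vy.
  have := fine_ge0 (bint_ge0 av) => b0 h.
  by rewrite -mulrN ler_pdivrMl//; lra.
have infA : has_inf A by split => //; exists (- (m^-1 * K)).
have seq k : exists v, [/\ Mp P mu 1 v, (bint v < +oo)%E & real_energy v < inf A + k.+1%:R^-1].
  have k0 : 0 < k.+1%:R^-1 :> R by rewrite invr_gt0.
  by have [_ [v [Mv vy ->]] h] := inf_adherent k0 infA; exists v.
have [v_ Hv] := choice seq.
have av k : admissible P (v_ k) by have [/Mp_admissible[]] := Hv k.
have vm k : (\int[mu]_(x in P) v_ k x = mu P)%E by have [/Mp_admissible[]] := Hv k.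
have vy k : (bint (v_ k) < +oo)%E by have [] := Hv k.
have vf k : bint (v_ k) \is a fin_num by rewrite ge0_fin_numE ?bint_ge0.
(* All energies in the sequence are below inf A + 1, so [boundary_le_energy] gives the second term;
   the maximum with 1 meets the requirement W >= 1 of the L^p estimate. *)
pose W := Num.max 1 (2 * (m * (inf A + 1)) + K).
have W1 : 1 <= W by rewrite le_max lexx.
have W0 : 0 < W by lra.
have vW k : (bint (v_ k) <= W%:E)%E.
  rewrite -(fineK (vf k)) lee_fin; apply: le_trans (HK _ (av k) (vm k) (vy k)) _.
  have [_ _ h] := Hv k; rewrite le_max; apply/orP; right.
  have k1 : k.+1%:R^-1 <= 1 :> R by rewrite invf_le1// ler1n.
  have : m * real_energy (v_ k) <= m * (inf A + 1) by rewrite ler_pM2l//; apply: ltW; apply: lt_le_trans h _; rewrite lerD2l.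
  lra.
have [phi [v [phi_le vv]]] := convergent_subsequence n2 hS W0 av vW.
pose u_ k := v_ (phi k); pose u := envelope (P°) v.
have au k : admissible P (u_ k) := av (phi k).
have um k : (\int[mu]_(x in P) u_ k x = mu P)%E := vm (phi k).
have uW k : (bint (u_ k) <= W%:E)%E := vW (phi k).
have uv x : P° x -> (fun k => fine (u_ k x)) @ \oo --> v x := vv x.
have aU : admissible P u := envelope_admissible n2 hS W1 au um uW uv.
have Um : (\int[mu]_(x in P) u x = mu P)%E := envelope_mass n2 hS W1 au um uW uv.
have UW : (bint u <= W%:E)%E := envelope_energy_bound n2 hS W1 au um uW uv.
have Uf : bint u \is a fin_num.
  by rewrite ge0_fin_numE ?bint_ge0//; apply: le_lt_trans UW (ltry _).
have energy_cvg : (fun k => real_energy (u_ k)) @ \oo --> inf A.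
  apply/cvgrPdist_lt => e e0.
  near=> k; have [Mk ky hk] := Hv (phi k).
  have lk : inf A <= real_energy (u_ k).
    by apply: ge_inf; [exists (- (m^-1 * K))|exists (v_ (phi k))].
  have kk : (phi k).+1%:R^-1 <= k.+1%:R^-1 :> R by rewrite lef_pV2 ?posrE// ler_nat ltnS.
  have ke : k.+1%:R^-1 < e by near: k; exact: near_infty_natSinv_lt (PosNum e0).
  rewrite distrC ger0_norm ?subr_ge0// ltrBlDl; apply: lt_le_trans hk _.
  by rewrite lerD2l ltW//; apply: le_lt_trans kk ke.
have X_cvg := envelope_entropy n2 hS W1 au um uW uv.
(* Energies and entropies both converge, so the boundary integrals converge too; the liminf in
   [envelope_energy] is then an explicit number, and the inequality says that the energy of [u] is
   at most [inf A]. *)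
have bint_cvg : (fun k => bint (u_ k)) @ \oo --> (m * inf A - T * fine (xint u))%:E.
  rewrite (_ : (fun k => _) = (fun k => (m * real_energy (u_ k) - T * fine (xint (u_ k)))%:E)).
    apply: cvg_EFin; first exact: nearW.
    by apply: cvgB; apply: cvgM => //; exact: cvg_cst.
  apply/funext => k; rewrite -[LHS](fineK (vf (phi k))); congr EFin.
  by rewrite /real_energy mulVKf ?gt_eqF// addrK.
have := envelope_energy n2 hS W1 au um uW uv.
rewrite (cvg_limn_einf_sup bint_cvg).1 -/u -(fineK Uf) lee_fin => uA.
exists u; split.
  (* The finite boundary integral of [u] alone gives the integrability of its power n/(n-1), by the
     same estimate as for the sequence. *)
  have [lu u0 lcu] := aU; do 4!split => //.
  have [C C0 HC] := Lp_boundary_estimate n2 hS.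
  exact: le_lt_trans (HC _ _ aU W1 UW) (ltry _).
move=> w Mw; have [wy|wy] := pselect (bint w < +oo)%E; last by rewrite (energy_y w)// leey.
rewrite (energy_ge w)// (free_energy_fin aU Um (ltW W0) UW) lee_fin.
apply: (@le_trans _ _ (inf A)).
  by rewrite /real_energy ler_pdivrMl//; lra.
by apply: ge_inf; [exists (- (m^-1 * K))|exists w].
Unshelve. all: by end_near. Qed.

End free_energy.

Unset Implicit Arguments.

Theorem mainTheorem10 (R : realType) (n : nat) (P : set 'rV[R]_n)
    (mu sigma : {measure set 'rV[R]_n -> \bar R}) :
  (2 <= n)%N -> is_system P mu sigma ->
  forall T : R, exists u : 'rV[R]_n -> \bar R,
    Mp P mu (n%:R / (n%:R - 1)) u /\
    forall v : 'rV[R]_n -> \bar R, Mp P mu 1 v ->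
      (free_energy P mu sigma T u <= free_energy P mu sigma T v)%E.
Proof. by move=> n2 hS T; exact: free_energy_minimizer. Qed.
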